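(* Fix an integer $M\ge1$ and a real $\alpha>0$. For $\theta>0$ let $\mathbf r\in\mathcal R^M$ be distributed according to $\mathbb P^{\alpha,M,\theta}$. For $N\ge1$ let $\mathcal J_N$ be the Jacobi orthogonal polynomial of degree $\min(N,M)$ corresponding to the weight function $x^{\alpha-1}(1-x)^{|M-N|}$ on $(0,1)$, and let $\mathfrak j^N_1<\dots<\mathfrak j^N_{\min(N,M)}$ be its roots in $(0,1)$, enumerated in increasing order. Then, as $\theta\to\infty$, $\mathbf r^N_i$ converges in probability to $\mathfrak j^N_i$ for all $N\ge 1$, $1\le i\le\min(N,M)$. Moreover, the random vector $$\sqrt\theta\,(\mathbf r^N_i-\mathfrak j^N_i),\qquad i=1,\dots,\min(N,M),\quad N=1,2,\dots,$$ converges (in finite-dimensional distributions) to a centered Gaussian random vector $\xi^N_i$, $i=1,\dots,\min(N,M)$, $N=1,2,\dots$.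
   Context: **The measure $\mathbb P^{\alpha,M,\theta}$.** Let $M\ge1$ be an integer, $\alpha,\theta>0$. $\mathcal R^M$ is the set of sequences $\mathbf r=(\mathbf r^1,\mathbf r^2,\dots)$, where $\mathbf r^N$ is a real sequence $0<\mathbf r^N_1<\dots<\mathbf r^N_{\min(N,M)}<1$ and $\mathbf r^N\prec\mathbf r^{N+1}$ for all $N$, i.e. $\mathbf r^{N+1}_1<\mathbf r^N_1<\mathbf r^{N+1}_2<\mathbf r^N_2<\cdots$. $\mathbb P^{\alpha,M,\theta}$ is the unique probability distribution on $\mathcal R^M$ such that: (1) for each $N\ge1$, $\mathbf r^N$ has density (in $z$, $0<z_1<\dots<z_{\min(N,M)}<1$) proportional to $\prod_{i<j}(z_j-z_i)^{2\theta}\prod_i z_i^{\theta\alpha-1}(1-z_i)^{\theta|M-N|+\theta-1}$; (2) $\{\mathbf r^N\}_{N\ge1}$ is a trajectory of a Markov chain whose backward transition density from $\mathbf r^N=y$ to $\mathbf r^{N-1}=z$ (supported on $z\prec y$) is, for $2\le N\le M$, $$\frac{\Gamma(N\theta)}{\Gamma(\theta)^N}\prod_{j=1}^Ny_j^{(N-1)\theta}\prod_{1\le i<j<N}(z_j-z_i)\prod_{1\le i<j\le N}(y_j-y_i)^{1-2\theta}\prod_{i=1}^{N-1}\prod_{j=1}^N|y_j-z_i|^{\theta-1}\prod_{i=1}^{N-1}z_i^{-N\theta},$$ and for $N>M$, $$\frac{\Gamma(N\theta)}{\Gamma(\theta)^M\Gamma(N\theta-M\theta)}\prod_{1\le i<j\le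 M}(z_j-z_i)(y_j-y_i)^{1-2\theta}\prod_{j=1}^My_j^{(N-1)\theta}(1-y_j)^{\theta(M-N-1)+1}\prod_{i,j=1}^M|y_j-z_i|^{\theta-1}\prod_{i=1}^M(1-z_i)^{\theta(N-M)-1}z_i^{-N\theta}.$$ *)

(* Defs.v *)
From HB Require Import structures.
From mathcomp Require Import all_boot all_order all_algebra.
From mathcomp Require Import all_classical all_reals all_analysis.
Set Implicit Arguments.
Unset Strict Implicit.
Unset Printing Implicit Defensive.
Import Order.TTheory GRing.Theory Num.Theory.
Import numFieldNormedType.Exports.
Local Open Scope classical_set_scope.
Local Open Scope ring_scope.

(* Lebesgue measure on R^k, obtained by transporting the product of the
   one-dimensional measures along R * R^k ~ R^(k+1). *)
Section lebesgue_tuple.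
Context {R : realType}.
Local Open Scope ereal_scope.

Definition tuple_cons k (p : measurableTypeR R * k.-tuple R) : k.+1.-tuple R :=
  [the k.+1.-tuple R of p.1 :: p.2].

Lemma measurable_tuple_cons k : measurable_fun setT (@tuple_cons k).
Proof. by apply: measurable_cons; [exact: measurable_fst|exact: measurable_snd]. Qed.

Definition lebesgue_consm k
  (mu : {sigma_finite_measure set (k.-tuple R) -> \bar R}) :
    set (k.+1.-tuple R) -> \bar R :=
  pushforward (lebesgue_measure \x mu) (@tuple_cons k).

Section instances.
Variables (k : nat) (mu : {sigma_finite_measure set (k.-tuple R) -> \bar R}).

Let lebesgue_consm0 : lebesgue_consm mu set0 = 0.
Proof. by rewrite /lebesgue_consm /pushforward preimage_set0 measure0. Qed.

Let lebesgue_consm_ge0 A : 0 <= lebesgue_consm mu A.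
Proof. by rewrite /lebesgue_consm /pushforward; exact: measure_ge0. Qed.

Let lebesgue_consm_sigma_additive : semi_sigma_additive (lebesgue_consm mu).
Proof.
move=> F mF tF mUF; rewrite /lebesgue_consm /pushforward preimage_bigcup.
have mc := @measurable_tuple_cons k.
apply: measure_semi_sigma_additive.
- by move=> n; rewrite -[X in measurable X]setTI; exact: mc.
- apply/trivIsetP => /= i j _ _ ij; rewrite -preimage_setI.
  by move/trivIsetP : tF => /(_ _ _ _ _ ij) ->//; rewrite preimage_set0.
- by rewrite -preimage_bigcup -[X in measurable X]setTI; exact: mc.
Qed.

HB.instance Definition _ := isMeasure.Build _ _ _ (lebesgue_consm mu)
  lebesgue_consm0 lebesgue_consm_ge0 lebesgue_consm_sigma_additive.

Let tuple_uncons (t : k.+1.-tuple R) : measurableTypeR R * k.-tuple R :=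
  (thead t, [tuple of behead t]).

Let consK : cancel (@tuple_cons k) tuple_uncons.
Proof.
case=> x t; congr pair; apply/val_inj => //=.
Qed.

Let measurable_uncons : measurable_fun setT tuple_uncons.
Proof.
apply/measurable_fun_pair; first exact: measurable_tnth.
exact: measurable_behead.
Qed.

Let lebesgue_consm_sigma_finite : sigma_finite setT (lebesgue_consm mu).
Proof.
have /sigma_finiteP[F [TF ndF Foo]] :=
  sigma_finiteT (@lebesgue_stieltjes_measure R idfun).
have /sigma_finiteP[G [TG ndG Goo]] := sigma_finiteT mu.
exists (fun n => tuple_uncons @^-1` (F n `*` G n)).
  apply/esym/seteqP; split=> // t _.
  have : [set: R] (tuple_uncons t).1 by [].
  have : [set: k.-tuple R] (tuple_uncons t).2 by [].
  rewrite TF TG => -[m _ Gm] [n _ Fn]; exists (maxn m n) => //; split.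
    by move: Fn; exact/subsetPset/ndF/leq_maxr.
  by move: Gm; exact/subsetPset/ndG/leq_maxl.
move=> n; have [mF ?] := Foo n; have [mG ?] := Goo n; split.
  rewrite -[X in measurable X]setTI.
  by apply: measurable_uncons => //; exact: measurableX.
rewrite /lebesgue_consm /pushforward -comp_preimage.
rewrite (_ : tuple_uncons \o _ = id) ?preimage_id; last first.
  by apply/funext => x /=; rewrite consK.
by rewrite product_measure1E// lte_mul_pinfty// ge0_fin_numE.
Qed.

HB.instance Definition _ := @Measure_isSigmaFinite.Build _ _ _
  (lebesgue_consm mu) lebesgue_consm_sigma_finite.

End instances.

Fixpoint lebesgue_tuple k : {sigma_finite_measure set (k.-tuple R) -> \bar R} :=
  match k with
  | 0 => [the {sigma_finite_measure set (0.-tuple R) -> \bar R} of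
            dirac ([tuple] : 0.-tuple R)]
  | k'.+1 => [the {sigma_finite_measure set (k'.+1.-tuple R) -> \bar R} of
                lebesgue_consm (lebesgue_tuple k')]
  end.

End lebesgue_tuple.

Section jacobi_corners.
Context {R : realType}.

(* 0 < z_1 < ... < z_k < 1 *)
Definition config01 k (z : k.-tuple R) : Prop :=
  (forall i, 0 < tnth z i < 1) /\
  (forall i j : 'I_k, (i < j)%N -> tnth z i < tnth z j).

(* z ≺ y, i.e. y_1 < z_1 < y_2 < z_2 < ...; used with l = k or l = k.+1. *)
Definition interlace k l (z : k.-tuple R) (y : l.-tuple R) : Prop :=
  forall (i : 'I_l) (j : 'I_k),
    (nat_of_ord i = j -> tnth y i < tnth z j) /\
    (nat_of_ord i = j.+1 -> tnth z j < tnth y i).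

(* The row N = 0 has no entries. *)
Definition interlacing_array (M : nat) (x : forall N, (minn N M).-tuple R) :
    Prop :=
  forall N, (1 <= N)%N -> config01 (x N) /\ interlace (x N) (x N.+1).

Definition Gamma (s : R) : R :=
  \int[lebesgue_measure]_(t in `]0, +oo[) (t `^ (s - 1) * expR (- t)).

(* \prod_(1 <= i < j <= k) (z_j - z_i)^s *)
Definition vandermonde_pow k (s : R) (z : k.-tuple R) : R :=
  \prod_(i < k) \prod_(j < k | (i < j)%N) (tnth z j - tnth z i) `^ s.

Definition jacobi_ensemble (alpha theta : R) (M N : nat)
    (z : (minn N M).-tuple R) : R :=
  vandermonde_pow (2 * theta) z *
  \prod_i (tnth z i `^ (theta * alpha - 1) *
    (1 - tnth z i) `^ (theta * `|M%:R - N%:R| + theta - 1)).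

(* The transition density from the N-th row y to the (N-1)-st row z. *)
Definition backward_density (theta : R) (M N : nat)
    (y : (minn N M).-tuple R) (z : (minn N.-1 M).-tuple R) : R :=
  if (N <= M)%N then
    Gamma (N%:R * theta) / Gamma theta ^+ N *
    \prod_j tnth y j `^ ((N%:R - 1) * theta) *
    vandermonde_pow 1 z * vandermonde_pow (1 - 2 * theta) y *
    \prod_i \prod_j `|tnth y j - tnth z i| `^ (theta - 1) *
    \prod_i tnth z i `^ (- (N%:R * theta))
  else
    Gamma (N%:R * theta) /
      (Gamma theta ^+ M * Gamma (N%:R * theta - M%:R * theta)) *
    (vandermonde_pow 1 z * vandermonde_pow (1 - 2 * theta) y) *
    \prod_j (tnth y j `^ ((N%:R - 1) * theta) *
      (1 - tnth y j) `^ (theta * (M%:R - N%:R - 1) + 1)) *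
    \prod_i \prod_j `|tnth y j - tnth z i| `^ (theta - 1) *
    \prod_i ((1 - tnth z i) `^ (theta * (N%:R - M%:R) - 1) *
      tnth z i `^ (- (N%:R * theta))).

(* The sigma-algebra generated by the rows N, N+1, N+2, ... *)
Definition upper_rows_sigma d (T : measurableType d) (M : nat)
    (x : forall N, T -> (minn N M).-tuple R) (N : nat) : set (set T) :=
  <<s \bigcup_(L in [set L | (N <= L)%N])
        preimage_set_system setT (x L) measurable >>.

(* The random array x has law P^{alpha,M,theta}. In the last clause the
   conditioning is on all rows N, N+1, ..., so the clause expresses both the
   Markov property and the form of the transition density. The support
   condition includes z in (0,1)^k, as z ≺ y alone does not bound the last
   entry of z when both rows have length M. *)
Definition jacobi_corners (alpha theta : R) (M : nat)
    d (T : measurableType d) (P : probability T R)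
    (x : forall N, {RV P >-> (minn N M).-tuple R}) : Prop :=
  [/\ forall w, interlacing_array (fun N => x N w),
      forall N, (1 <= N)%N -> exists2 c : R, 0 < c &
        forall B : set ((minn N M).-tuple R), measurable B ->
        P (x N @^-1` B) =
          (\int[lebesgue_tuple (minn N M)]_(z in B `&` [set z | config01 z])
             (c * jacobi_ensemble alpha theta z)%:E)%E
    & forall N, (2 <= N)%N ->
        forall (A : set T) (B : set ((minn N.-1 M).-tuple R)),
        upper_rows_sigma (fun L => x L : T -> _) N A -> measurable B ->
        P (A `&` x N.-1 @^-1` B) =
          (\int[P]_(w in A) \int[lebesgue_tuple (minn N.-1 M)]_(z in
              B `&` [set z | config01 z /\ interlace z (x N w)])
             (backward_density theta (x N w) z)%:E)%E].

End jacobi_corners.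

Section orthogonal_polynomials.
Context {R : realType}.

Definition jacobi_weight (alpha : R) (M N : nat) (x : R) : R :=
  x `^ (alpha - 1) * (1 - x) `^ `|M%:R - N%:R|.

(* p is the orthogonal polynomial of degree n (unique up to normalization)
   for the weight w on (0,1). *)
Definition orthogonal_poly (w : R -> R) (n : nat) (p : {poly R}) : Prop :=
  size p = n.+1 /\
  forall q : {poly R}, (size q <= n)%N ->
    \int[lebesgue_measure]_(x in `]0%R, 1%R[) (p.[x] * q.[x] * w x) = 0.

Definition enumerates_roots01 (p : {poly R}) n (s : n.-tuple R) : Prop :=
  (forall i j : 'I_n, (i < j)%N -> tnth s i < tnth s j) /\
  (forall x : R, (exists i, x = tnth s i) <-> (root p x /\ 0 < x < 1)).

End orthogonal_polynomials.

Section limits.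
Context {R : realType}.

(* Convergence as theta -> +oo, where the theta-th variable lives on its own
   probability space. *)
Definition cvg_in_probability (d : R -> measure_display)
    (T : forall theta, measurableType (d theta))
    (P : forall theta, probability (T theta) R)
    (X : forall theta, T theta -> R) (c : R) : Prop :=
  forall e : R, 0 < e ->
    P theta [set w | e < `|X theta w - c|] @[theta --> +oo] --> 0%E.

Definition cvg_fdd (I : Type) (d : R -> measure_display)
    (T : forall theta, measurableType (d theta))
    (P : forall theta, probability (T theta) R)
    (X : forall theta, I -> T theta -> R)
    d' (T' : measurableType d') (P' : probability T' R) (xi : I -> T' -> R) :
    Prop :=
  forall (n : nat) (s : 'I_n -> I) (f : 'rV[R]_n -> R),
    continuous f -> (exists C : R, forall v, `|f v| <= C) ->
    ('E_(P theta)[(fun w => f (\row_k X theta (s k) w)%R)])%E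
      @[theta --> +oo] -->
    ('E_P'[(fun w => f (\row_k xi (s k) w)%R)])%E.

(* Normal law of mean 0, the Dirac mass at 0 (zero variance) included. *)
Definition centered_normal d (T : measurableType d) (P : probability T R)
    (X : T -> R) : Prop :=
  (exists2 sigma : R, 0 < sigma & forall B : set R, measurable B ->
     P (X @^-1` B) = normal_prob 0 sigma B) \/
  P (X @^-1` [set 0]) = 1%E.

Definition centered_gaussian (I : Type) d (T : measurableType d)
    (P : probability T R) (xi : I -> {RV P >-> R}) : Prop :=
  forall (n : nat) (s : 'I_n -> I) (a : 'I_n -> R),
    centered_normal P (fun w => \sum_(k < n) a k * xi (s k) w).

End limits.

(* Main.v *)
From HB Require Import structures.
Require Import Defs.
From mathcomp Require Import all_boot all_order all_algebra.
From mathcomp Require Import ring lra zify.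
From mathcomp Require Import all_classical all_reals all_analysis.
From mathcomp Require Import measurable_realfun.
Set Implicit Arguments.
Unset Strict Implicit.
Unset Printing Implicit Defensive.
Import Order.TTheory GRing.Theory Num.Theory.
Import numFieldNormedType.Exports.
Local Open Scope classical_set_scope.
Local Open Scope ring_scope.

(* In the product of the density of a row y with the backward transition density
   to the previous row z, the Vandermonde factors of y combine to the first
   power. Hence the array, read upwards, is a Markov chain whose transition
   density from z to y is, up to normalization, Delta(y) times the product over m
   and i of |y_m - zeta_i|^(theta c_i - 1), where the zeta_i are 0, the entries of
   z and (in the first M rows) 1, restricted to zeta_m < y_m < zeta_(m+1). As theta
   grows, y_m concentrates at the zero of sum_i c_i / (y - zeta_i) in its interval.
   When z consists of the roots of a Jacobi polynomial Q, integration by parts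
   shows that sum_i c_i prod_(l <> i) (X - zeta_l) is the next Jacobi polynomial,
   so these zeros are its roots. In the scale theta^(-1/2), Laplace's method gives
   the pointwise convergence of each transition density to a product of normal
   densities with means linear in the previous row. By Scheffe's lemma the joint
   laws converge to that of a Gaussian autoregressive chain, and convergence in
   probability follows. *)

(** * Densities and Lebesgue measure on tuples *)

(** The normalizations of the upward transitions are left as integrals. They absorb the Gamma
    factors, the constants of the marginals and every factor depending on the lower row alone, and
    Laplace's method treats numerator and integral together. The coordinates of a row decouple
    because the surviving Vandermonde factor has an exponent free of theta. Each coordinate then has
    a concave one-dimensional log-density as soon as all exponents theta c_i - 1 are nonnegative,
    and concavity turns bounds at two fixed points into an exponential bound on the whole line, as
    domination requires. Row 0 is empty, so the upward chain starts from a point. Convergence is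
    proved along sequences theta = t_n, with e_n = t_n^(-1/2), since the convergence theorems for
    integrals are sequential. The limit calls for countably many independent normal variables on one
    probability space: the unit interval supplies them through repeated splitting of binary digits
    and normal quantiles, and Gaussianity reduces to that of finite linear combinations of these
    variables. *)

Section density.
Context d (T : measurableType d) (R : realType).
Local Open Scope ereal_scope.
Import HBNNSimple.

Lemma integral_density (nu mu : {measure set T -> \bar R}) (f : T -> \bar R) :
  measurable_fun setT f -> (forall x, 0 <= f x) ->
  (forall A, measurable A -> nu A = \int[mu]_(x in A) f x) ->
  forall g : T -> \bar R, measurable_fun setT g -> (forall x, 0 <= g x) ->
  \int[nu]_x g x = \int[mu]_x (g x * f x).
Proof.
move=> mf f0 nuE g mg g0.
pose h := nnsfun_approx measurableT mg.
have hE x : (h n x)%:E @[n --> \oo] --> g x by exact: cvg_nnsfun_approx.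
have nd_hx x : {homo (fun n => (h n x)%:E) : m n / (m <= n)%N >-> m <= n}.
  by move=> m n mn; rewrite lee_fin; exact/lefP/nd_nnsfun_approx.
transitivity (limn (fun n => \int[nu]_x (h n x)%:E)).
  rewrite -monotone_convergence//.
  - by apply: eq_integral => x _; apply/esym/cvg_lim => //; exact: hE.
  - by move=> n; exact/measurable_EFinP.
  - by move=> n x _; rewrite lee_fin.
transitivity (limn (fun n => \int[mu]_x ((h n x)%:E * f x))); last first.
  rewrite -monotone_convergence//.
  - apply: eq_integral => x _; apply/cvg_lim => //.
    (* Multiplication of extended reals is not continuous at 0 times infinity, so points where [f]
       or [g] vanishes are treated apart; where [g x] is 0, the increasing approximations are all
       0. *)
    have [fx0|fx0] := eqVneq (f x) 0.
      by rewrite fx0 mule0; under eq_fun do rewrite mule0; exact: cvg_cst.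
    have [gx0|gx0] := eqVneq (g x) 0.
      have hx0 n : h n x = 0%R.
        apply/eqP; rewrite eq_le fun_ge0 andbT -lee_fin -[leRHS]gx0.
        rewrite -(cvg_unique _ (ereal_nondecreasing_cvgn (nd_hx x)) (hE x)) //.
        by apply: ereal_sup_ubound; exists n.
      by rewrite gx0 mul0e; under eq_fun do rewrite hx0 mul0e; exact: cvg_cst.
    apply: cvgeM; [|exact: hE|exact: cvg_cst].
    by rewrite mule_defE (negbTE fx0) (negbTE gx0).
  - by move=> n; apply: emeasurable_funM => //; exact/measurable_EFinP.
  - by move=> n x _; rewrite mule_ge0// lee_fin.
  - by move=> x _ m n mn; apply: lee_wpmul2r => //; exact: nd_hx.
congr (limn _); apply/funext => n.
under eq_integral do rewrite fimfunE -fsumEFin//.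
rewrite ge0_integral_fsum//; last 2 first.
- move=> r; under eq_fun do rewrite EFinM.
  exact/measurable_EFinP/measurable_funM.
- by move=> r x _; rewrite EFinM nnfun_muleindic_ge0.
have hf x : (h n x)%:E * f x =
    \sum_(r \in range (h n)) ((r * \1_(h n @^-1` [set r]) x)%:E * f x).
  rewrite fimfunE -fsumEFin// ge0_mule_fsuml// => r.
  by rewrite EFinM nnfun_muleindic_ge0.
under [RHS]eq_integral do rewrite hf.
rewrite ge0_integral_fsum//; last 2 first.
- move=> r; apply: emeasurable_funM => //.
  exact/measurable_EFinP/measurable_funM.
- by move=> r x _; rewrite mule_ge0// EFinM nnfun_muleindic_ge0.
apply: eq_fsbigr => r /set_mem [y _ hr].
have r0 : (0 <= r)%R by rewrite -hr.
have mhr : measurable (h n @^-1` [set r]) by exact: measurable_sfunP.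
under eq_integral do rewrite EFinM.
rewrite ge0_integralZl//; [|exact/measurable_EFinP].
rewrite integral_indic// setIT nuE//.
under [RHS]eq_integral do rewrite EFinM -muleA.
rewrite ge0_integralZl//; last 2 first.
- by apply: emeasurable_funM => //; exact/measurable_EFinP.
- by move=> x _; rewrite mule_ge0.
congr (_ * _); rewrite integral_mkcond; apply: eq_integral => x _.
by rewrite epatch_indic muleC.
Qed.

(** The proofs [mf] and [f0] are carried as arguments so that the measure structure declared below
    can be inferred from the term alone. *)
Definition density_measure (mu : {measure set T -> \bar R}) (f : T -> \bar R)
  (mf : measurable_fun setT f) (f0 : forall x, 0 <= f x) (A : set T) :=
  \int[mu]_(x in A) f x.

Section density_measure.
Variables (mu : {measure set T -> \bar R}) (f : T -> \bar R).
Variables (mf : measurable_fun setT f) (f0 : forall x, 0 <= f x).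
Let nu := density_measure mu mf f0.

Let nu0 : nu set0 = 0. Proof. exact: integral_set0. Qed.
Let nu_ge0 A : 0 <= nu A. Proof. exact: integral_ge0. Qed.
Let nu_sigma_additive : semi_sigma_additive nu.
Proof. exact: semi_sigma_additive_nng_induced. Qed.

HB.instance Definition _ := isMeasure.Build _ _ _ (density_measure mu mf f0)
  nu0 nu_ge0 nu_sigma_additive.
End density_measure.
End density.

Section density_product.
Context d1 d2 (T1 : measurableType d1) (T2 : measurableType d2) (R : realType).
Local Open Scope ereal_scope.
Variables (m1 : {sigma_finite_measure set T1 -> \bar R})
  (m2 : {sigma_finite_measure set T2 -> \bar R}).

Lemma integral_mkrect (f : T1 * T2 -> \bar R) (A : set T1) (B : set T2) :
  measurable_fun setT f -> (forall x, 0 <= f x) ->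
  measurable A -> measurable B ->
  \int[m1 \x m2]_(z in A `*` B) f z = \int[m1]_(x in A) \int[m2]_(y in B) f (x, y).
Proof.
move=> mf f0 mA mB.
rewrite [LHS]integral_mkcond fubini_tonelli1; last 2 first.
- by apply/(measurable_restrictT _ _).1; [exact: measurableX|exact: measurable_funTS].
- by move=> x; rewrite patchE; case: ifP.
rewrite [RHS]integral_mkcond; apply: eq_integral => x _.
rewrite /fubini_F [RHS]patchE; case: ifPn => xA.
  rewrite [RHS]integral_mkcond; apply: eq_integral => y _.
  by rewrite !patchE in_setX/= xA.
by apply: integral0_eq => y _; rewrite patchE in_setX/= (negbTE xA).
Qed.

(** Rectangles form a generating pi-system, and finiteness of [nu] lets the whole space alone serve
    as the exhausting sequence in the uniqueness theorem. *)
Lemma rect_density (nu : {measure set (T1 * T2)%type -> \bar R})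
    (f : T1 * T2 -> \bar R) :
  nu setT < +oo -> measurable_fun setT f -> (forall x, 0 <= f x) ->
  (forall A B, measurable A -> measurable B ->
    nu (A `*` B) = \int[m1]_(x in A) \int[m2]_(y in B) f (x, y)) ->
  forall X, measurable X -> nu X = \int[m1 \x m2]_(z in X) f z.
Proof.
move=> nufin mf f0 nuE X mX.
pose C := [set A `*` B | A in (measurable : set (set T1)) & B in (measurable : set (set T2))].
have := @measure_unique _ R (T1 * T2)%type C (fun=> setT) _ _ _ _ nu
  (density_measure (m1 \x m2) mf f0).
apply => //.
- by rewrite measurable_prod_measurableType.
- move=> _ _ [A1 mA1 [B1 mB1 <-]] [A2 mA2 [B2 mB2 <-]].
  exists (A1 `&` A2); first exact: measurableI.
  by exists (B1 `&` B2); [exact: measurableI|rewrite setXI].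
- by move=> _; exists setT => //; exists setT => //; rewrite setXTT.
- by rewrite bigcup_const.
- by move=> _ [A mA [B mB <-]]; rewrite /= /density_measure integral_mkrect// nuE.
Qed.

Lemma tonelli_rect (f : T1 * T2 -> \bar R) (A : set T1) (B : set T2) :
  measurable_fun setT f -> (forall x, 0 <= f x) ->
  measurable A -> measurable B ->
  \int[m1]_(x in A) \int[m2]_(y in B) f (x, y) =
  \int[m2]_(y in B) \int[m1]_(x in A) f (x, y).
Proof.
move=> mf f0 mA mB.
have mfr : measurable_fun setT (f \_ (A `*` B)).
  by apply/(measurable_restrictT _ _).1; [exact: measurableX|exact: measurable_funTS].
have fr0 z : 0 <= (f \_ (A `*` B)) z by rewrite patchE; case: ifP.
rewrite -integral_mkrect// [LHS]integral_mkcond (fubini_tonelli2 _ mfr fr0).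
rewrite [RHS]integral_mkcond; apply: eq_integral => y _.
rewrite /fubini_G [RHS]patchE; case: ifPn => yB.
  rewrite [RHS]integral_mkcond; apply: eq_integral => x _.
  by rewrite !patchE in_setX/= yB andbT.
by apply: integral0_eq => x _; rewrite patchE in_setX/= (negbTE yB) andbF.
Qed.
End density_product.

Definition pushforward_measure d1 d2 (T1 : measurableType d1)
    (T2 : measurableType d2) (R : realType) (mu : {measure set T1 -> \bar R})
    (f : T1 -> T2) (mf : measurable_fun setT f) : {measure set T2 -> \bar R} :=
  measure_function_pushforward__canonical__measure_function_Measure mu mf.

Section lebesgue_tuple_integral.
Context {R : realType}.
Local Open Scope ereal_scope.
Notation leb := (@lebesgue_measure R).

Lemma integral_tuple0 (f : 0.-tuple R -> \bar R) :
  measurable_fun setT f -> \int[lebesgue_tuple 0]_x f x = f [tuple].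
Proof. by move=> mf; rewrite /= integral_dirac// diracT mul1e. Qed.

Lemma integral_tupleS k (f : k.+1.-tuple R -> \bar R) :
  measurable_fun setT f -> (forall x, 0 <= f x) ->
  \int[lebesgue_tuple k.+1]_x f x =
  \int[leb]_x \int[lebesgue_tuple k]_t f [the k.+1.-tuple R of x :: t].
Proof.
move=> mf f0.
transitivity (\int[pushforward (leb \x lebesgue_tuple k)
    (@tuple_cons R k)]_x f x); first by [].
rewrite ge0_integral_pushforward//; last exact: measurable_tuple_cons.
rewrite preimage_setT fubini_tonelli1//.
- exact: measurableT_comp mf (@measurable_tuple_cons R k).
- by move=> x; exact: f0.
Qed.

(** Lebesgue measure is determined by its values on half-open intervals, and the pushforward under
    [b + a * x], scaled by the absolute value of [a], gives each interval its length. For negative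
    [a] the preimage is open at the other end, which does not change its length. *)
Lemma integral_affine (f : R -> \bar R) (a b : R) : (a != 0)%R ->
  measurable_fun setT f -> (forall x, 0 <= f x) ->
  \int[leb]_x f x = `|a|%:E * \int[leb]_x f (b + a * x)%R.
Proof.
move=> a0 mf f0.
pose h (x : measurableTypeR R) : measurableTypeR R := (b + a * x)%R.
have mh : measurable_fun setT h.
  by apply: measurable_funD => //; exact: measurable_funM.
pose m := mscale (NngNum (normr_ge0 a)) (pushforward_measure leb mh).
have mE A : measurable A -> leb A = m A.
  move=> mA; apply: lebesgue_measure_unique => // _ [[x y]] _ <-.
  rewrite /m /= /mscale /= /pushforward.
  have [ap|an] := ltP 0%R a.
    rewrite (_ : h @^-1` _ = `](x - b) / a, (y - b) / a]%classic)%R; last first.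
      apply/seteqP; split=> z /=; rewrite !in_itv/= /h ler_pdivlMr// ltr_pdivrMr//.
        by rewrite ltrBlDl lerBrDl (mulrC z).
      by rewrite ltrBlDl lerBrDl (mulrC z).
    rewrite !lebesgue_measure_itv/= !lte_fin ltr_pM2r ?invr_gt0// ltrD2r gtr0_norm//.
    case: ifPn => [xy|]; last by rewrite mule0.
    by rewrite -!EFinD -EFinM; congr (_%:E); field.
  have {}an : (a < 0)%R by rewrite lt_neqAle a0.
  rewrite (_ : h @^-1` _ = `[(y - b) / a, (x - b) / a[%classic)%R; last first.
    apply/seteqP; split=> z /=; rewrite !in_itv/= /h ler_ndivrMr// ltr_ndivlMr//.
      by rewrite ltrBlDl lerBrDl (mulrC z) andbC.
    by rewrite ltrBlDl lerBrDl (mulrC z) andbC.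
  rewrite !lebesgue_measure_itv/= !lte_fin ltr_nM2r ?invr_lt0// ltrD2r ltr0_norm//.
  case: ifPn => [xy|]; last by rewrite mule0.
  by rewrite -!EFinD -EFinM; congr (_%:E); field.
rewrite (eq_measure_integral m); last by move=> A mA _; exact: mE.
rewrite /m ge0_integral_mscale//= /pushforward_measure.
by rewrite ge0_integral_pushforward// preimage_setT.
Qed.

(** Both the rescaling [sqrt theta * (r - j)] and its inverse [j + v / sqrt theta] are of this
    form. *)
Definition affine_tuple k (b : k.-tuple R) (a : R) (v : k.-tuple R) : k.-tuple R :=
  [tuple (tnth b i + a * tnth v i)%R | i < k].

Lemma measurable_mktuple d (T : measurableType d) k (f : 'I_k -> T -> R) :
  (forall i, measurable_fun setT (f i)) ->
  measurable_fun setT (fun x => [tuple f i x | i < k]).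
Proof.
move=> mf; apply/measurable_fun_tnthP => i.
by rewrite (_ : _ \o _ = f i)//; apply/funext => x /=; rewrite tnth_mktuple.
Qed.

Lemma measurable_affine_tuple k (b : k.-tuple R) a :
  measurable_fun setT (affine_tuple b a).
Proof.
apply: measurable_mktuple => i; apply: measurable_funD => //.
by apply: measurable_funM => //; exact: measurable_tnth.
Qed.

Lemma affine_tupleS k (b : k.+1.-tuple R) a x (t : k.-tuple R) :
  affine_tuple b a [the k.+1.-tuple R of x :: t] =
  [the k.+1.-tuple R of
    (thead b + a * x)%R :: affine_tuple [tuple of behead b] a t].
Proof.
apply: eq_from_tnth => i; rewrite tnth_mktuple.
case: (unliftP ord0 i) => [j|] ->; last by rewrite !tnth0.
rewrite [in RHS]tnthS tnth_mktuple tnthS; congr (_ + _ * _)%R.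
by rewrite [in RHS]tnth_behead; congr (tnth _ _); apply/val_inj; rewrite /= inordK// ltnS.
Qed.

Lemma integral_affine_tuple k (b : k.-tuple R) a (f : k.-tuple R -> \bar R) :
  (0 < a)%R -> measurable_fun setT f -> (forall x, 0 <= f x) ->
  \int[lebesgue_tuple k]_x f x =
  (a ^+ k)%:E * \int[lebesgue_tuple k]_x f (affine_tuple b a x).
Proof.
move=> a0; elim: k b f => [|k IH] b f mf f0.
  rewrite expr0 mul1e !integral_tuple0//.
    by congr f; apply: eq_from_tnth => -[].
  by apply: measurableT_comp => //; exact: measurable_affine_tuple.
rewrite !integral_tupleS//; last first.
  by apply: measurableT_comp => //; exact: measurable_affine_tuple.
have mfc : measurable_fun setT (f \o @tuple_cons R k).
  by apply: measurableT_comp => //; exact: measurable_tuple_cons.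
rewrite (@integral_affine _ _ (thead b) (lt0r_neq0 a0)) ?(gtr0_norm a0); last 2 first.
- by have /= := measurable_fun_fubini_tonelli_F (m2 := lebesgue_tuple k) _ mfc (fun x => f0 _).
- by move=> x; exact: integral_ge0.
rewrite exprS EFinM -muleA; congr (_ * _).
rewrite -ge0_integralZl//=; last 3 first.
- have mg : measurable_fun setT (fun z : measurableTypeR R * k.-tuple R =>
      f (affine_tuple b a (tuple_cons z))).
    apply: measurableT_comp mf _.
    exact: measurableT_comp (@measurable_affine_tuple _ _ _) (@measurable_tuple_cons R k).
  by have /= := measurable_fun_fubini_tonelli_F (m2 := lebesgue_tuple k) _ mg (fun x => f0 _).
- by move=> x _; exact: integral_ge0.
- by rewrite lee_fin exprn_ge0// ltW.
apply: eq_integral => x _; rewrite (IH [tuple of behead b])//; last first.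
  exact: (measurableT_comp mfc (measurable_fun_pair (measurable_cst _) (@measurable_id _ _ _))).
by congr (_ * _); apply: eq_integral => t _; rewrite affine_tupleS.
Qed.

Lemma integral_prod_tuple k (h : 'I_k -> R -> R) :
  (forall i, measurable_fun setT (h i)) -> (forall i x, (0 <= h i x)%R) ->
  \int[lebesgue_tuple k]_x (\prod_i h i (tnth x i))%R%:E =
  \prod_i \int[leb]_x (h i x)%:E.
Proof.
elim: k h => [|k IH] h mh h0.
  rewrite big_ord0 (_ : (fun _ => _) = cst 1) ?integral_tuple0//.
  by apply/funext => x; rewrite big_ord0.
have mprod l (g : 'I_l -> R -> R) : (forall i, measurable_fun setT (g i)) ->
    measurable_fun setT (fun x : l.-tuple R => (\prod_i g i (tnth x i))%R%:E).
  move=> mg; apply/measurable_EFinP/measurable_prod => i _.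
  by apply: measurableT_comp => //; exact: measurable_tnth.
rewrite integral_tupleS//; last 2 first.
- exact: mprod.
- by move=> x; rewrite lee_fin prodr_ge0.
rewrite big_ord_recl.
rewrite -(IH (fun i => h (lift ord0 i)))//.
transitivity (\int[leb]_x ((h ord0 x)%:E *
    \int[lebesgue_tuple k]_t (\prod_i h (lift ord0 i) (tnth t i))%R%:E)).
  apply: eq_integral => x _.
  rewrite -ge0_integralZl//.
  - apply: eq_integral => t _; rewrite big_ord_recl tnth0 EFinM.
    by congr (_ * _%:E); apply: eq_bigr => i _; rewrite tnthS.
  - exact: (mprod _ (fun i => h (lift ord0 i))).
  - by move=> t _; rewrite lee_fin prodr_ge0.
  - by rewrite lee_fin.
rewrite ge0_integralZr//.
- by apply/measurable_EFinP; exact: (mh ord0).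
- by move=> x _; rewrite lee_fin.
- by apply: integral_ge0 => t _; rewrite lee_fin prodr_ge0.
Qed.
End lebesgue_tuple_integral.

Section transfer.
Context d1 d2 (T1 : measurableType d1) (T2 : measurableType d2) (R : realType).
Local Open Scope ereal_scope.

(** Multiplication by [D >= 0] commutes with taking positive and negative parts, so the nonnegative
    case [hD] applies to each part. *)
Lemma density_transfer (P : {measure set T1 -> \bar R}) (mu : {measure set T2 -> \bar R})
    (h : T1 -> T2) (D : T2 -> R) :
  (forall x, (0 <= D x)%R) ->
  (forall g : T2 -> \bar R, measurable_fun setT g -> (forall x, 0 <= g x) ->
    \int[P]_w g (h w) = \int[mu]_x (g x * (D x)%:E)) ->
  forall f : T2 -> R, measurable_fun setT f ->
    \int[P]_w (f (h w))%:E = \int[mu]_x (f x * D x)%:E.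
Proof.
move=> D0 hD f mf.
have mfE : measurable_fun setT (EFin \o f) by exact/measurable_EFinP.
rewrite integralE [RHS]integralE; congr (_ - _).
  transitivity (\int[P]_w (EFin \o f)^\+ (h w)).
    by apply: eq_integral => x _; rewrite !funeposE.
  rewrite (hD (EFin \o f)^\+)//; last exact: measurable_funepos.
  apply: eq_integral => x _; rewrite !funeposE/= -!EFin_max -EFinM.
  by rewrite maxr_pMl// mul0r.
transitivity (\int[P]_w (EFin \o f)^\- (h w)).
  by apply: eq_integral => x _; rewrite !funenegE.
rewrite (hD (EFin \o f)^\-)//; last exact: measurable_funeneg.
apply: eq_integral => x _; rewrite !funenegE/= -!EFin_max -EFinM.
by rewrite maxr_pMl// mul0r mulNr.
Qed.
End transfer.

(** * Convergence of densities implies convergence of bounded integrals *)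

Section cvg_density.
Context d (T : measurableType d) (R : realType) (mu : {measure set T -> \bar R}).
Local Open Scope ereal_scope.
Variables (D_ : nat -> T -> R) (D : T -> R).
Hypotheses (mD_ : forall n, measurable_fun setT (D_ n)) (mD : measurable_fun setT D).
Hypotheses (D_0 : forall n x, (0 <= D_ n x)%R) (D0 : forall x, (0 <= D x)%R).
Hypotheses (D_1 : \forall n \near \oo, \int[mu]_x (D_ n x)%:E = 1) (D1 : \int[mu]_x (D x)%:E = 1).
Hypothesis D_D : forall x, D_ n x @[n --> \oo] --> D x.

(* Scheffe: the integrals of min(D_n, D) tend to 1 by dominated convergence. *)
Lemma cvg_density (f : T -> R) (C : R) :
  measurable_fun setT f -> (forall x, (`|f x| <= C)%R) ->
  \int[mu]_x (f x * D_ n x)%:E @[n --> \oo] --> \int[mu]_x (f x * D x)%:E.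
Proof.
move=> mf fC.
pose m n x := Num.min (D_ n x) (D x).
have mm n : measurable_fun setT (m n) by exact: measurable_minr.
have m0 n x : (0 <= m n x)%R by rewrite le_min D_0 D0.
have leDm n x : (m n x <= D_ n x)%R by rewrite ge_min lexx.
have leD n x : (m n x <= D x)%R by rewrite ge_min lexx orbT.
have iD : mu.-integrable setT (EFin \o D).
  apply/integrableP; split; first exact/measurable_EFinP.
  by under eq_integral do rewrite /= ger0_norm//; rewrite D1 ltry.
have im n : mu.-integrable setT (EFin \o m n).
  apply: (le_integrable _ _ _ iD) => //; first exact/measurable_EFinP.
  by move=> x _; rewrite lee_fin !ger0_norm.
have bdd (g : T -> R) : mu.-integrable setT (EFin \o g) ->
    mu.-integrable setT (fun x => (f x * g x)%:E).
  move=> ig.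
  have mg : measurable_fun setT g by exact/measurable_EFinP/(measurable_int _ ig).
  apply: (@le_integrable _ _ _ _ _ _ _ (fun x => C%:E * (g x)%:E)) => //.
  - by apply/measurable_EFinP; exact: measurable_funM.
  - move=> x _; rewrite -EFinM lee_fin !normrM ler_wpM2r//.
    by rewrite (le_trans (fC x))// ler_norm.
  - exact: integrableZl.
have cv (g : T -> R) (K : R) : measurable_fun setT g -> (forall x, (`|g x| <= K)%R) ->
    \int[mu]_x (g x * m n x)%:E @[n --> \oo] --> \int[mu]_x (g x * D x)%:E.
  move=> mg gK; apply: (dominated_cvg _ _ _ (g := fun x => K%:E * (D x)%:E)) => //.
  - by move=> n; apply/measurable_EFinP; exact: measurable_funM.
  - move=> x _; apply/cvg_EFin; first exact: nearW.
    apply: cvgMr; apply/cvgrPdist_le => e e0.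
    have := @D_D x; move/cvgrPdist_le => /(_ e e0); apply: filterS => n; apply: le_trans.
    rewrite /m; case: (leP (D_ n x) (D x)) => // h.
    by rewrite subrr normr0.
  - exact: integrableZl.
  - move=> n x _; rewrite lee_fin normrM ler_pM//.
    by rewrite ger0_norm.
pose A n := (\int[mu]_x (f x * D_ n x))%R.
pose B n := (\int[mu]_x (f x * m n x))%R.
pose c n := (\int[mu]_x (m n x))%R.
pose L := (\int[mu]_x (f x * D x))%R.
have cB : B n @[n --> \oo] --> L.
  apply: fine_cvg; rewrite /L fineK; first exact: (cv _ C).
  by apply: integrable_fin_num => //; exact: bdd.
have cc : c n @[n --> \oo] --> (1 : R)%R.
  apply: fine_cvg; rewrite -D1; have := cv (cst 1%R) 1%R (measurable_cst _) _.
  have e1 (g : T -> R) : (fun x => (cst 1%R x * g x)%:E) = EFin \o g.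
    by apply/funext => x /=; rewrite mul1r.
  rewrite e1; under eq_fun do rewrite e1.
  by apply => x; rewrite normr1.
have iD_ : \forall n \near \oo, mu.-integrable setT (EFin \o D_ n).
  apply: filterS D_1 => n Dn; apply/integrableP; split; first exact/measurable_EFinP.
  by under eq_integral do rewrite /= ger0_norm//; rewrite Dn ltry.
have cA : A n @[n --> \oo] --> L.
  (* Replacing [D_ n] by [m n] costs at most [C] times the integral of [D_ n - m n], which is
     [C * (1 - c n)] because [D_ n] has mass 1. *)
  apply: (@squeeze_cvgr _ _ _ _ (fun n => B n - C * (1 - c n))%R
      (fun n => B n + C * (1 - c n))%R).
  - near=> n.
    have iDn : mu.-integrable setT (EFin \o D_ n) by near: n.
    have Dn1 : \int[mu]_x (D_ n x)%:E = 1 by near: n.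
    have -> : (1 - c n)%R = (\int[mu]_x (D_ n x - m n x))%R.
      by rewrite RintegralB//; congr (_ - _)%R; rewrite /Rintegral Dn1.
    rewrite -ler_distl -RintegralB//; [|exact: bdd|exact: bdd].
    have ib : mu.-integrable setT (EFin \o (fun x => D_ n x - m n x)%R).
      by have := integrableB measurableT iDn (im n).
    under eq_Rintegral do rewrite -mulrBr.
    rewrite (le_trans (le_normr_Rintegral _ _))//; first exact: bdd.
    rewrite -RintegralZl//; apply: le_Rintegral => //.
    - by have /= := integrable_norm (bdd _ ib).
    - by have := integrableZl measurableT C ib.
    - by move=> x _; rewrite normrM ler_pM// ger0_norm// subr_ge0.
  - rewrite [X in _ --> X](_ : _ = L - C * (1 - 1))%R; last by rewrite subrr mulr0 subr0.
    by apply: cvgB => //; apply: cvgMr; apply: cvgB => //; exact: cvg_cst.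
  - rewrite [X in _ --> X](_ : _ = L + C * (1 - 1))%R; last by rewrite subrr mulr0 addr0.
    by apply: cvgD => //; apply: cvgMr; apply: cvgB => //; exact: cvg_cst.
have -> : \int[mu]_x (f x * D x)%:E = L%:E.
  by rewrite /L fineK//; apply: integrable_fin_num => //; exact: bdd.
apply: cvg_EFin; last exact: cA.
near=> n; apply: integrable_fin_num => //.
by apply: bdd; near: n.
Unshelve. all: by end_near. Qed.
End cvg_density.

Section measurable_continuous_row.
Context d (T : measurableType d) (R : realType).

(** Rounding every coordinate down to the grid of mesh [1 / (m + 1)] gives functions with countably
    many values, measurable by inspection; continuity of [f] makes them converge pointwise. *)
Lemma measurable_continuous_row n (f : 'rV[R]_n -> R) (c : 'I_n -> T -> R) :
  continuous f -> (forall k, measurable_fun setT (c k)) ->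
  measurable_fun setT (fun x => f (\row_k c k x)).
Proof.
move=> cf mc.
pose z (m : nat) x : {ffun 'I_n -> int} := [ffun k => Num.floor (m.+1%:R * c k x)].
pose g (m : nat) x := f (\row_k ((z m x k)%:~R / m.+1%:R)).
have mg m : measurable_fun setT (g m).
  move=> _ B mB; rewrite setTI.
  rewrite (_ : g m @^-1` B = \bigcup_(a in [set a : {ffun 'I_n -> int} |
      B (f (\row_k ((a k)%:~R / m.+1%:R)))])
      \bigcap_(k in [set: 'I_n]) (c k @^-1` [set y | Num.floor (m.+1%:R * y) = a k])).
    rewrite bigcup_mkcond; apply: countable_bigcupT_measurable => [|a].
      exact: countableP.
    case: ifPn => // _; apply: fin_bigcap_measurable => // k _.
    rewrite -[X in _ X]setTI; apply: mc => //.
    rewrite (_ : [set y | _] = `[(a k)%:~R / m.+1%:R, (a k + 1)%:~R / m.+1%:R[%classic)//.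
    apply/seteqP; split => y /=; rewrite in_itv/= ler_pdivrMr// ltr_pdivlMr// mulrC => h.
      by rewrite -h floor_le/= -floor_lt_int; rewrite ltrDl.
    by apply/eqP; rewrite floor_eq.
  apply/seteqP; split => x /=.
    by move=> Bx; exists (z m x) => // k _ /=; rewrite ffunE.
  move=> [a Ba ax]; rewrite /g (_ : z m x = a)//.
  by apply/ffunP => k; rewrite ffunE; exact: ax.
apply: (measurable_fun_cvg (h := g)) => // x _.
apply: (cvg_comp (fun m => \row_k ((z m x k)%:~R / m.+1%:R)) f); last exact: cf.
apply/cvg_ballP => e e0; near=> m; split=> // i k; rewrite /ball/= !mxE ffunE.
have m0 : 0 < m.+1%:R :> R by [].
have /andP[h1 h2] : (Num.floor (m.+1%:R * c k x))%:~R <= m.+1%:R * c k x <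
   (Num.floor (m.+1%:R * c k x) + 1)%:~R by exact: floor_itv.
rewrite ltr_distl; apply/andP; split.
  rewrite (@lt_le_trans _ _ ((Num.floor (m.+1%:R * c k x))%:~R / m.+1%:R))//.
    by rewrite ltrBlDr ltrDl.
  by rewrite ler_pdivrMr// (mulrC (c k x)).
rewrite (@lt_trans _ _ ((Num.floor (m.+1%:R * c k x) + 1)%:~R / m.+1%:R))//.
  by rewrite ltr_pdivlMr// (mulrC (c k x)).
rewrite intrD mulrDl ltrD2l mul1r; near: m.
exact: (near_infty_natSinv_lt (PosNum e0)).
Unshelve. all: by end_near. Qed.
End measurable_continuous_row.

(** * Independent normal variables on the unit interval *)

Section uniform.
Context {R : realType}.
Local Open Scope ereal_scope.
Notation leb := (@lebesgue_measure R).
Notation unif := (uniform_prob (@ltr01 R)).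

Lemma integral_unif (f : R -> \bar R) :
  measurable_fun setT f -> (forall x, 0 <= f x) ->
  \int[unif]_x f x = \int[leb]_(x in `[0%R, 1%R[) f x.
Proof.
move=> mf f0; rewrite integral_uniform// subr0 invr1 mul1e.
by rewrite -integral_itv_bndo_bndc//; exact: measurable_funTS.
Qed.

Lemma unif_split (f : R -> \bar R) :
  measurable_fun setT f -> (forall x, 0 <= f x) ->
  \int[unif]_x f x =
  2^-1%:E * (\int[unif]_x f (x / 2)%R + \int[unif]_x f ((1 + x) / 2)%R).
Proof.
move=> mf f0.
have mhalf (b : R) : measurable_fun setT (fun x : R => f ((b + x) / 2)%R).
  apply: measurableT_comp => //; apply: measurable_funM => //.
  exact: measurable_funD.
have half (b : R) : \int[leb]_(x in `[(b / 2)%R, ((b + 1) / 2)%R[) f x =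
    2^-1%:E * \int[unif]_x f ((b + x) / 2)%R.
  rewrite integral_unif// integral_mkcond.
  rewrite (@integral_affine _ _ 2^-1 (b / 2))%R ?invr_eq0//; last 2 first.
  - by apply/(measurable_restrictT _ _).1 => //; exact: measurable_funTS.
  - by move=> x; rewrite patchE; case: ifP.
  rewrite ger0_norm ?invr_ge0//; congr (_ * _).
  rewrite [RHS]integral_mkcond; apply: eq_integral => x _.
  rewrite !patchE !mem_setE !in_itv/= (mulrC 2^-1%R) -mulrDl.
  by rewrite ler_pM2r ?invr_gt0// ltr_pM2r ?invr_gt0// lerDl ltrD2l.
rewrite integral_unif//.
have := half 0%R; rewrite mul0r add0r => h0; have := half 1%R => h1.
rewrite muleDr//; last by rewrite ge0_adde_def// inE integral_ge0.
under [in RHS]eq_integral do rewrite -[X in (X / _)%R]add0r.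
rewrite -h0 -h1.
rewrite (_ : `[0%R, 1%R[%classic = `[0%R, (1 / 2)%R[ `|` `[(1 / 2)%R, ((1 + 1) / 2)%R[).
  rewrite ge0_integral_setU//=.
  - exact: measurable_funTS.
  - rewrite disj_set2E; apply/eqP/seteqP; split => x //=.
    rewrite !in_itv/= => -[/andP[_ x2] /andP[x1 _]].
    by move: (lt_le_trans x2 x1); rewrite ltxx.
apply/seteqP; split => x /=; rewrite !in_itv/=.
  by move=> /andP[x0 x1]; case: (ltP x (1 / 2)%R) => h; [left|right]; lra.
by case; lra.
Qed.

Definition bit (x : R) : R := (if 2^-1 <= x then 1 else 0)%R.
Definition shift_digits (x : R) : R := (2 * x - bit x)%R.

Lemma measurable_bit : measurable_fun setT bit.
Proof.
apply: measurable_fun_ifT => //.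
by apply: measurable_fun_ler.
Qed.

Lemma measurable_shift_digits : measurable_fun setT shift_digits.
Proof.
by apply: measurable_funB; [exact: measurable_funM|exact: measurable_bit].
Qed.

(** The leading binary digit of a uniform variable is a fair coin independent of the remaining
    digits, which again form a uniform variable. *)
Lemma unif_bit_shift (f : R * R -> \bar R) :
  measurable_fun setT f -> (forall x, 0 <= f x) ->
  \int[unif]_x f (bit x, shift_digits x) =
  2^-1%:E * (\int[unif]_x f (0%R, x) + \int[unif]_x f (1%R, x)).
Proof.
move=> mf f0; rewrite unif_split//; last first.
  apply: measurableT_comp mf _.
  by apply: measurable_fun_pair; [exact: measurable_bit|exact: measurable_shift_digits].
have mp (b : R) : measurable_fun setT (fun x => f (b, x)).
  by apply: measurableT_comp mf _; exact: measurable_fun_pair.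
have mg (h : R -> R) : measurable_fun setT h ->
    measurable_fun setT (fun x => f (bit (h x), shift_digits (h x))).
  move=> mh; apply: measurableT_comp mf _.
  by apply: measurable_fun_pair; apply: measurableT_comp mh;
    [exact: measurable_bit|exact: measurable_shift_digits].
have mg0 : measurable_fun setT (fun x : R => f (bit (x / 2)%R, shift_digits (x / 2)%R)).
  by apply: mg; exact: measurable_funM.
have mg1 : measurable_fun setT (fun x : R => f (bit ((1 + x) / 2)%R, shift_digits ((1 + x) / 2)%R)).
  by apply: mg; apply: measurable_funM => //; exact: measurable_funD.
congr (_ * (_ + _)).
  rewrite !integral_unif//.
  apply: eq_integral => x; rewrite inE/= in_itv/= => /andP[x0 x1].
  rewrite /shift_digits (_ : bit _ = 0%R); last by rewrite /bit; case: ifP => //; lra.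
  by congr (f (_, _)); field.
rewrite !integral_unif//.
apply: eq_integral => x; rewrite inE/= in_itv/= => /andP[x0 x1].
rewrite /shift_digits (_ : bit _ = 1%R); last by rewrite /bit; case: ifPn => //; lra.
by congr (f (_, _)); field.
Qed.

Lemma unif_bit_shift2 (f : R * (R * R) -> \bar R) :
  measurable_fun setT f -> (forall x, 0 <= f x) ->
  \int[unif]_x f (bit x, (bit (shift_digits x), shift_digits (shift_digits x))) =
  4^-1%:E * ((\int[unif]_x f (0%R, (0%R, x)) + \int[unif]_x f (0%R, (1%R, x))) +
             (\int[unif]_x f (1%R, (0%R, x)) + \int[unif]_x f (1%R, (1%R, x)))).
Proof.
move=> mf f0.
have mbd : measurable_fun setT (fun x : R => (bit x, shift_digits x)).
  by apply: measurable_fun_pair; [exact: measurable_bit|exact: measurable_shift_digits].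
rewrite (unif_bit_shift (f := fun z => f (z.1, (bit z.2, shift_digits z.2))))//; last first.
  apply: measurableT_comp mf _; apply: measurable_fun_pair => //.
  by apply: measurableT_comp mbd _.
have hb (b : R) : \int[unif]_x f (b, (bit x, shift_digits x)) =
    2^-1%:E * (\int[unif]_x f (b, (0%R, x)) + \int[unif]_x f (b, (1%R, x))).
  rewrite (unif_bit_shift (f := fun z => f (b, z)))//.
  by apply: measurableT_comp mf _; exact: measurable_fun_pair.
rewrite /= !hb -muleDr//; last by rewrite ge0_adde_def// inE adde_ge0// integral_ge0.
rewrite muleA -EFinM; by congr (_%:E * _); field.
Qed.

(* [evens] keeps the binary digits of [x] of even rank and [odds] those of odd
   rank: a uniform variable is split into two independent uniform ones. *)
Definition evens_ n (x : R) : R := (\sum_(k < n) bit (iter k (shift_digits \o shift_digits) x) / 2 ^+ k.+1)%R.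
Definition evens (x : R) : R := limn (fun n => evens_ n x).
Definition odds (x : R) : R := evens (shift_digits x).

Lemma bit_ge0 x : (0 <= bit x)%R. Proof. by rewrite /bit; case: ifP. Qed.
Lemma bit_le1 x : (bit x <= 1)%R. Proof. by rewrite /bit; case: ifP. Qed.

Lemma evens_S n x : evens_ n.+1 x = ((bit x + evens_ n (shift_digits (shift_digits x))) / 2)%R.
Proof.
rewrite /evens_ big_ord_recl mulrDl expr1; congr (_ + _)%R.
rewrite mulr_suml; apply: eq_bigr => i _; rewrite lift0 iterSr.
by rewrite [(2 ^+ i.+2)%R]exprSr invfM mulrA.
Qed.

Lemma evens_bound n x : (0 <= evens_ n x <= 1)%R.
Proof.
elim: n x => [|n IH] x; first by rewrite /evens_ big_ord0 lexx ler01.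
rewrite evens_S; have := IH (shift_digits (shift_digits x)); have := bit_ge0 x; have := bit_le1 x.
lra.
Qed.

Lemma evens_cvg x : evens_ n x @[n --> \oo] --> evens x.
Proof.
apply: nondecreasing_is_cvgn.
  apply/nondecreasing_seqP => n; rewrite /evens_ big_ord_recr/= lerDl.
  by rewrite divr_ge0 ?bit_ge0// exprn_ge0.
by exists 1%R => _ [n _ <-]; have /andP[] := evens_bound n x.
Qed.

Lemma evensE x : evens x = ((bit x + evens (shift_digits (shift_digits x))) / 2)%R.
Proof.
have := @evens_cvg x; rewrite -(cvg_shiftS (fun n => evens_ n x)) => h.
apply: (cvg_unique _ h) => //.
rewrite (_ : (fun _ => _) = fun n => ((bit x + evens_ n (shift_digits (shift_digits x))) / 2)%R); last first.
  by apply/funext => n; rewrite /= -evens_S.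
apply: cvgMl; apply: cvgD; [exact: cvg_cst|exact: evens_cvg].
Qed.

Lemma evens_range x : (0 <= evens x <= 1)%R.
Proof.
by apply/andP; split; [apply: (limr_ge (cvgP _ (@evens_cvg x)))|
  apply: (limr_le (cvgP _ (@evens_cvg x)))]; apply: nearW => n;
  have /andP[] := evens_bound n x.
Qed.

Lemma measurable_evens : measurable_fun setT evens.
Proof.
apply: (measurable_fun_cvg (h := evens_)) => [n|x _]; last exact: evens_cvg.
apply: measurable_sum => k; apply: measurable_funM => //.
have : measurable_fun setT (iter k (shift_digits \o shift_digits)).
  elim: (k : nat) => [|l IH]; first exact: measurable_id.
  by apply: measurableT_comp IH; apply: measurableT_comp; exact: measurable_shift_digits.
by apply: measurableT_comp; exact: measurable_bit.
Qed.

Lemma measurable_odds : measurable_fun setT odds.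
Proof. exact: measurableT_comp measurable_evens measurable_shift_digits. Qed.

(** Distribution function of the uniform law. *)
Let clip (s : R) : R := Num.min (Num.max s 0%R) 1%R.

Let clipE s : clip s = ((clip (2 * s) + clip (2 * s - 1)) / 2)%R.
Proof.
rewrite /clip /Num.min /Num.max.
have [h0|h0] := ltP s 0%R; have [h1|h1] := ltP (2 * s)%R 0%R;
have [h2|h2] := ltP (2 * s - 1)%R 0%R; repeat case: ifPn; lra.
Qed.

Let msub (s t : R) : measurable [set x : R | (evens x <= s)%R /\ (odds x <= t)%R].
Proof.
rewrite (_ : [set _ | _] = evens @^-1` `]-oo, s] `&` odds @^-1` `]-oo, t]).
  apply: measurableI; rewrite -[X in measurable X]setTI.
    exact: measurable_evens.
  exact: measurable_odds.
by apply/seteqP; split => x /=; rewrite !in_itv.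
Qed.

(** Joint distribution function of [evens] and [odds]. *)
Let G (s t : R) : R := fine (unif [set x | (evens x <= s)%R /\ (odds x <= t)%R]).

Let GE (s t : R) : (G s t)%:E = unif [set x | (evens x <= s)%R /\ (odds x <= t)%R].
Proof. by rewrite fineK// fin_num_measure//; exact: msub. Qed.

Let G_rec (s t : R) : G s t =
  ((G (2 * s) (2 * t) + G (2 * s) (2 * t - 1)
  + (G (2 * s - 1) (2 * t) + G (2 * s - 1) (2 * t - 1))) / 4)%R.
Proof.
apply: EFin_inj; rewrite mulrC EFinM !EFinD !GE.
(* [z.1] and [z.2.1] are the first digits of [evens] and [odds], that is the first two digits of the
   variable; the thresholds are those left for the remaining digits. *)
pose f (z : R * (R * R)) : \bar R :=
  (\1_[set x | (evens x <= 2 * s - z.1)%R /\ (odds x <= 2 * t - z.2.1)%R] z.2.2)%:E.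
have f0 z : 0 <= f z by rewrite lee_fin.
have mf : measurable_fun setT f.
  rewrite (_ : f = EFin \o \1_([set z | (evens z.2.2 + z.1 <= 2 * s)%R] `&`
      [set z | (odds z.2.2 + z.2.1 <= 2 * t)%R])).
    apply/measurable_EFinP/measurable_indic.
    have mh (g : R * (R * R) -> R) (b : R) : measurable_fun setT g ->
        measurable [set z | (g z <= b)%R].
      move=> mg; rewrite (_ : [set _ | _] = g @^-1` `]-oo, b]).
        by rewrite -[X in measurable X]setTI; exact: mg.
      by apply/seteqP; split => x /=; rewrite !in_itv.
    apply: measurableI; apply: mh; apply: measurable_funD => //.
    - apply: measurableT_comp; first exact: measurable_evens.
      exact: measurableT_comp.
    - apply: measurableT_comp; first exact: measurable_odds.
      exact: measurableT_comp.
    - exact: measurableT_comp.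
  apply/funext => -[a [b x]]; rewrite /f/= !indicE; congr ((nat_of_bool _)%:R%:E).
  by apply/idP/idP; rewrite !inE/= !lerBrDr.
have fI (a b : R) : \int[unif]_x f (a, (b, x)) =
    unif [set x | (evens x <= 2 * s - a)%R /\ (odds x <= 2 * t - b)%R].
  by have := integral_indic unif measurableT (msub (2 * s - a) (2 * t - b));
    rewrite setIT.
have fI' (a b s' t' : R) : (s' = 2 * s - a)%R -> (t' = 2 * t - b)%R ->
    unif [set x | (evens x <= s')%R /\ (odds x <= t')%R] = \int[unif]_x f (a, (b, x)).
  by move=> -> ->; rewrite fI.
transitivity (\int[unif]_x f (bit x, (bit (shift_digits x), shift_digits (shift_digits x)))); last first.
  rewrite (unif_bit_shift2 mf f0); congr (_ * ((_ + _) + (_ + _))); apply/esym;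
    apply: fI'; rewrite ?subr0//.
rewrite -[X in unif X]setIT -integral_indic//; last exact: msub.
apply: eq_integral => x _; rewrite /f/= !indicE; congr ((nat_of_bool _)%:R%:E).
apply/idP/idP; rewrite !inE/= /odds !(evensE x) (evensE (shift_digits x)); lra.
Qed.

(** Both sides obey the same self-similar recursion, so their difference is the average of four of
    its own values at rescaled points. At least one of the four always vanishes, so a uniform bound
    improves by the factor 3/4 at every step and the difference is 0. *)
Let G_clip (s t : R) : G s t = (clip s * clip t)%R.
Proof.
have G01 s' t' : (0 <= G s' t' <= 1)%R.
  by apply/andP; split; rewrite -lee_fin GE;
    [exact: measure_ge0|apply: probability_le1; exact: msub].
have clip01 s' : (0 <= clip s' <= 1)%R.
  by rewrite /clip ge_min le_min le_max !lexx ler01 !orbT.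
have Gs0 s' t' : (s' < 0)%R -> (G s' t' - clip s' * clip t' = 0)%R.
  move=> h; have -> : clip s' = 0%R.
    by rewrite /clip /Num.max h/= minEle ler01.
  rewrite mul0r subr0 /G (_ : [set _ | _] = set0) ?measure0//.
  by rewrite -subset0 => x /= [+ _]; have /andP[] := evens_range x; lra.
have Gt0 s' t' : (t' < 0)%R -> (G s' t' - clip s' * clip t' = 0)%R.
  move=> h; have -> : clip t' = 0%R.
    by rewrite /clip /Num.max h/= minEle ler01.
  rewrite mulr0 subr0 /G (_ : [set _ | _] = set0) ?measure0//.
  by rewrite -subset0 => x /= [_]; have /andP[] := evens_range (shift_digits x); rewrite /odds; lra.
have G11 s' t' : (1 <= s')%R -> (1 <= t')%R -> (G s' t' - clip s' * clip t' = 0)%R.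
  have clip1 u : (1 <= u)%R -> clip u = 1%R.
    by move=> h; rewrite /clip maxEle; case: ifP; rewrite minEle; case: ifP; lra.
  move=> hs ht; rewrite !clip1// mulr1 /G (_ : [set _ | _] = setT).
    by rewrite probability_setT subrr.
  apply/seteqP; split => // x _ /=; have /andP[_ h1] := evens_range x.
  by have /andP[_ h2] := evens_range (shift_digits x); split; [exact: le_trans hs|exact: le_trans ht].
suff h n s' t' : (`|G s' t' - clip s' * clip t'| <= (3 / 4) ^+ n)%R.
  apply/eqP; rewrite -subr_eq0 -normr_eq0 eq_le normr_ge0 andbT.
  have c34 : ((3 / 4 : R) ^+ n @[n --> \oo] --> 0)%R.
    by apply: cvg_expr; rewrite ger0_norm; lra.
  rewrite -(cvg_lim _ c34)//; apply: limr_ge; first by apply/cvg_ex; exists 0%R.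
  by apply: nearW => n; exact: h.
elim: n s' t' => [|n IH] {}s {}t.
  have /andP[g0 g1] := G01 s t.
  have /andP[a0 a1] := clip01 s; have /andP[b0 b1] := clip01 t.
  by rewrite expr0 ler_norml; apply/andP; split; nra.
have -> : (G s t - clip s * clip t = ((G (2 * s) (2 * t) - clip (2 * s) * clip (2 * t))
    + (G (2 * s) (2 * t - 1) - clip (2 * s) * clip (2 * t - 1))
    + ((G (2 * s - 1) (2 * t) - clip (2 * s - 1) * clip (2 * t))
    + (G (2 * s - 1) (2 * t - 1) - clip (2 * s - 1) * clip (2 * t - 1)))) / 4)%R.
  by rewrite G_rec (clipE s) (clipE t); field.
move: (IH (2 * s) (2 * t))%R (IH (2 * s) (2 * t - 1))%R
  (IH (2 * s - 1) (2 * t))%R (IH (2 * s - 1) (2 * t - 1))%R.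
rewrite exprS !ler_norml => /andP[a1 a2] /andP[b1 b2] /andP[c1 c2] /andP[d1 d2].
have e0 : (0 <= (3 / 4 : R) ^+ n)%R by rewrite exprn_ge0.
(* If [s < 1/2] the two terms at [2 * s - 1 < 0] vanish, similarly for [t]; otherwise [2 * s] and
   [2 * t] are at least 1 and the first term vanishes. *)
have [hs|hs] := ltP s 2^-1%R.
  rewrite [X in (_ + _ + (X + _))%R]Gs0 ?[X in (_ + _ + (_ + X))%R]Gs0; lra.
have [ht|ht] := ltP t 2^-1%R.
  rewrite [X in (_ + X + (_ + _))%R]Gt0 ?[X in (_ + _ + (_ + X))%R]Gt0; lra.
rewrite [X in (X + _ + (_ + _))%R]G11; lra.
Qed.

(** Subtracting half-lines yields the half-open intervals, a generating pi-system exhausted by []-n,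
    n]]; finiteness makes the subtraction legitimate. *)
Lemma cdf_unique (m1 m2 : {measure set (measurableTypeR R) -> \bar R}) :
  m1 setT < +oo -> (forall s, m1 `]-oo, s]%classic = m2 `]-oo, s]%classic) ->
  forall A, measurable A -> m1 A = m2 A.
Proof.
move=> m1oo m12.
have m1fin A : measurable A -> m1 A < +oo.
  by move=> mA; apply: le_lt_trans m1oo; apply: le_measure => //; rewrite inE.
move=> A mA.
pose g n : set (measurableTypeR R) := (`](- n%:R)%R, (n%:R)%R]%classic : set R).
have := @measure_unique _ R (measurableTypeR R) (@measurable _ (ocitv_type R)) g
  _ _ _ _ m1 m2 _ _ A mA; apply => //.
- by move=> X Y; exact: measurableI.
- by move=> n; exact: is_ocitv.
- apply/seteqP; split => // x _; exists (Num.truncn `|x|).+1 => //=.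
  rewrite /g/= in_itv/=; have := truncnS_gt `|x|.
  by have := ler_norm x; have := ler_norm (- x)%R; rewrite normrN; lra.
- move=> _ [[a b] _ <-] /=.
  have [ab|ba] := ltP a b; last by rewrite set_itv_ge ?measure0// -leNgt bnd_simp.
  have -> : `]a, b]%classic = `]-oo, b]%classic `\` `]-oo, a]%classic :> set R.
    by apply/seteqP; split => x /=; rewrite !in_itv/=; [move=> /andP[h1 h2]; split => //; lra|move=> [h1 /negP]; lra].
  have mab : `]-oo, b]%classic `&` `]-oo, a]%classic = `]-oo, a]%classic :> set R.
    by apply/seteqP; split => x /=; rewrite !in_itv/=; [case|split => //; lra].
  have mD (m : {measure set (measurableTypeR R) -> \bar R}) : m `]-oo, b]%classic < +oo ->
      m (`]-oo, b]%classic `\` `]-oo, a]%classic) = m `]-oo, b]%classic - m `]-oo, a]%classic.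
    by move=> h; rewrite measureD ?mab//; exact: measurable_itv.
  have m1b : m1 `]-oo, b]%classic < +oo by apply: m1fin; exact: measurable_itv.
  have m2b : m2 `]-oo, b]%classic < +oo by rewrite -m12.
  by rewrite (mD m1)// (mD m2)// !m12.
- by move=> n; apply: m1fin; exact: measurable_itv.
Qed.

Lemma unifE (A : set R) : measurable A -> unif A = leb (A `&` `[0%R, 1%R[).
Proof.
move=> mA; rewrite -[A in LHS]setIT -integral_indic// integral_unif//.
- by rewrite integral_indic.
- exact/measurable_EFinP/measurable_indic.
Qed.

Let unif_clip s : unif `]-oo, s]%classic = (clip s)%:E.
Proof.
have clip0 : (s < 0)%R -> clip s = 0%R.
  by move=> h; rewrite /clip /Num.max h/= minEle ler01.
have clip1 : (1 <= s)%R -> clip s = 1%R.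
  by move=> h; rewrite /clip maxEle; case: ifP; rewrite minEle; case: ifP; lra.
have clips : (0 <= s)%R -> (s < 1)%R -> clip s = s.
  by move=> h h'; rewrite /clip maxEle; case: ifP; rewrite minEle; case: ifP; lra.
rewrite unifE//.
have [s0|s0] := boolP (s < 0)%R.
  rewrite clip0// (_ : _ `&` _ = set0) ?measure0//.
  by rewrite -subset0 => x []/=; rewrite !in_itv/=; lra.
have [s1|s1] := boolP (s < 1)%R; last first.
  rewrite clip1; last by rewrite leNgt.
  rewrite (_ : _ `&` _ = `[0%R, 1%R[%classic); last first.
    by apply/seteqP; split => x /=; rewrite !in_itv/=; [case|]; lra.
  by rewrite lebesgue_measure_itv/= lte_fin ltr01 oppr0 adde0.
rewrite clips//; last by rewrite leNgt.
rewrite (_ : _ `&` _ = `[0%R, s]%classic); last first.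
  by apply/seteqP; split => x /=; rewrite !in_itv/=; [case|]; lra.
rewrite lebesgue_measure_itv/= lte_fin; case: ifPn => [s0'|h].
  by rewrite oppr0 adde0.
by congr (_%:E); lra.
Qed.

Lemma unif_evens_odds_rect (A B : set R) : measurable A -> measurable B ->
  unif (evens @^-1` A `&` odds @^-1` B) = unif A * unif B.
Proof.
have me (C : set R) : measurable C -> measurable (evens @^-1` C).
  by move=> mC; rewrite -[X in measurable X]setTI; exact: measurable_evens.
have mo (C : set R) : measurable C -> measurable (odds @^-1` C).
  by move=> mC; rewrite -[X in measurable X]setTI; exact: measurable_odds.
have mE : measurable_fun setT (evens : measurableTypeR R -> measurableTypeR R).
  exact: measurable_evens.
have mO : measurable_fun setT (odds : measurableTypeR R -> measurableTypeR R).
  exact: measurable_odds.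
have fu (C : set R) : measurable C -> unif C \is a fin_num.
  by move=> mC; rewrite fin_num_measure.
(* The joint distribution function only settles products of half-lines. Uniqueness is used once per
   variable: first with the half-line for [odds] fixed, then with the set [A] for [evens] fixed. *)
have step1 (C : set R) t : measurable C ->
    unif (evens @^-1` C `&` odds @^-1` `]-oo, t]) = unif C * unif `]-oo, t]%classic.
  move=> mC; have mt := mo _ (measurable_itv `]-oo, t]).
  pose m1 := pushforward_measure (mrestr unif mt) mE.
  pose m2 := mscale (NngNum (fine_ge0 (measure_ge0 unif `]-oo, t]%classic))) unif.
  have := @cdf_unique m1 m2; rewrite /m1 /m2/= /pushforward /mrestr /mscale/= => ->//.
  - by rewrite fineK ?fu// muleC.
  - by rewrite ltey_eq fu// preimage_setT setTI.
  - move=> s; rewrite fineK ?fu// !unif_clip -EFinM mulrC -G_clip GE.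
    by congr (unif _); apply/seteqP; split => x /=; rewrite !in_itv.
move=> mA mB; have mA' := me _ mA.
pose m1 := pushforward_measure (mrestr unif mA') mO.
pose m2 := mscale (NngNum (fine_ge0 (measure_ge0 unif A))) unif.
have := @cdf_unique m1 m2; rewrite /m1 /m2/= /pushforward /mrestr /mscale/= => H.
rewrite setIC H//.
- by rewrite fineK ?fu.
- by rewrite ltey_eq fu// preimage_setT setTI.
- by move=> s; rewrite fineK ?fu// setIC step1.
Qed.

Lemma unif_evens_odds (f : R * R -> \bar R) :
  measurable_fun setT f -> (forall x, 0 <= f x) ->
  \int[unif]_x f (evens x, odds x) = \int[unif]_x \int[unif]_y f (x, y).
Proof.
move=> mf f0.
have mp : measurable_fun setT (fun x : measurableTypeR R =>
    (evens x, odds x) : measurableTypeR R * measurableTypeR R).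
  by apply: measurable_fun_pair; [exact: measurable_evens|exact: measurable_odds].
have := @fubini_tonelli1 _ _ (measurableTypeR R) (measurableTypeR R) R unif unif f mf f0.
rewrite /fubini_F => <-.
rewrite [RHS](eq_measure_integral (pushforward_measure unif mp)).
  by rewrite ge0_integral_pushforward// preimage_setT.
move=> X mX _; apply: product_measure_unique => // A B mA mB.
exact: unif_evens_odds_rect.
Qed.

End uniform.

Section normal_quantile.
Context {R : realType} (sigma : R).
Local Open Scope ereal_scope.
Notation leb := (@lebesgue_measure R).
Notation unif := (uniform_prob (@ltr01 R)).
Notation N := (normal_prob (0 : R) sigma).

Definition normal_cdf (t : R) : R := fine (N `]-oo, t]%classic).

(** The identity is viewed as a random variable with law [N], so that general facts on distribution
    functions apply to [normal_cdf]. *)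
Let idR : measurableTypeR R -> R := idfun.
#[local] HB.instance Definition _ :=
  @isMeasurableFun.Build _ _ _ _ idR (@measurable_id _ _ setT).
Let X : {RV N >-> R} := idR.

Let cdfE t : cdf X t = (normal_cdf t)%:E.
Proof.
by rewrite /normal_cdf fineK ?fin_num_measure// /cdf /distribution /pushforward preimage_id.
Qed.

Lemma normal_cdf_nd : {homo normal_cdf : x y / (x <= y)%R}.
Proof. by move=> x y xy; rewrite -lee_fin -!cdfE; exact: cdf_nondecreasing. Qed.

(** Generalized inverse of the distribution function. Outside []0, 1[] the infimum may be
    meaningless, and the value 0 is set by convention. *)
Definition normal_quantile (u : R) : R :=
  if (0 < u < 1)%R then inf [set t | (u <= normal_cdf t)%R] else 0%R.

Lemma normal_quantile_le (u t : R) : (0 < u < 1)%R ->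
  (normal_quantile u <= t)%R = (u <= normal_cdf t)%R.
Proof.
move=> /[dup] u01 /andP[u0 u1]; rewrite /normal_quantile u01.
have cE : cdf X = EFin \o normal_cdf by apply/funext => ?; exact: cdfE.
have [t1 ht1] : exists t, (u < normal_cdf t)%R.
  have := cvg_cdfy1 X; rewrite cE.
  move=> /fine_cvg/= /cvgr_gt /(_ _ u1).
  by move=> h; near (pinfty_nbhs R) => x; exists x; near: x.
have [t0 ht0] : exists t, (normal_cdf t < u)%R.
  have := cvg_cdfNy0 X; rewrite cE.
  move=> /fine_cvg/= /cvgr_lt /(_ _ u0).
  by move=> h; near (ninfty_nbhs R) => x; exists x; near: x.
have lbS x : (normal_cdf x < u)%R -> lbound [set t | (u <= normal_cdf t)%R] x.
  move=> hx y /= uy; rewrite leNgt; apply/negP => yx.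
  by have := normal_cdf_nd (ltW yx); lra.
apply/idP/idP => [|h]; last by apply: ge_inf => //; exists t0; exact: lbS.
apply: contraLR; rewrite -!ltNge => tu.
(* If [normal_cdf t < u], right continuity provides some [x > t] with the same inequality; [x] is
   then a lower bound of the set, so the infimum exceeds [t]. *)
have := @cdf_right_continuous _ _ _ _ X t; rewrite cE.
move=> /fine_cvg/= /cvgr_lt /(_ _ tu) h.
near t^'+ => x.
apply: (@lt_le_trans _ _ x); first by near: x; exact: nbhs_right_gt.
apply: lb_le_inf; first by exists t1; exact/ltW.
by apply: lbS; near: x.
Unshelve. all: by end_near. Qed.

Lemma measurable_normal_quantile : measurable_fun setT normal_quantile.
Proof.
apply: (measurability _ (RGenOInfty.measurableE R)) => //.
move=> _ [_ [t ->] <-]; rewrite setTI.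
rewrite (_ : _ @^-1` _ = ~` ((`]0%R, 1%R[ `&` `]-oo, normal_cdf t]) `|`
    (if (0 <= t)%R then ~` `]0%R, 1%R[ else set0))); last first.
  apply/seteqP; split => u /=; rewrite !in_itv/= andbT (ltNge t).
    move/negP => h [[u01]|]; first by rewrite -normal_quantile_le// => /h.
    case: ifPn => //= t0; rewrite in_itv/= => /negP u01.
    by apply: h; rewrite /normal_quantile (negbTE u01).
  move=> h; apply/negP => h'; apply: h.
  have [u01|u01] := boolP (0 < u < 1)%R.
    by left; split => //; rewrite -normal_quantile_le.
  right; move: h'; rewrite /normal_quantile (negbTE u01) => ->/=.
  by rewrite in_itv/=; exact/negP.
apply: measurableC; apply: measurableU; first exact: measurableI.
by case: ifP => // _; exact: measurableC.
Qed.

Let unif_quantile_ray t : unif (normal_quantile @^-1` `]-oo, t]) = N `]-oo, t]%classic.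
Proof.
have mq : measurable (normal_quantile @^-1` `]-oo, t]).
  by rewrite -[X in measurable X]setTI; exact: measurable_normal_quantile.
rewrite unifE//.
(* The point 0 is split off because the quantile takes its conventional value there; it has measure
   0. *)
rewrite (_ : _ `&` _ = (normal_quantile @^-1` `]-oo, t] `&` [set 0%R]) `|`
    (normal_quantile @^-1` `]-oo, t] `&` `]0%R, 1%R[)); last first.
  rewrite -setIUr; congr (_ `&` _); apply/seteqP; split => x /=; rewrite !in_itv/=.
    by move=> /andP[x0 x1]; have [->|xn0] := eqVneq x 0%R; [left|right; rewrite lt_neqAle eq_sym xn0 x0 x1].
  by case=> [->|]; lra.
have m0 : leb (normal_quantile @^-1` `]-oo, t] `&` [set 0%R]) = 0.
  apply/eqP; rewrite eq_le measure_ge0 andbT -(lebesgue_measure_set1 (0%R : R)).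
  by apply: le_measure; rewrite ?inE//; exact: measurableI.
rewrite setUC measureU0//; [|exact: measurableI|exact: measurableI].
rewrite (_ : N _ = (normal_cdf t)%:E); last by rewrite /normal_cdf fineK// fin_num_measure.
have F0 : (0 <= normal_cdf t)%R by rewrite fine_ge0.
have F1 : (normal_cdf t <= 1)%R by rewrite -lee_fin -cdfE cdf_le1.
(* At the value 1 the interval []0, normal_cdf t]] would leave []0, 1[], hence a separate case. *)
have [FE|F1'] := eqVneq (normal_cdf t) 1%R.
  rewrite (_ : _ `&` _ = `]0%R, 1%R[%classic).
    by rewrite /= lebesgue_measure_itv/= lte_fin ltr01 oppr0 adde0 FE.
  apply/seteqP; split => x /=; rewrite !in_itv/=; first by case.
  by move=> x01; split => //; rewrite normal_quantile_le// FE; lra.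
rewrite (_ : _ `&` _ = `]0%R, normal_cdf t]%classic).
  rewrite /= lebesgue_measure_itv/= lte_fin; case: ifPn => h.
    by rewrite oppr0 adde0.
  by congr (_%:E); lra.
have {}F1 : (normal_cdf t < 1)%R by rewrite lt_neqAle F1'.
apply/seteqP; split => x /=; rewrite !in_itv/=.
  by move=> [+ x01]; rewrite normal_quantile_le//; lra.
move=> h; have x01 : (0 < x < 1)%R by lra.
by split => //; rewrite normal_quantile_le//; lra.
Qed.

Lemma integral_normal_quantile (f : R -> \bar R) :
  measurable_fun setT f -> (forall x, 0 <= f x) ->
  \int[unif]_u f (normal_quantile u) = \int[leb]_x (f x * (normal_pdf 0 sigma x)%:E).
Proof.
move=> mf f0.
have mq : measurable_fun setT (normal_quantile : measurableTypeR R -> measurableTypeR R).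
  exact: measurable_normal_quantile.
transitivity (\int[pushforward_measure unif mq]_x f x).
  by rewrite ge0_integral_pushforward// preimage_setT.
apply: (@integral_density _ (measurableTypeR R)) => //.
- by apply/measurable_EFinP; exact: measurable_normal_pdf.
- by move=> x; rewrite lee_fin normal_pdf_ge0.
- have h1 : pushforward_measure unif mq setT < +oo.
    by rewrite /= /pushforward preimage_setT probability_setT ltry.
  exact: (cdf_unique h1 unif_quantile_ray).
Qed.

End normal_quantile.

Section independent_uniforms.
Context {R : realType}.
Local Open Scope ereal_scope.
Notation leb := (@lebesgue_measure R).
Notation unif := (uniform_prob (@ltr01 R)).

(** Each remainder is split in two: its [evens] part becomes the next term of the sequence and its
    [odds] part is kept for all later terms. *)
Fixpoint tail (n : nat) (x : R) : R := if n is m.+1 then odds (tail m x) else x.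
Definition unif_seq (n : nat) (x : R) : R := evens (tail n x).

Lemma measurable_tail n : measurable_fun setT (tail n).
Proof.
elim: n => [|n IH]; first exact: measurable_id.
exact: measurableT_comp (@measurable_odds R) IH.
Qed.

Lemma measurable_unif_seq n : measurable_fun setT (unif_seq n).
Proof. exact: measurableT_comp (@measurable_evens R) (measurable_tail n). Qed.

(* [h] only involves the first [n] variables of the sequence [unif_seq]. *)
Definition indep_tail d (E : measurableType d) (h : R -> E) (n : nat) :=
  measurable_fun setT h /\
  forall f : E * R -> \bar R, measurable_fun setT f -> (forall x, 0 <= f x) ->
  \int[unif]_x f (h x, tail n x) = \int[unif]_x \int[unif]_y f (h x, y).

Lemma unif1 : unif setT = 1.
Proof. exact: probability_setT. Qed.

Lemma integral_unif_cst (c : \bar R) : \int[unif]_x c = c.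
Proof. by rewrite integral_cst// -[RHS]mule1 -unif1. Qed.

Lemma indep_tail0 d (E : measurableType d) (e : E) : indep_tail (cst e) 0.
Proof.
split; first exact: measurable_cst.
move=> f mf f0 /=; rewrite integral_cst//.
by rewrite [X in _ = _ * X]unif1 mule1.
Qed.

Lemma indep_tail_comp d1 d2 (E : measurableType d1) (F : measurableType d2)
    (h : R -> E) (g : E -> F) n :
  measurable_fun setT g -> indep_tail h n -> indep_tail (g \o h) n.
Proof.
move=> mg [mh hn]; split; first exact: measurableT_comp mg mh.
move=> f mf f0; apply: (hn (fun z => f (g z.1, z.2))) => //.
apply: measurableT_comp mf _; apply: measurable_fun_pair => //.
exact: measurableT_comp.
Qed.

Lemma integral_evens (f : R -> \bar R) : measurable_fun setT f -> (forall x, 0 <= f x) ->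
  \int[unif]_x f (evens x) = \int[unif]_x f x.
Proof.
move=> mf f0; transitivity (\int[unif]_x \int[unif]_(y in setT) f x).
  by apply: (@unif_evens_odds R (fun z => f z.1)) => //; exact: measurableT_comp.
by apply: eq_integral => x _; rewrite integral_cst// [X in _ * X]unif1 mule1.
Qed.

Lemma measurable_integral_snd d (E : measurableType d) (d' : measure_display)
    (F : measurableType d') (mu : {sigma_finite_measure set F -> \bar R})
    (f : E * F -> \bar R) : measurable_fun setT f -> (forall z, 0 <= f z) ->
  measurable_fun setT (fun x => \int[mu]_y f (x, y)).
Proof. by move=> mf f0; exact: (measurable_fun_fubini_tonelli_F f). Qed.

(** The tail is an independent uniform variable, whose even and odd digits are again independent and
    uniform. Integrating out the odd part first leaves a function of [h] and the even part, to which
    the hypothesis applies a second time. *)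
Lemma indep_tailS d (E : measurableType d) (h : R -> E) n :
  indep_tail h n -> indep_tail (fun x => (h x, unif_seq n x)) n.+1.
Proof.
move=> [mh hn]; split.
  by apply: measurable_fun_pair => //; exact: measurable_unif_seq.
move=> f mf f0.
have mge (e : E) : measurable_fun setT (fun z : R * R => f ((e, z.1), z.2)).
  by apply: measurableT_comp mf _; apply: measurable_fun_pair => //;
    exact: measurable_fun_pair.
have mF : measurable_fun setT (fun z : E * R => \int[unif]_y f (z, y)).
  exact: measurable_integral_snd.
have mev : measurable_fun setT (fun z : E * R => (z.1, evens z.2)).
  apply: measurable_fun_pair => //.
  exact: measurableT_comp (@measurable_evens R) measurable_snd.
transitivity (\int[unif]_x \int[unif]_y f ((h x, evens y), odds y)).
  apply: (hn (fun z => f ((z.1, evens z.2), odds z.2))) => //.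
  apply: measurableT_comp mf _; apply: measurable_fun_pair => //.
  exact: measurableT_comp (@measurable_odds R) measurable_snd.
transitivity (\int[unif]_x \int[unif]_z \int[unif]_y f ((h x, evens z), y)); last first.
  apply/esym; apply: (hn (fun z => \int[unif]_y f ((z.1, evens z.2), y))).
    exact: (measurableT_comp mF mev).
  by move=> x; exact: integral_ge0.
apply: eq_integral => x _.
transitivity (\int[unif]_z \int[unif]_y f (h x, z, y)).
  by apply: (unif_evens_odds (mge (h x))).
apply/esym; apply: (integral_evens (f := fun e => \int[unif]_y f (h x, e, y))).
  apply: (measurableT_comp mF (g := fun e : R => (h x, e))).
  exact: measurable_fun_pair.
by move=> e; exact: integral_ge0.
Qed.

Definition normal_seq (sigma : R) n x := normal_quantile sigma (unif_seq n x).

Lemma measurable_normal_seq sigma n : measurable_fun setT (normal_seq sigma n).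
Proof.
exact: measurableT_comp (measurable_normal_quantile _) (measurable_unif_seq n).
Qed.

Lemma indep_normal_seq d (E : measurableType d) (h : R -> E) n sigma
    (f : E * R -> \bar R) : indep_tail h n ->
  measurable_fun setT f -> (forall x, 0 <= f x) ->
  \int[unif]_x f (h x, normal_seq sigma n x) =
  \int[unif]_x \int[leb]_y (f (h x, y) * (normal_pdf 0 sigma y)%:E).
Proof.
move=> [mh hn] mf f0.
have mg : measurable_fun setT (fun z : E * R => (z.1, normal_quantile sigma (evens z.2))).
  apply: measurable_fun_pair => //.
  apply: measurableT_comp; first exact: measurable_normal_quantile.
  exact: measurableT_comp (@measurable_evens R) measurable_snd.
transitivity (\int[unif]_x \int[unif]_y f (h x, normal_quantile sigma (evens y))).
  apply: (hn (fun z => f (z.1, normal_quantile sigma (evens z.2)))) => //.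
  exact: measurableT_comp mf mg.
have mfe (e : E) : measurable_fun setT (fun y => f (e, y)).
  by apply: measurableT_comp mf _; exact: measurable_fun_pair.
apply: eq_integral => x _.
transitivity (\int[unif]_y f (h x, normal_quantile sigma y)).
  apply: (integral_evens (f := fun e => f (h x, normal_quantile sigma e))) => //.
  exact: measurableT_comp (mfe _) (measurable_normal_quantile _).
by apply: (@integral_normal_quantile R sigma (fun y => f (h x, y))).
Qed.

Lemma indep_normal_seqS d (E : measurableType d) (h : R -> E) n sigma :
  indep_tail h n -> indep_tail (fun x => (h x, normal_seq sigma n x)) n.+1.
Proof.
move=> hn.
have := indep_tail_comp (g := fun z : E * R => (z.1, normal_quantile sigma z.2)) _ (indep_tailS hn).
apply; apply: measurable_fun_pair => //.
exact: measurableT_comp (measurable_normal_quantile _) measurable_snd.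
Qed.

End independent_uniforms.

(** * Linear combinations of independent normal variables *)

Section normal_combination.
Context {R : realType}.
Local Open Scope ereal_scope.
Notation leb := (@lebesgue_measure R).
Notation unif := (uniform_prob (@ltr01 R)).

(** Completing the square: the joint density of [X + b Y] and [Y] is the density of the sum times
    the conditional density of [Y] given the sum. *)
Lemma normal_pdf_mul (s u b x y : R) : (0 < s)%R -> (0 < u)%R ->
  let v := (Num.sqrt (s ^+ 2 + (b * u) ^+ 2))%R in
  (normal_pdf 0 s (x - b * y) * normal_pdf 0 u y =
   normal_pdf 0 v x * normal_pdf (b * u ^+ 2 / v ^+ 2 * x) (s * u / v) y)%R.
Proof.
move=> s0 u0 v.
have v2 : (v ^+ 2 = s ^+ 2 + (b * u) ^+ 2)%R.
  by rewrite sqr_sqrtr// addr_ge0// sqr_ge0.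
have v0 : (0 < v)%R.
  by rewrite sqrtr_gt0 ltr_pwDl// ?exprn_gt0// sqr_ge0.
rewrite !normal_pdfE ?gt_eqF ?divr_gt0 ?mulr_gt0//.
move: v v2 v0 => {}v v2 v0.
have v4 : (s ^+ 2 + (b * u) ^+ 2 != 0)%R by rewrite -v2 gt_eqF// exprn_gt0.
rewrite mulrACA [RHS]mulrACA; congr (_ * _)%R.
  rewrite /normal_peak -!invfM; congr (_^-1)%R.
  have e (p : R) : (s ^+ 2 * p *+ 2 * (u ^+ 2 * p *+ 2) =
      v ^+ 2 * p *+ 2 * ((s * u / v) ^+ 2 * p *+ 2))%R.
    by field; rewrite gt_eqF.
  have sM (a c : R) : (0 <= a)%R -> (Num.sqrt a * Num.sqrt c = Num.sqrt (a * c))%R.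
    by move=> a0; rewrite sqrtrM.
  have sp (c : R) : (0 <= c ^+ 2 * pi *+ 2)%R.
    by rewrite mulrn_wge0// mulr_ge0 ?sqr_ge0 ?pi_ge0.
  by rewrite (sM _ _ (sp s)) (sM _ _ (sp v)) e.
rewrite /normal_fun -!expRD; apply: (congr1 expR).
rewrite !subr0 !expr_div_n v2.
by field; rewrite v4 !gt_eqF.
Qed.

Let normal_law (X : R -> R) s := forall f : R -> \bar R,
  measurable_fun setT f -> (forall x, 0 <= f x) ->
  \int[unif]_x f (X x) = \int[leb]_x (f x * (normal_pdf 0 s x)%:E).

Lemma normal_pdf_scale (b s y : R) : (b != 0)%R -> (0 < s)%R ->
  (normal_pdf 0 s y = `|b| * normal_pdf 0 (`|b| * s) (b * y))%R.
Proof.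
move=> b0 s0.
have nb0 : (0 < `|b|)%R by rewrite normr_gt0.
rewrite !normal_pdfE ?gt_eqF ?mulr_gt0// mulrA; congr (_ * _)%R.
  rewrite /normal_peak.
  have -> : ((`|b| * s) ^+ 2 * pi *+ 2 = `|b| ^+ 2 * (s ^+ 2 * pi *+ 2))%R by ring.
  rewrite sqrtrM ?sqr_ge0// sqrtr_sqr normr_id.
  by rewrite invfM mulrA divff ?mul1r// gt_eqF.
rewrite /normal_fun !subr0 !exprMn real_normK ?num_real//; apply: (congr1 expR).
by field; rewrite b0 gt_eqF.
Qed.

(** Independent terms are added one at a time and variances add. The alternative [X = 0] is the case
    of zero variance, where there is no density. *)
Lemma normal_law_combination (sigma b : nat -> R) n :
  (forall m, (0 < sigma m)%R) ->
  let X x := (\sum_(m < n) b m * normal_seq (sigma m) m x)%R in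
  indep_tail X n /\
  ((forall x, X x = 0%R) \/ exists2 s, (0 < s)%R & normal_law X s).
Proof.
move=> s0; elim: n => [|n IH] X.
  have XE : X = cst 0%R by apply/funext => x; rewrite /X big_ord0.
  split; first by rewrite XE; exact: indep_tail0.
  by left => x; rewrite XE.
move: IH; set Y := (fun x => _) => -[iY lY].
have XE : X = fun x => (Y x + b n * normal_seq (sigma n) n x)%R.
  by apply/funext => x; rewrite /X big_ord_recr.
have mg : measurable_fun setT (fun z : R * R => (z.1 + b n * z.2)%R).
  by apply: measurable_funD => //; exact: measurable_funM.
split.
  by rewrite XE; have := indep_tail_comp mg (indep_normal_seqS (sigma n) iY).
have lawX (f : R -> \bar R) : measurable_fun setT f -> (forall x, 0 <= f x) ->
    \int[unif]_x f (X x) = \int[unif]_x \int[leb]_y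
      (f (Y x + b n * y)%R * (normal_pdf 0 (sigma n) y)%:E).
  move=> mf f0; rewrite XE.
  have := @indep_normal_seq R _ R Y n (sigma n) (fun z => f (z.1 + b n * z.2)%R) iY; apply => //.
  exact: measurableT_comp mf mg.
have [bn0|bn0] := eqVneq (b n) 0%R.
  have -> : X = Y by rewrite XE; apply/funext => x; rewrite bn0 mul0r addr0.
  exact: lY.
right; case: lY => [Y0|[s sp lY]].
  exists (`|b n| * sigma n)%R; first by rewrite mulr_gt0// normr_gt0.
  move=> f mf f0; rewrite lawX//.
  have mh : measurable_fun setT (fun y => f y * (normal_pdf 0 (`|b n| * sigma n) y)%:E).
    by apply: emeasurable_funM => //; apply/measurable_EFinP; exact: measurable_normal_pdf.
  rewrite [RHS](integral_affine (a := b n) 0)//; last first.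
    by move=> x; rewrite mule_ge0// lee_fin normal_pdf_ge0.
  under eq_integral do under eq_integral do rewrite Y0.
  rewrite integral_unif_cst.
  rewrite -ge0_integralZl//; last 2 first.
  - apply: (measurableT_comp mh (g := fun x : R => 0 + b n * x)%R).
    by apply: measurable_funD => //; exact: measurable_funM.
  - by move=> x _; rewrite mule_ge0// lee_fin normal_pdf_ge0.
  apply: eq_integral => y _; rewrite add0r muleCA -EFinM.
  by rewrite -normal_pdf_scale.
pose v := (Num.sqrt (s ^+ 2 + (b n * sigma n) ^+ 2))%R.
exists v; first by rewrite sqrtr_gt0 ltr_pwDl// ?exprn_gt0// sqr_ge0.
move=> f mf f0; rewrite lawX//.
have mpdf m s' : measurable_fun setT (fun x : R => (normal_pdf m s' x)%:E).
  by apply/measurable_EFinP; exact: measurable_normal_pdf.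
have pdf0 m s' (x : R) : 0 <= (normal_pdf m s' x)%:E by rewrite lee_fin normal_pdf_ge0.
have mk : measurable_fun setT (fun z : R * R =>
    f (z.1 + b n * z.2)%R * (normal_pdf 0 (sigma n) z.2)%:E).
  apply: emeasurable_funM; first exact: measurableT_comp mf mg.
  exact: measurableT_comp (mpdf _ _) measurable_snd.
rewrite (lY (fun x => \int[leb]_y
   (f (x + b n * y)%R * (normal_pdf 0 (sigma n) y)%:E))); last 2 first.
- by apply: (@measurable_integral_snd R _ R _ (measurableTypeR R) leb _ mk) => z; exact: mule_ge0.
- by move=> x; apply: integral_ge0 => y _; exact: mule_ge0.
transitivity (\int[leb]_x \int[leb]_y
   (f (x + b n * y)%R * (normal_pdf 0 (sigma n) y)%:E * (normal_pdf 0 s x)%:E)).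
  apply: eq_integral => x _; rewrite ge0_integralZr//.
  - apply: (measurableT_comp mk (g := fun y : R => (x, y))).
    exact: measurable_fun_pair.
  - by move=> y _; exact: mule_ge0.
have mk2 : measurable_fun setT (fun z : R * R => f (z.1 + b n * z.2)%R *
    (normal_pdf 0 (sigma n) z.2)%:E * (normal_pdf 0 s z.1)%:E).
  by apply: emeasurable_funM => //; exact: measurableT_comp (mpdf _ _) measurable_fst.
have := @fubini_tonelli _ _ (measurableTypeR R) (measurableTypeR R) R leb leb _ mk2.
rewrite /= => ->; last by move=> z; rewrite !mule_ge0.
(* Once [x] denotes the whole sum, [normal_pdf_mul] factors the two densities, and the one in [y]
   integrates to 1. *)
transitivity (\int[leb]_y \int[leb]_x (f x *
   ((normal_pdf 0 s (x - b n * y) * normal_pdf 0 (sigma n) y)%R)%:E)).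
  apply: eq_integral => y _.
  rewrite [RHS](integral_affine (a := 1) (b n * y))%R ?oner_neq0//; last 2 first.
  - apply: emeasurable_funM => //; apply/measurable_EFinP.
    apply: measurable_funM => //.
    apply: measurableT_comp; first exact: measurable_normal_pdf.
    exact: measurable_funB.
  - by move=> x; rewrite mule_ge0// lee_fin mulr_ge0// normal_pdf_ge0.
  rewrite normr1 mul1e; apply: eq_integral => x _.
  rewrite mul1r (addrC (b n * y)%R) addrK EFinM -muleA.
  by congr (_ * _); rewrite muleC.
have mk3 : measurable_fun setT (fun z : R * R => f z.2 *
   ((normal_pdf 0 s (z.2 - b n * z.1) * normal_pdf 0 (sigma n) z.1)%R)%:E).
  apply: emeasurable_funM; first exact: measurableT_comp mf measurable_snd.
  apply/measurable_EFinP/measurable_funM.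
    apply: measurableT_comp; first exact: measurable_normal_pdf.
    by apply: measurable_funB => //; exact: measurable_funM.
  by apply: measurableT_comp => //; exact: measurable_normal_pdf.
have := @fubini_tonelli _ _ (measurableTypeR R) (measurableTypeR R) R leb leb _ mk3.
rewrite /= => ->; last by move=> z; rewrite mule_ge0// lee_fin mulr_ge0// normal_pdf_ge0.
apply: eq_integral => x _.
under eq_integral do rewrite normal_pdf_mul// EFinM muleA.
rewrite ge0_integralZl//.
- by rewrite integral_normal_pdf mule1.
- exact: mpdf.
- by rewrite mule_ge0.
Qed.

End normal_combination.

(** * Reversal of a Markov chain of rows *)

Section product_sigma_finite.
Context d1 d2 (T1 : measurableType d1) (T2 : measurableType d2) (R : realType).
Variables (m1 : {sigma_finite_measure set T1 -> \bar R})
  (m2 : {sigma_finite_measure set T2 -> \bar R}).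
Local Open Scope ereal_scope.

(** A named copy of the product, to which a sigma-finite structure is attached so that products can
    be iterated. *)
Definition product_measure := m1 \x m2.
HB.instance Definition _ := Measure.on product_measure.

Let product_measure_sigma_finite : sigma_finite setT product_measure.
Proof.
have /sigma_finiteP[F [TF ndF Foo]] := sigma_finiteT m1.
have /sigma_finiteP[G [TG ndG Goo]] := sigma_finiteT m2.
exists (fun n => F n `*` G n).
  apply/esym/seteqP; split => // -[x y] _.
  have [m _ Fm] : (\bigcup_n F n) x by rewrite -TF.
  have [n _ Gn] : (\bigcup_n G n) y by rewrite -TG.
  exists (m + n)%N => //; split.
    by move: Fm; exact/subsetPset/ndF/leq_addr.
  by move: Gn; exact/subsetPset/ndG/leq_addl.
move=> n; have [mF Ffin] := Foo n; have [mG Gfin] := Goo n.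
split; first exact: measurableX.
by rewrite /product_measure product_measure1E// lte_mul_pinfty// ge0_fin_numE.
Qed.

HB.instance Definition _ := Measure_isSigmaFinite.Build _ _ _ product_measure
  product_measure_sigma_finite.
End product_sigma_finite.

(** * Finite arrays of rows as nested products *)

Section array_space.
Context {R : realType}.
Variable dim : nat -> nat.
Local Notation row k := ((dim k).-tuple R).

(** The display of a product depends on those of its factors, so the recursion returns a display
    together with the space. Nesting pairs lets Tonelli's theorem peel off the last row. *)
Fixpoint array_sig (N : nat) : {d : measure_display & measurableType d} :=
  match N with
  | 0 => existT _ _ [the measurableType _ of row 0]
  | N'.+1 => existT _ _
      [the measurableType _ of (projT2 (array_sig N') * row N'.+1)%type]
  end.

Definition array (N : nat) : measurableType (projT1 (array_sig N)) :=
  projT2 (array_sig N).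

Fixpoint array_measure (N : nat) : {sigma_finite_measure set (array N) -> \bar R} :=
  match N return {sigma_finite_measure set (array N) -> \bar R} with
  | 0 => lebesgue_tuple (dim 0)
  | N'.+1 => [the {sigma_finite_measure set (array N' * row N'.+1)%type -> \bar R} of
      product_measure (array_measure N') (lebesgue_tuple (dim N'.+1))]
  end.

Definition last_row (N : nat) : array N -> row N :=
  match N return array N -> row N with
  | 0 => id
  | N'.+1 => snd
  end.

Lemma measurable_array_last N : measurable_fun setT (@last_row N).
Proof. by case: N => [|N]; [exact: measurable_id|exact: measurable_snd]. Qed.

(** Indexing by natural numbers, with default 0, avoids casts between row types. *)
Fixpoint array_coord (N : nat) : array N -> nat -> nat -> R :=
  match N return array N -> nat -> nat -> R with
  | 0 => fun e _ i => nth 0 (e : row 0) i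
  | N'.+1 => fun e k i =>
      if k == N'.+1 then nth 0 (e.2 : row N'.+1) i else array_coord e.1 k i
  end.

Lemma measurable_nth k i : measurable_fun setT (fun t : k.-tuple R => nth 0 t i).
Proof.
have [ik|ki] := ltnP i k.
  rewrite (_ : (fun _ => _) = fun t : k.-tuple R => tnth t (Ordinal ik)).
    exact: measurable_tnth.
  by apply/funext => t; rewrite (tnth_nth 0).
rewrite (_ : (fun _ => _) = cst 0); first exact: measurable_cst.
by apply/funext => t; rewrite nth_default// size_tuple.
Qed.

Lemma measurable_array_coord N k i :
  measurable_fun setT (fun e : array N => array_coord e k i).
Proof.
elim: N => [|N IH] /=; first exact: measurable_nth.
have [_|_] := eqVneq k N.+1.
  exact: measurableT_comp (@measurable_nth _ i) (@measurable_snd _ _ _ _).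
exact: measurableT_comp IH (@measurable_fst _ _ _ _).
Qed.

Fixpoint array_map (T : Type) (x : forall k, T -> row k) (N : nat) : T -> array N :=
  match N return T -> array N with
  | 0 => x 0%N
  | N'.+1 => fun w => (array_map x N' w, x N'.+1 w)
  end.

Lemma measurable_array_map d (T : measurableType d) (x : forall k, T -> row k) N :
  (forall k, measurable_fun setT (x k)) -> measurable_fun setT (array_map x N).
Proof.
move=> mx; elim: N => [|N IH]; first exact: mx.
by apply: measurable_fun_pair; [exact: IH|exact: mx].
Qed.

Lemma last_row_map (T : Type) (x : forall k, T -> row k) N w :
  last_row (array_map x N w) = x N w.
Proof. by case: N. Qed.

Lemma array_coord_map (T : Type) (x : forall k, T -> row k) N w k i :
  (k <= N)%N -> array_coord (array_map x N w) k i = nth 0 (x k w) i.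
Proof.
elim: N => [|N IH] /=; first by rewrite leqn0 => /eqP ->.
rewrite leq_eqVlt => /predU1P[->|kN]; first by rewrite eqxx.
by rewrite ltn_eqF// IH.
Qed.

(** The initial density 1 is meant for an empty row 0, whose law is a point mass. *)
Fixpoint array_density (q : forall k, row k -> row k.+1 -> R) (N : nat) : array N -> R :=
  match N return array N -> R with
  | 0 => fun=> 1
  | N'.+1 => fun e => array_density q e.1 * q N' (last_row e.1) e.2
  end.

Lemma array_density_ge0 q N e :
  (forall k u v, 0 <= q k u v) -> 0 <= @array_density q N e.
Proof. by move=> q0; elim: N e => //= N IH e; rewrite mulr_ge0. Qed.

Lemma measurable_array_density (q : forall k, row k -> row k.+1 -> R) N :
  (forall k, measurable_fun setT (fun z : row k * row k.+1 => q k z.1 z.2)) ->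
  measurable_fun setT (@array_density q N).
Proof.
move=> mq; elim: N => [|N IH]; first exact: measurable_cst.
apply: measurable_funM; first exact: measurableT_comp IH (@measurable_fst _ _ _ _).
apply: (measurableT_comp (mq N) (g := fun e : array N * row N.+1 => (last_row e.1, e.2))).
apply: measurable_fun_pair => //.
exact: measurableT_comp (@measurable_array_last N) (@measurable_fst _ _ _ _).
Qed.

End array_space.

(** Stated with an equation because [minn 0 M] does not reduce to 0 when [M] is a variable. *)
Lemma tuple_dim0_eq (R : realType) n (u v : n.-tuple R) : n = 0%N -> u = v.
Proof. by move=> n0; move: u v; rewrite n0 => u v; apply: eq_from_tnth => -[]. Qed.

Lemma integral_tuple_dim0 (R : realType) n (F : n.-tuple R -> \bar R) (v : n.-tuple R) : n = 0%N ->
  measurable_fun setT F -> (\int[lebesgue_tuple n]_u F u = F v)%E.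
Proof.
move=> n0; move: F v; rewrite n0 => F v mF.
by rewrite integral_tuple0//; congr F; apply: eq_from_tnth => -[].
Qed.

Section reversed_chain.
Context {R : realType}.
Variable dim : nat -> nat.
Local Notation row k := ((dim k).-tuple R).
Local Notation leb k := (@lebesgue_tuple R (dim k)).
Local Open Scope ereal_scope.
Context d (T : measurableType d) (P : probability T R).
(** [S k] stands for the events determined by the rows of index at least [k]. *)
Variables (x : forall k, T -> row k) (S : nat -> set (set T)).
Unset Implicit Arguments.
Variables (b : forall k, row k.+1 -> row k -> R) (p : forall k, row k.+1 -> R).
Variables (w : forall k, row k -> row k.+1 -> R) (s : forall k, row k -> R).
Variable kappa : nat -> R.
Hypothesis mx : forall k, measurable_fun setT (x k).
Hypothesis S_T : forall k, S k setT.
Hypothesis S_I : forall k B (A : set (row k)), S k.+1 B -> measurable A ->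
  S k (B `&` x k @^-1` A).
Hypothesis mS : forall k B, S k B -> measurable B.
Hypothesis b0 : forall k v u, (0 <= b k v u)%R.
Hypothesis mb : forall k, measurable_fun setT (fun z : row k.+1 * row k => b k z.1 z.2).
Hypothesis backward : forall k B A, S k.+1 B -> measurable A ->
  P (B `&` x k @^-1` A) = \int[P]_(t in B) \int[leb k]_(u in A) (b k (x k.+1 t) u)%:E.
Hypothesis p0 : forall k v, (0 <= p k v)%R.
Hypothesis mp : forall k, measurable_fun setT (p k).
Hypothesis marginal : forall k A, measurable A ->
  P (x k.+1 @^-1` A) = \int[leb k.+1]_(v in A) (p k v)%:E.
Hypothesis marginal0 : forall A, measurable A ->
  P (x 0 @^-1` A) = \int[leb 0]_(v in A) 1.
Hypothesis w0 : forall k u v, (0 <= w k u v)%R.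
Hypothesis mw : forall k, measurable_fun setT (fun z : row k * row k.+1 => w k z.1 z.2).
Hypothesis s0 : forall k u, (0 <= s k u)%R.
Hypothesis ms : forall k, measurable_fun setT (s k).
Hypothesis kappa0 : forall k, (0 <= kappa k)%R.
(* Thanks to [factor], the array is also a Markov chain from row [0] upwards, with
   transition density proportional to [w]. *)
Hypothesis factor : forall k u v,
  (p k v * b k v u = kappa k * w k u v * s k u)%R.
Hypothesis w_fin : forall k u, \int[leb k.+1]_v (w k u v)%:E < +oo.

(** Dividing [w] by its own mass removes [kappa] and [s]. Where that mass is 0 the quotient is 0,
    the inverse of 0 being 0. *)
Definition forward_density k (u : row k) (v : row k.+1) : R :=
  (w k u v / fine (\int[leb k.+1]_v (w k u v)%:E))%R.
Let q := forward_density.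

Let Z k (u : row k) : \bar R := \int[leb k.+1]_v (w k u v)%:E.
Let Z0 k u : 0 <= Z k u.
Proof. by apply: integral_ge0 => v _; rewrite lee_fin. Qed.
Let Zfin k u : Z k u \is a fin_num.
Proof. by rewrite ge0_fin_numE// w_fin. Qed.
Let q0 k u v : (0 <= q k u v)%R.
Proof. exact: divr_ge0 (w0 _ _ _) (fine_ge0 (Z0 _ _)). Qed.

Let mwu k u : measurable_fun setT (w k u).
Proof.
apply: (measurableT_comp (@mw k) (g := fun v => (u, v))).
exact: measurable_fun_pair.
Qed.

Let mbu k u : measurable_fun setT (fun v => b k v u).
Proof.
apply: (measurableT_comp (@mb k) (g := fun v => (v, u))).
exact: measurable_fun_pair.
Qed.

Let mZ k : measurable_fun setT (Z k).
Proof.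
apply: (@measurable_integral_snd _ _ _ _ _ (leb k.+1)
  (fun z : row k * row k.+1 => (w k z.1 z.2)%:E)).
  by apply/measurable_EFinP; exact: mw.
by move=> z; rewrite lee_fin; exact: w0.
Qed.

Lemma measurable_forward_density k :
  measurable_fun setT (fun z : row k * row k.+1 => forward_density k z.1 z.2).
Proof.
apply: measurable_funM; first exact: mw.
rewrite (_ : (fun _ => _) = fun z : row k * row k.+1 => (fine (Z k z.1) `^ (-1))%R).
  apply: (measurableT_comp (measurable_powR (-1)) (g := fun z => fine (Z k z.1))).
  apply: measurableT_comp => //.
  exact: measurableT_comp (mZ k) (@measurable_fst _ _ _ _).
by apply/funext => z; rewrite powR_inv1// fine_ge0// Z0.
Qed.

Let mqu k u : measurable_fun setT (q k u).
Proof.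
apply: (measurableT_comp (measurable_forward_density k) (g := fun v => (u, v))).
exact: measurable_fun_pair.
Qed.

(** Density at [u] of row [k] restricted to the event [B], as given by [backward] once the two
    integrals are exchanged. *)
Let beta k (B : set T) (u : row k) : \bar R := \int[P]_(t in B) (b k (x k.+1 t) u)%:E.

Let mbx k : measurable_fun setT (fun z : T * row k => (b k (x k.+1 z.1) z.2)%:E).
Proof.
apply/measurable_EFinP.
apply: (measurableT_comp (@mb k) (g := fun z => (x k.+1 z.1, z.2))).
apply: measurable_fun_pair => //.
exact: measurableT_comp (@mx k.+1) (@measurable_fst _ _ _ _).
Qed.

Let beta0 k B u : 0 <= beta k B u.
Proof. by apply: integral_ge0 => t _; rewrite lee_fin. Qed.

Let mbeta k B : measurable B -> measurable_fun setT (beta k B).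
Proof.
move=> mB.
rewrite (_ : beta k B = fun u => \int[P]_t ((b k (x k.+1 t) u)%:E * (\1_B t)%:E)).
  apply: (@measurable_fun_fubini_tonelli_G _ _ _ _ _ P
    (fun z : T * row k => (b k (x k.+1 z.1) z.2)%:E * (\1_B z.1)%:E)).
    apply: emeasurable_funM; first exact: mbx.
    apply/measurable_EFinP.
    apply: (measurableT_comp (f := (\1_B : T -> R))); last exact: measurable_fst.
    exact: measurable_indic.
  by move=> z; rewrite mule_ge0// lee_fin.
apply/funext => u; rewrite /beta integral_mkcond; apply: eq_integral => t _.
by rewrite epatch_indic.
Qed.

Let backwardE k B A : S k.+1 B -> measurable A ->
  P (B `&` x k @^-1` A) = \int[leb k]_(u in A) beta k B u.
Proof.
move=> SB mA; rewrite backward//.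
apply: (@tonelli_rect _ _ _ _ _ P (leb k)
  (fun z : T * row k => (b k (x k.+1 z.1) z.2)%:E)) => //.
- exact: mbx.
- by move=> z; rewrite lee_fin; exact: b0.
- exact: mS _ _ SB.
Qed.

Let integral_law k (B : set T) (f : row k -> \bar R) : measurable B ->
  measurable_fun setT f -> (forall u, 0 <= f u) ->
  (forall A, measurable A -> P (B `&` x k @^-1` A) = \int[leb k]_(u in A) f u) ->
  forall A (g : row k -> \bar R), measurable A ->
    measurable_fun setT g -> (forall u, 0 <= g u) ->
  \int[P]_(t in B `&` x k @^-1` A) g (x k t) = \int[leb k]_(u in A) (g u * f u).
Proof.
move=> mB mf f0 hf A g mA mg g0.
have mA' : measurable (x k @^-1` A) by rewrite -[X in measurable X]setTI; exact: mx.
have mgA : measurable_fun setT (g \_ A).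
  by apply/(measurable_restrictT _ _).1 => //; exact: measurable_funTS.
have gA0 u : 0 <= (g \_ A) u by rewrite patchE; case: ifP.
have := integral_density (nu := pushforward_measure (mrestr P mB) (mx k)) mf f0 _ mgA gA0.
move=> /(_ (leb k)) h.
transitivity (\int[leb k]_u ((g \_ A) u * f u)); last first.
  rewrite [RHS]integral_mkcond; apply: eq_integral => u _.
  by rewrite !patchE; case: ifP => //; rewrite mul0e.
rewrite -h; last by move=> C mC; rewrite -hf// /= /pushforward /mrestr setIC.
transitivity (\int[mrestr P mB]_(t in x k @^-1` setT) ((g \_ A) \o x k) t); last first.
  by apply/esym; apply: (ge0_integral_pushforward (mx k)).
rewrite preimage_setT (integral_density (mu := P) (f := fun t => (\1_B t)%:E)); last 5 first.
- by apply/measurable_EFinP; exact: measurable_indic.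
- by move=> t; rewrite lee_fin.
- by move=> F mF; rewrite integral_indic// /= /mrestr setIC.
- exact: measurableT_comp mgA (mx k).
- by move=> t; exact: gA0.
rewrite [LHS]integral_mkcond; apply: eq_integral => t _.
rewrite patchE in_setI indicE /= patchE.
have -> : (t \in x k @^-1` A) = (x k t \in A) by apply/idP/idP; rewrite !inE.
by case: (t \in B); case: (x k t \in A); rewrite ?mule1 ?mule0.
Qed.

Fixpoint rev_density N : array dim N -> R :=
  match N return array dim N -> R with
  | 0 => fun=> 1%R
  | N'.+1 => fun e => (rev_density N' e.1 * b N' e.2 (last_row e.1))%R
  end.

Let rev_density0 N e : (0 <= rev_density N e)%R.
Proof. by elim: N e => //= N IH e; rewrite mulr_ge0. Qed.

Let mlast N : measurable_fun setT (@last_row R dim N).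
Proof. exact: measurable_array_last. Qed.

Let measurable_rev_density N : measurable_fun setT (rev_density N).
Proof.
elim: N => [|N IH]; first exact: measurable_cst.
apply: measurable_funM; first exact: measurableT_comp IH (@measurable_fst _ _ _ _).
apply: (measurableT_comp (mb N) (g := fun e : array dim N * row N.+1 => (e.2, last_row e.1))).
apply: measurable_fun_pair => //.
exact: measurableT_comp (mlast N) (@measurable_fst _ _ _ _).
Qed.

Let h N := array_map x N.
Let mh N : measurable_fun setT (h N).
Proof. exact: measurable_array_map. Qed.

(** Passing from [N] to [N.+1], the condition on row [N.+1] is merged into the event [B], and the
    induction hypothesis is applied to the enlarged event. This requires the transition law
    conditionally on all higher rows, and not only on the next one. *)
Let law_given N B (C : set (array dim N)) : S N.+1 B -> measurable C ->
  P (B `&` h N @^-1` C) =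
  \int[array_measure dim N]_(e in C) ((rev_density N e)%:E * beta N B (last_row e)).
Proof.
elim: N B C => [|N IH] B C SB mC.
  by rewrite backwardE//; apply: eq_integral => u _; rewrite /= mul1e.
have mB := mS _ _ SB.
pose f (z : array dim N * row N.+1) :=
  (rev_density N z.1)%:E * ((b N z.2 (last_row z.1))%:E * beta N.+1 B z.2).
have mf : measurable_fun setT f.
  apply: emeasurable_funM.
    apply/measurable_EFinP.
    exact: measurableT_comp (measurable_rev_density N) (@measurable_fst _ _ _ _).
  apply: emeasurable_funM.
    apply/measurable_EFinP.
    apply: (measurableT_comp (mb N)
      (g := fun e : array dim N * row N.+1 => (e.2, last_row e.1))).
    apply: measurable_fun_pair => //.
    exact: measurableT_comp (mlast N) (@measurable_fst _ _ _ _).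
  exact: measurableT_comp (mbeta N.+1 B mB) (@measurable_snd _ _ _ _).
have f0 z : 0 <= f z by rewrite !mule_ge0// lee_fin.
transitivity (\int[array_measure dim N \x leb N.+1]_(z in C) f z); last first.
  by apply: eq_integral => -[e v] _; rewrite /f /= EFinM muleA.
rewrite -(@rect_density _ _ _ _ _ _ _
  (pushforward_measure (mrestr P mB) (mh N.+1)))//.
- by rewrite /= /pushforward /mrestr setIC.
- rewrite /= /pushforward /mrestr (le_lt_trans (probability_le1 _ _)) ?ltry//.
  by rewrite preimage_setT setTI.
move=> C1 A mC1 mA.
rewrite /= /pushforward /mrestr.
rewrite (_ : _ `&` B = (B `&` x N.+1 @^-1` A) `&` h N @^-1` C1); last first.
  by apply/seteqP; split => t /= [? ?]; tauto.
rewrite IH//; last exact: S_I.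
apply: eq_integral => e _.
rewrite /f /= ge0_integralZl//.
- congr (_ * _); rewrite /beta -/(beta _ _ _).
  apply: (@integral_law N.+1 B (beta N.+1 B) mB (mbeta N.+1 B mB) (@beta0 _ _) _ _
    (fun v => (b N v (last_row e))%:E)) => //.
  + by move=> D mD; exact: backwardE.
  + by apply/measurable_EFinP; exact: mbu.
  + by move=> u; rewrite lee_fin.
- apply: measurable_funTS; apply: emeasurable_funM; last exact: mbeta.
  by apply/measurable_EFinP; exact: mbu.
- by move=> v _; rewrite mule_ge0// lee_fin.
- by rewrite lee_fin.
Qed.

Let D N : array dim N -> R := @array_density R dim q N.
Let D0 N e : (0 <= D N e)%R.
Proof. exact: array_density_ge0. Qed.
Let mD N : measurable_fun setT (D N).
Proof. by apply: measurable_array_density; exact: measurable_forward_density. Qed.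

(** Here [B] is a condition on row [N.+1] alone, so its marginal density enters and [factor] trades
    [p * b] for [w]: the integral over row [N.+1] now involves only [w]. *)
Let sweep N (C : set (array dim N)) A : measurable C -> measurable A ->
  P (x N.+1 @^-1` A `&` h N @^-1` C) =
  \int[array_measure dim N]_(e in C) ((rev_density N e * kappa N * s N (last_row e))%:E *
     \int[leb N.+1]_(v in A) (w N (last_row e) v)%:E).
Proof.
move=> mC mA; rewrite law_given//; last first.
  by rewrite -[X in S _ X]setTI; apply: S_I.
apply: eq_integral => e _.
rewrite -mulrA EFinM -muleA; congr (_ * _).
have -> : x N.+1 @^-1` A = setT `&` x N.+1 @^-1` A by rewrite setTI.
rewrite /beta (@integral_law N.+1 setT (fun v => (p N v)%:E) measurableT _ _ _ _
    (fun v => (b N v (last_row e))%:E)) //.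
- rewrite -ge0_integralZl//.
  + apply: eq_integral => v _; rewrite -!EFinM mulrC factor; congr EFin; ring.
  + by apply: measurable_funTS; apply/measurable_EFinP; exact: mwu.
  + by move=> v _; rewrite lee_fin.
  + by rewrite lee_fin mulr_ge0.
- by apply/measurable_EFinP; exact: mp.
- by move=> u; rewrite lee_fin.
- by move=> F mF; rewrite setTI marginal.
- by apply/measurable_EFinP; exact: mbu.
- by move=> u; rewrite lee_fin.
Qed.

(** The law of rows 0 to [N] has two densities: [F], from [sweep] with no condition on row [N.+1],
    and [D], from the induction hypothesis. The joint law with row [N.+1] is the integral of the
    normalized transition [Q] against [F], and [F] may be replaced by [D] there. *)
Lemma forward_law N (C : set (array dim N)) : measurable C ->
  P (array_map x N @^-1` C) =
  \int[array_measure dim N]_(e in C) (array_density forward_density e)%:E.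
Proof.
elim: N C => [|N IH] C mC; first by rewrite marginal0.
pose f (z : array dim N * row N.+1) :=
  (D N z.1)%:E * (q N (last_row z.1) z.2)%:E.
have mf : measurable_fun setT f.
  apply: emeasurable_funM; apply/measurable_EFinP.
    exact: measurableT_comp (mD N) (@measurable_fst _ _ _ _).
  apply: (measurableT_comp (measurable_forward_density N)
      (g := fun e : array dim N * row N.+1 => (last_row e.1, e.2))).
  apply: measurable_fun_pair => //.
  exact: measurableT_comp (mlast N) (@measurable_fst _ _ _ _).
have f0 z : 0 <= f z by rewrite !mule_ge0// lee_fin.
transitivity (\int[array_measure dim N \x leb N.+1]_(z in C) f z); last first.
  by apply: eq_integral => -[e v] _; rewrite /f /= EFinM.
rewrite -(@rect_density _ _ _ _ _ _ _ (pushforward_measure P (mh N.+1)))//.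
  by rewrite /= /pushforward preimage_setT probability_setT ltry.
move=> C1 A mC1 mA.
rewrite /= /pushforward.
rewrite (_ : h N.+1 @^-1` _ = x N.+1 @^-1` A `&` h N @^-1` C1); last first.
  by apply/seteqP; split => t /= [? ?]; tauto.
rewrite sweep//.
pose Q e := \int[leb N.+1]_(v in A) (q N (last_row e) v)%:E.
have Q0 e : 0 <= Q e by apply: integral_ge0 => v _; rewrite lee_fin.
have QZ e : Q e * Z N (last_row e) = \int[leb N.+1]_(v in A) (w N (last_row e) v)%:E.
  rewrite /Q /q /forward_density.
  under eq_integral do rewrite EFinM.
  rewrite ge0_integralZr//; last 3 first.
  - by apply: measurable_funTS; apply/measurable_EFinP; exact: mwu.
  - by move=> v _; rewrite lee_fin.
  - by rewrite lee_fin invr_ge0 fine_ge0// Z0.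
  rewrite -muleA -[X in _ * (_ * X)](fineK (Zfin N (last_row e))) -EFinM.
  (* If the total mass of [w] is 0, so is its integral over [A], and both sides vanish. *)
  have [z0|z0] := eqVneq (fine (Z N (last_row e))) 0%R.
    rewrite -/(Z _ _) z0 mulr0 mule0; apply/esym/eqP; rewrite eq_le.
    rewrite integral_ge0 ?andbT; last by move=> v _; rewrite lee_fin.
    have -> : 0 = Z N (last_row e) by rewrite -[RHS]fineK ?z0.
    apply: ge0_subset_integral => //.
      by apply/measurable_EFinP; exact: mwu.
    by move=> v _; rewrite lee_fin.
  by rewrite mulVf// mule1.
have mQ : measurable_fun setT Q.
  rewrite (_ : Q = fun e => \int[leb N.+1]_v
     ((q N (last_row e) v)%:E * (\1_A v)%:E)); last first.
    apply/funext => e; rewrite /Q integral_mkcond; apply: eq_integral => v _.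
    by rewrite epatch_indic.
  apply: (@measurable_fun_fubini_tonelli_F _ _ _ _ _ (leb N.+1)
    (fun z : array dim N * row N.+1 => (q N (last_row z.1) z.2)%:E * (\1_A z.2)%:E)).
    apply: emeasurable_funM; apply/measurable_EFinP.
      apply: (measurableT_comp (measurable_forward_density N)
        (g := fun e : array dim N * row N.+1 => (last_row e.1, e.2))).
      apply: measurable_fun_pair => //.
      exact: measurableT_comp (mlast N) (@measurable_fst _ _ _ _).
    apply: (measurableT_comp (f := (\1_A : row N.+1 -> R))); last exact: measurable_snd.
    exact: measurable_indic.
  by move=> z; rewrite mule_ge0// lee_fin.
pose F e := (rev_density N e * kappa N * s N (last_row e))%:E * Z N (last_row e).
have F0 e : 0 <= F e by rewrite mule_ge0 ?Z0// lee_fin !mulr_ge0.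
have mF : measurable_fun setT F.
  apply: emeasurable_funM; last exact: measurableT_comp (mZ N) (mlast N).
  apply/measurable_EFinP; apply: measurable_funM.
    exact: measurable_funM.
  exact: measurableT_comp (ms N) (mlast N).
have lawF E : measurable E -> pushforward_measure P (mh N) E = 
    \int[array_measure dim N]_(e in E) F e.
  move=> mE; have := @sweep N E setT mE measurableT; rewrite preimage_setT setTI.
  by apply.
have lawD E : measurable E -> pushforward_measure P (mh N) E = 
    \int[array_measure dim N]_(e in E) (D N e)%:E by move=> mE; exact: IH.
have mQC : measurable_fun setT (Q \_ C1).
  by apply/(measurable_restrictT _ _).1 => //; exact: measurable_funTS.
have QC0 u : 0 <= (Q \_ C1) u by rewrite patchE; case: ifP.
transitivity (\int[array_measure dim N]_e ((Q \_ C1) e * F e)).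
  rewrite integral_mkcond; apply: eq_integral => e _; rewrite !patchE; case: ifP => _.
    by rewrite -QZ /F muleCA.
  by rewrite mul0e.
(* Both densities represent the same law, so the integral against [F] is turned into one against
   that law, then into one against [D]. *)
rewrite -(integral_density mF F0 lawF mQC QC0).
rewrite (integral_density (mu := array_measure dim N) (f := fun e => (D N e)%:E) _ _ lawD mQC QC0); last 2 first.
- exact/measurable_EFinP.
- by move=> e; rewrite lee_fin.
rewrite [RHS]integral_mkcond; apply: eq_integral => e _; rewrite !patchE; case: ifP => _.
  rewrite /f /= ge0_integralZl//.
  - by rewrite muleC.
  - by apply: measurable_funTS; apply/measurable_EFinP; exact: mqu.
  - by move=> v _; rewrite lee_fin.
  - by rewrite lee_fin.
by rewrite mul0e.
Qed.

Lemma forward_law_integral N (g : array dim N -> \bar R) :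
  measurable_fun setT g -> (forall e, 0 <= g e) ->
  \int[P]_t g (array_map x N t) =
  \int[array_measure dim N]_e (g e * (array_density forward_density e)%:E).
Proof.
move=> mg g0.
rewrite -(integral_density (nu := pushforward_measure P (mh N))
  (f := fun e => (array_density forward_density e)%:E) _ _ _ mg g0).
- by rewrite /pushforward_measure ge0_integral_pushforward// preimage_setT.
- by apply/measurable_EFinP; exact: mD.
- by move=> e; rewrite lee_fin D0.
- by move=> A mA; exact: forward_law.
Qed.

End reversed_chain.
Set Implicit Arguments.

(** * Gaussian chains of rows *)

Section normal_tuple.
Context {R : realType}.
Local Open Scope ereal_scope.
Notation leb := (@lebesgue_measure R).
Notation unif := (uniform_prob (@ltr01 R)).

Lemma measurable_prod_normal_pdf d (b s : 'I_d -> R) :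
  measurable_fun setT
    (fun z : d.-tuple R => (\prod_(m < d) normal_pdf (b m) (s m) (tnth z m))%R).
Proof.
apply: measurable_prod => m _; apply: measurableT_comp; last exact: measurable_tnth.
exact: measurable_normal_pdf.
Qed.

Lemma prod_normal_pdf_ge0 d (b s : 'I_d -> R) (z : d.-tuple R) :
  (0 <= \prod_(m < d) normal_pdf (b m) (s m) (tnth z m))%R.
Proof. by apply: prodr_ge0 => m _; exact: normal_pdf_ge0. Qed.

Lemma normal_pdf_standard (b s x : R) : (0 < s)%R ->
  (s * normal_pdf b s (b + s * x) = normal_pdf 0 1 x)%R.
Proof.
move=> s0; rewrite !normal_pdfE ?gt_eqF// mulrA; congr (_ * _)%R.
  rewrite /normal_peak expr1n mul1r.
  rewrite -mulrnAr sqrtrM ?sqr_ge0// sqrtr_sqr gtr0_norm//.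
  by rewrite invfM mulrA divff ?mul1r// gt_eqF.
rewrite /normal_fun subr0 addrAC subrr add0r; apply: (congr1 expR).
rewrite expr1n exprMn -[(s ^+ 2 *+ 2)%R]mulr_natr; field; rewrite gt_eqF//.
Qed.

(** One-dimensional affine substitutions, one per coordinate, since the scales [s m] differ. *)
Lemma integral_normal_tuple d (b s : 'I_d -> R) (F : d.-tuple R -> \bar R) :
  (forall m, (0 < s m)%R) -> measurable_fun setT F -> (forall v, 0 <= F v) ->
  \int[lebesgue_tuple d]_v (F v * (\prod_(m < d) normal_pdf (b m) (s m) (tnth v m))%R%:E) =
  \int[lebesgue_tuple d]_z (F [tuple (b m + s m * tnth z m)%R | m < d] *
     (\prod_(m < d) normal_pdf 0 1 (tnth z m))%R%:E).
Proof.
elim: d b s F => [|d IH] b s F s0 mF F0.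
  rewrite !integral_tuple0; last 2 first.
  - apply: emeasurable_funM.
      apply: measurableT_comp mF _; by apply: measurable_mktuple => -[m i]; have := i; rewrite ltn0.
    by apply/measurable_EFinP; exact: measurable_prod_normal_pdf.
  - apply: emeasurable_funM => //.
    by apply/measurable_EFinP; exact: measurable_prod_normal_pdf.
  by rewrite !big_ord0; congr (F _ * _); apply: eq_from_tnth => -[].
have mFc (x : R) : measurable_fun setT (fun t : d.-tuple R => F [the d.+1.-tuple R of x :: t]).
  apply: (measurableT_comp mF (g := fun t => tuple_cons (x, t))).
  apply: measurableT_comp; first exact: measurable_tuple_cons.
  exact: measurable_fun_pair.
have mpdf (x : R) : measurable_fun setT (normal_pdf (b ord0) (s ord0)).
  exact: measurable_normal_pdf.
have mL : measurable_fun setT (fun v : d.+1.-tuple R =>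
    F v * (\prod_(m < d.+1) normal_pdf (b m) (s m) (tnth v m))%R%:E).
  apply: emeasurable_funM => //.
  by apply/measurable_EFinP; exact: measurable_prod_normal_pdf.
have mR : measurable_fun setT (fun z : d.+1.-tuple R =>
    F [tuple (b m + s m * tnth z m)%R | m < d.+1] * (\prod_(m < d.+1) normal_pdf 0 1 (tnth z m))%R%:E).
  apply: emeasurable_funM; last by apply/measurable_EFinP; exact: measurable_prod_normal_pdf.
  apply: measurableT_comp mF _; apply: measurable_mktuple => m.
  by apply: measurable_funD => //; apply: measurable_funM => //; exact: measurable_tnth.
rewrite [LHS](integral_tupleS mL); last first.
  by move=> v; rewrite mule_ge0// lee_fin prod_normal_pdf_ge0.
rewrite [RHS](integral_tupleS mR); last first.
  by move=> v; rewrite mule_ge0// lee_fin prod_normal_pdf_ge0.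
rewrite [LHS](integral_affine (a := s ord0) (b ord0)) ?gt_eqF//; last 2 first.
- apply: (@measurable_integral_snd R _ (measurableTypeR R) _ _ (lebesgue_tuple d)
    (fun z => F (tuple_cons z) *
      (\prod_(m < d.+1) normal_pdf (b m) (s m) (tnth (tuple_cons z) m))%R%:E)).
    by apply: measurableT_comp mL _; exact: measurable_tuple_cons.
  by move=> z; rewrite mule_ge0// lee_fin prod_normal_pdf_ge0.
- by move=> x; apply: integral_ge0 => t _; rewrite mule_ge0// lee_fin prod_normal_pdf_ge0.
rewrite -ge0_integralZl//; last 2 first.
- apply: (@measurable_integral_snd R _ (measurableTypeR R) _ _ (lebesgue_tuple d)
    (fun z => F (tuple_cons ((b ord0 + s ord0 * z.1)%R, z.2)) *
      (\prod_(m < d.+1) normal_pdf (b m) (s m)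
        (tnth (tuple_cons ((b ord0 + s ord0 * z.1)%R, z.2)) m))%R%:E)).
    apply: (measurableT_comp mL (g := fun z => tuple_cons ((b ord0 + s ord0 * z.1)%R, z.2))).
    apply: measurableT_comp; first exact: measurable_tuple_cons.
    apply: measurable_fun_pair => //.
    by apply: measurable_funD => //; exact: measurable_funM.
  by move=> z; rewrite mule_ge0// lee_fin prod_normal_pdf_ge0.
- by move=> x _; apply: integral_ge0 => t _; rewrite mule_ge0// lee_fin prod_normal_pdf_ge0.
apply: eq_integral => x _.
pose c := (s ord0 * normal_pdf (b ord0) (s ord0) (b ord0 + s ord0 * x))%R.
transitivity (\int[lebesgue_tuple d]_t ((F [the d.+1.-tuple R of (b ord0 + s ord0 * x)%R :: t] * c%:E) *
    (\prod_(m < d) normal_pdf (b (lift ord0 m)) (s (lift ord0 m)) (tnth t m))%R%:E)).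
  rewrite -ge0_integralZl//.
  - apply: eq_integral => t _; rewrite big_ord_recl tnth0 gtr0_norm// /c.
    under eq_bigr do rewrite tnthS.
    by rewrite !EFinM -!muleA; rewrite muleCA; congr (_ * _); rewrite muleCA.
  - apply: emeasurable_funM; first exact: mFc.
    apply/measurable_EFinP.
    apply: (measurableT_comp (measurable_prod_normal_pdf b s)
      (g := fun t => tuple_cons ((b ord0 + s ord0 * x)%R, t))).
    apply: measurableT_comp; first exact: measurable_tuple_cons.
    exact: measurable_fun_pair.
  - by move=> t _; rewrite mule_ge0// lee_fin prod_normal_pdf_ge0.
have c0 : (0 <= c)%R by rewrite mulr_ge0 ?normal_pdf_ge0// ltW.
rewrite (IH (fun m => b (lift ord0 m)) (fun m => s (lift ord0 m))
  (fun t => F [the d.+1.-tuple R of (b ord0 + s ord0 * x)%R :: t] * c%:E))//; last 2 first.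
- by apply: emeasurable_funM => //; exact: mFc.
- by move=> v; rewrite mule_ge0.
apply: eq_integral => t _; rewrite big_ord_recl tnth0 /c normal_pdf_standard//.
under [in RHS]eq_bigr do rewrite tnthS.
rewrite EFinM -muleA; congr (F _ * _).
apply: eq_from_tnth => i; rewrite [in RHS]tnth_mktuple.
by case: (unliftP ord0 i) => [m|] ->; rewrite ?tnthS ?tnth0 ?tnth_mktuple.
Qed.

Definition normals n d (x : R) : d.-tuple R := [tuple normal_seq 1 (n + m) x | m < d].

Lemma normalsS n d x :
  normals n d.+1 x = [the d.+1.-tuple R of normal_seq 1 n x :: normals n.+1 d x].
Proof.
apply: eq_from_tnth => i; rewrite tnth_mktuple.
case: (unliftP ord0 i) => [m|] ->; last by rewrite tnth0 addn0.
by rewrite tnthS tnth_mktuple /= /bump/= add1n addnS.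
Qed.

Lemma indep_normals dE (E : measurableType dE) (h : R -> E) n d : indep_tail h n ->
  indep_tail (fun x => (h x, normals n d x)) (n + d) /\
  forall f : E * d.-tuple R -> \bar R, measurable_fun setT f -> (forall z, 0 <= f z) ->
    \int[unif]_x f (h x, normals n d x) = \int[unif]_x \int[lebesgue_tuple d]_z
      (f (h x, z) * (\prod_(m < d) normal_pdf 0 1 (tnth z m))%R%:E).
Proof.
elim: d dE E h n => [|d IH] dE E h n hn.
  have n0 x : normals n 0 x = [tuple] by apply: eq_from_tnth => -[].
  split.
    rewrite addn0 (_ : (fun x => _) = (fun e => (e, [tuple])) \o h); last first.
      by apply/funext => x /=; rewrite n0.
    by apply: indep_tail_comp => //; exact: measurable_fun_pair.
  move=> f mf f0; apply: eq_integral => x _; rewrite integral_tuple0.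
    by rewrite big_ord0 mule1 n0.
  apply: emeasurable_funM.
    by apply: measurableT_comp mf _; exact: measurable_fun_pair.
  by apply/measurable_EFinP; exact: measurable_prod_normal_pdf.
have hn1 := indep_normal_seqS 1 hn.
have [i1 law1] := IH _ _ _ _ hn1.
pose G (z : E * R * d.-tuple R) : E * d.+1.-tuple R := (z.1.1, tuple_cons (z.1.2, z.2)).
have mG : measurable_fun setT G.
  apply: measurable_fun_pair; first exact: measurableT_comp.
  apply: measurableT_comp; first exact: measurable_tuple_cons.
  by apply: measurable_fun_pair => //; exact: measurableT_comp.
have GE x : (h x, normals n d.+1 x) = G ((h x, normal_seq 1 n x), normals n.+1 d x).
  by rewrite normalsS.
split.
  rewrite (_ : (fun x => _) = G \o (fun x => ((h x, normal_seq 1 n x), normals n.+1 d x))); last first.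
    by apply/funext => x; rewrite GE.
  by apply: indep_tail_comp => //; rewrite addnS -addSn.
move=> f mf f0.
transitivity (\int[unif]_x f (G ((h x, normal_seq 1 n x), normals n.+1 d x))).
  by apply: eq_integral => x _; rewrite GE.
have mfG : measurable_fun setT (f \o G) by exact: measurableT_comp.
rewrite (law1 (f \o G))//; last by move=> z; exact: f0.
pose F (z : E * R) := \int[lebesgue_tuple d]_t
  (f (G (z, t)) * (\prod_(m < d) normal_pdf 0 1 (tnth t m))%R%:E).
have mFi : measurable_fun setT (fun z : E * R * d.-tuple R =>
    f (G z) * (\prod_(m < d) normal_pdf 0 1 (tnth z.2 m))%R%:E).
  apply: emeasurable_funM => //; apply/measurable_EFinP.
  exact: measurableT_comp (measurable_prod_normal_pdf _ _) (@measurable_snd _ _ _ _).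
have mF : measurable_fun setT F.
  apply: (@measurable_integral_snd R _ _ _ _ _ (fun z : E * R * d.-tuple R =>
    f (G z) * (\prod_(m < d) normal_pdf 0 1 (tnth z.2 m))%R%:E)) => //.
  by move=> z; rewrite mule_ge0// lee_fin prod_normal_pdf_ge0.
have F0 z : 0 <= F z.
  by apply: integral_ge0 => t _; rewrite mule_ge0// lee_fin prod_normal_pdf_ge0.
rewrite [LHS](indep_normal_seq 1 (f := F) hn)//.
apply: eq_integral => x _; rewrite integral_tupleS; last 2 first.
- apply: emeasurable_funM.
    by apply: measurableT_comp mf _; exact: measurable_fun_pair.
  by apply/measurable_EFinP; exact: measurable_prod_normal_pdf.
- by move=> z; rewrite mule_ge0// lee_fin prod_normal_pdf_ge0.
apply: eq_integral => y _; rewrite /F muleC -ge0_integralZl//.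
- apply: eq_integral => t _; rewrite big_ord_recl tnth0.
  under [in RHS]eq_bigr do rewrite tnthS.
  by rewrite EFinM muleCA.
- apply: (measurableT_comp mFi (g := fun t => ((h x, y), t))).
  exact: measurable_fun_pair.
- by move=> t _; rewrite mule_ge0// lee_fin prod_normal_pdf_ge0.
- by rewrite lee_fin normal_pdf_ge0.
Qed.

End normal_tuple.

Section gaussian_rows.
Context {R : realType}.
Local Open Scope ereal_scope.
Notation unif := (uniform_prob (@ltr01 R)).
Variable dim : nat -> nat.
Hypothesis dim0 : dim 0 = 0%N.
Local Notation row k := ((dim k).-tuple R).
Variable A : forall k, 'I_(dim k.+1) -> 'I_(dim k) -> R.
Variable sigma : forall k, 'I_(dim k.+1) -> R.
Hypothesis sigma0 : forall k m, (0 < sigma (k := k) m)%R.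

Definition row_mean k (u : row k) (m : 'I_(dim k.+1)) : R :=
  (\sum_(i < dim k) A m i * tnth u i)%R.

Definition gaussian_density k (u : row k) (v : row k.+1) : R :=
  (\prod_(m < dim k.+1) normal_pdf (row_mean u m) (sigma m) (tnth v m))%R.

(** Number of normal variables consumed by rows 1 to [k], so that the next row draws fresh ones; it
    later serves as the exponent of the Jacobian when a whole array is rescaled. *)
Fixpoint offset (k : nat) : nat := if k is l.+1 then (offset l + dim k)%N else 0.

Fixpoint gaussian_row (k : nat) : R -> row k :=
  match k with
  | 0 => fun=> [tuple 0%R | i < dim 0]
  | l.+1 => fun x => [tuple (row_mean (gaussian_row l x) m +
       sigma m * tnth (normals (offset l) (dim l.+1) x) m)%R | m < dim l.+1]
  end.

Lemma measurable_row_mean k m : measurable_fun setT (fun u : row k => row_mean u m).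
Proof.
by apply: measurable_sum => i; apply: measurable_funM => //; exact: measurable_tnth.
Qed.

Lemma measurable_gaussian_row k : measurable_fun setT (gaussian_row k).
Proof.
elim: k => [|k IH]; first by apply: measurable_mktuple => i; exact: measurable_cst.
apply: measurable_mktuple => m; apply: measurable_funD.
  exact: measurableT_comp (measurable_row_mean m) IH.
apply: measurable_funM => //.
rewrite /= (_ : (fun x => _) = normal_seq 1 (offset k + m)); first exact: measurable_normal_seq.
by apply/funext => x; rewrite tnth_mktuple.
Qed.

Lemma gaussian_density_ge0 k (u : row k) v : (0 <= gaussian_density u v)%R.
Proof. by apply: prodr_ge0 => m _; exact: normal_pdf_ge0. Qed.

Lemma measurable_gaussian_density k :
  measurable_fun setT (fun z : row k * row k.+1 => gaussian_density z.1 z.2).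
Proof.
apply: measurable_prod => m _.
(* Moving the mean into the argument makes the density a function of one variable composed with a
   measurable map, hence jointly measurable in both rows. *)
rewrite (_ : (fun _ => _) = fun z : row k * row k.+1 =>
   normal_pdf 0 (sigma m) (tnth z.2 m - row_mean z.1 m)%R); last first.
  apply/funext => z; rewrite !normal_pdfE ?gt_eqF//.
  by rewrite /normal_fun subr0.
apply: measurableT_comp; first exact: measurable_normal_pdf.
apply: measurable_funB.
  exact: measurableT_comp (measurable_tnth m) (@measurable_snd _ _ _ _).
exact: measurableT_comp (measurable_row_mean m) (@measurable_fst _ _ _ _).
Qed.

(** Row [N.+1] is an affine image of fresh normal variables, independent of the earlier rows; the
    substitution of [integral_normal_tuple] turns their standard density into [gaussian_density]. *)
Lemma gaussian_rows_law N :
  indep_tail (array_map gaussian_row N) (offset N) /\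
  forall g : array dim N -> \bar R, measurable_fun setT g -> (forall e, 0 <= g e) ->
    \int[unif]_x g (array_map gaussian_row N x) =
    \int[array_measure dim N]_e (g e * (array_density gaussian_density e)%:E).
Proof.
elim: N => [|N [iN lawN]].
  split.
    exact: (@indep_tail0 R _ (array dim 0) [tuple 0%R | i < dim 0]).
  move=> g mg g0.
  transitivity (\int[unif]_(x in setT) cst (g [tuple 0%R | i < dim 0]) x); first by [].
  rewrite integral_cst// [X in _ * X]unif1 mule1.
  rewrite [RHS](integral_tuple_dim0 (F := fun u => g u * 1%:E) [tuple 0%R | i < dim 0])//.
    by rewrite mule1.
  by apply: emeasurable_funM.
pose d := dim N.+1.
pose sh (e : array dim N) (z : row N.+1) : row N.+1 :=
  [tuple (row_mean (last_row e) m + sigma m * tnth z m)%R | m < d].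
pose G (z : array dim N * row N.+1) : array dim N.+1 := (z.1, sh z.1 z.2).
have mlast : measurable_fun setT (@last_row R dim N) by exact: measurable_array_last.
have mG : measurable_fun setT G.
  apply: measurable_fun_pair => //; apply: measurable_mktuple => m.
  apply: measurable_funD.
    apply: (measurableT_comp (measurable_row_mean m)).
    exact: measurableT_comp mlast (@measurable_fst _ _ _ _).
  apply: measurable_funM => //.
  exact: measurableT_comp (measurable_tnth m) (@measurable_snd _ _ _ _).
have [iZ lawZ] := indep_normals d iN.
have GE x : array_map gaussian_row N.+1 x =
    G (array_map gaussian_row N x, normals (offset N) d x).
  by rewrite /G /sh last_row_map.
split.
  rewrite (_ : array_map gaussian_row N.+1 = G \o (fun x =>
      (array_map gaussian_row N x, normals (offset N) d x))); last by apply/funext => x; exact: GE.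
  exact: indep_tail_comp mG iZ.
move=> g mg g0.
transitivity (\int[unif]_x g (G (array_map gaussian_row N x, normals (offset N) d x))).
  by apply: eq_integral => x _; rewrite -GE.
have mgG : measurable_fun setT (g \o G) by exact: measurableT_comp.
rewrite (lawZ (g \o G))//; last by move=> z; exact: g0.
pose Phi (e : array dim N) := \int[lebesgue_tuple d]_z
  (g (G (e, z)) * (\prod_(m < d) normal_pdf 0 1 (tnth z m))%R%:E).
have mPhi : measurable_fun setT Phi.
  apply: (@measurable_integral_snd R _ _ _ _ _ (fun z : array dim N * row N.+1 =>
    g (G z) * (\prod_(m < d) normal_pdf 0 1 (tnth z.2 m))%R%:E)).
    apply: emeasurable_funM => //; apply/measurable_EFinP.
    exact: measurableT_comp (measurable_prod_normal_pdf _ _) (@measurable_snd _ _ _ _).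
  by move=> z; rewrite mule_ge0// lee_fin prod_normal_pdf_ge0.
have Phi0 e : 0 <= Phi e.
  by apply: integral_ge0 => t _; rewrite mule_ge0// lee_fin prod_normal_pdf_ge0.
rewrite [LHS](lawN Phi)//.
pose D := @array_density R dim gaussian_density.
have D0 e : (0 <= D N e)%R.
  by apply: array_density_ge0 => k u v; exact: gaussian_density_ge0.
have mD k : measurable_fun setT (D k).
  by apply: measurable_array_density => l; exact: measurable_gaussian_density.
have mgD : measurable_fun setT (fun e : array dim N.+1 => g e * (D N.+1 e)%:E).
  by apply: emeasurable_funM => //; apply/measurable_EFinP; exact: mD.
have D0' e : (0 <= D N.+1 e)%R.
  by apply: array_density_ge0 => k u v; exact: gaussian_density_ge0.
transitivity (\int[array_measure dim N \x lebesgue_tuple d]_e (g e * (D N.+1 e)%:E)); last by [].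
rewrite (fubini_tonelli1 _ mgD); last by move=> e; rewrite mule_ge0// lee_fin.
apply: eq_integral => e _; rewrite /fubini_F.
have mge : measurable_fun setT (fun v : row N.+1 => g (e, v)).
  by apply: measurableT_comp mg _; exact: measurable_fun_pair.
transitivity (\int[lebesgue_tuple d]_v (g (e, v) * (gaussian_density (last_row e) v)%:E) * (D N e)%:E).
  suff -> : Phi e = \int[lebesgue_tuple d]_v (g (e, v) * (gaussian_density (last_row e) v)%:E) by [].
  apply/esym.
  exact: (integral_normal_tuple (fun m => row_mean (last_row e) m) (@sigma0 N) mge).
rewrite muleC -ge0_integralZl//.
- by apply: eq_integral => v _; rewrite /D /= EFinM muleCA.
- apply: emeasurable_funM => //; apply/measurable_EFinP.
  exact: measurable_prod_normal_pdf.
- by move=> v _; rewrite mule_ge0// lee_fin gaussian_density_ge0.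
- by rewrite lee_fin.
Qed.

Definition normal_span (n : nat) (f : R -> R) :=
  exists b : nat -> R, forall x, f x = (\sum_(m < n) b m * normal_seq 1 m x)%R.

Lemma normal_span_le n n' f : (n <= n')%N -> normal_span n f -> normal_span n' f.
Proof.
move=> nn' [b fE]; exists (fun m => if (m < n)%N then b m else 0%R) => x.
rewrite fE (big_ord_widen_cond _ xpredT (fun m => b m * normal_seq 1 m x)%R nn') big_mkcond.
by apply: eq_bigr => m _; rewrite andTb; case: ifP => // _; rewrite mul0r.
Qed.

Lemma normal_span_scale n a f : normal_span n f -> normal_span n (fun x => a * f x)%R.
Proof.
move=> [b fE]; exists (fun m => a * b m)%R => x.
by rewrite fE mulr_sumr; apply: eq_bigr => m _; rewrite mulrA.
Qed.

Lemma normal_span_sum n (I : Type) (r : seq I) (f : I -> R -> R) :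
  (forall i, normal_span n (f i)) -> normal_span n (fun x => \sum_(i <- r) f i x)%R.
Proof.
move=> h; elim: r => [|i r [b bE]].
  by exists (fun=> 0%R) => x; rewrite big_nil big1// => m _; rewrite mul0r.
have [b' b'E] := h i; exists (fun m => b' m + b m)%R => x.
rewrite big_cons bE b'E -big_split/=; apply: eq_bigr => m _; by rewrite mulrDl.
Qed.

Lemma normal_span_seq n m : (m < n)%N -> normal_span n (normal_seq 1 m).
Proof.
move=> mn; exists (fun l => (l == m)%:R)%R => x.
rewrite (bigD1 (Ordinal mn))//= eqxx mul1r big1 ?addr0// => l lm.
by rewrite (_ : (l == m :> nat) = false) ?mul0r//; apply: contraNF lm => /eqP e; apply/eqP/val_inj.
Qed.

(** The recursion is linear, so every entry is a combination of finitely many terms of [normal_seq];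
    joint Gaussianity of the array follows from this. *)
Lemma gaussian_row_span k i : normal_span (offset k) (fun x => tnth (gaussian_row k x) i).
Proof.
elim: k i => [|k IH] i; first by exfalso; case: i => m; rewrite dim0.
rewrite (_ : (fun x => _) = (fun x => \sum_(c <- [:: (fun x => row_mean (gaussian_row k x) i);
    (fun x => sigma i * normal_seq 1 (offset k + i) x)]) c x)%R); last first.
  by apply/funext => x; rewrite !big_cons big_nil addr0 /= !tnth_mktuple.
have h1 : normal_span (offset k.+1) (fun x => row_mean (gaussian_row k x) i).
  apply: normal_span_sum => l; apply: normal_span_scale.
  by apply: normal_span_le (IH l); rewrite /= leq_addr.
have h2 : normal_span (offset k.+1) (fun x => sigma i * normal_seq 1 (offset k + i) x)%R.
  by apply: normal_span_scale; apply: normal_span_seq; rewrite /= ltn_add2l.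
have [b1 b1E] := h1; have [b2 b2E] := h2; exists (fun m => b1 m + b2 m)%R => x.
rewrite !big_cons big_nil addr0 b1E b2E -big_split/=; apply: eq_bigr => m _; by rewrite mulrDl.
Qed.

End gaussian_rows.

Section gaussian_array.
Context {R : realType}.
Notation unif := (uniform_prob (@ltr01 R)).
Variable dim : nat -> nat.
Hypothesis dim0 : dim 0 = 0%N.
Variable A : forall k, 'I_(dim k.+1) -> 'I_(dim k) -> R.
Variable sigma : forall k, 'I_(dim k.+1) -> R.

Definition gaussian_entry (ki : {k : nat & 'I_(dim k)}) : measurableTypeR R -> R :=
  fun x => tnth (gaussian_row A sigma (tag ki) x) (tagged ki).

Let measurable_gaussian_entry ki : measurable_fun setT (gaussian_entry ki).
Proof. exact: (measurableT_comp (measurable_tnth (tagged ki)) (@measurable_gaussian_row _ _ _ _ (tag ki))). Qed.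

HB.instance Definition _ ki := isMeasurableFun.Build _ _ _ _ (gaussian_entry ki)
  (measurable_gaussian_entry ki).

Lemma gaussian_array_centered :
  centered_gaussian (fun ki => [the {RV unif >-> R} of gaussian_entry ki]).
Proof.
move=> n s a.
pose N := \max_(k < n) offset dim (tag (s k)).
have [b bE] : normal_span N (fun x => \sum_(k < n) a k * gaussian_entry (s k) x).
  apply: normal_span_sum => k; apply: normal_span_scale.
  apply: (normal_span_le _ (@gaussian_row_span _ _ dim0 A sigma (tag (s k)) (tagged (s k)))).
  exact: (leq_bigmax (F := fun k : 'I_n => offset dim (tag (s k)))).
have [[mX _] [X0|[sg sg0 law]]] := @normal_law_combination R (fun=> 1) b N (fun=> ltr01).
  right; rewrite (_ : _ @^-1` _ = setT) ?probability_setT//.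
  by apply/seteqP; split => // x _ /=; rewrite bE X0.
left; exists sg => // B mB.
have mB' : measurable_fun setT (fun x : R => (\1_B x)%:E : \bar R).
  by apply/measurable_EFinP; exact: measurable_indic.
have B0 (x : R) : (0 <= (\1_B x)%:E :> \bar R)%E by rewrite lee_fin.
pose X x := \sum_(m < N) b m * normal_seq 1 m x.
have XE : (fun w => \sum_(k < n) a k * [the {RV unif >-> R} of gaussian_entry (s k)] w) = X.
  by apply/funext => w; rewrite /X -bE.
have mXB : measurable (X @^-1` B : set (measurableTypeR R)).
  by rewrite -[X in measurable X]setTI; exact: mX.
rewrite XE -[X @^-1` B]setIT -integral_indic//.
transitivity (\int[unif]_x (\1_B (X x))%:E)%E; first by [].
rewrite (law _ mB' B0) /normal_prob [RHS]integral_mkcond; apply: eq_integral => x _.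
by rewrite epatch_indic muleC.
Qed.
End gaussian_array.

(** * Critical equations for the roots of Jacobi polynomials *)

Section beta_moments.
Context {R : realType}.
Local Notation mu := lebesgue_measure.
Implicit Types (a : R) (b : nat) (p q s : {poly R}).

Lemma integral_powR_itv a (e : R) : 0 < a -> 0 < e < 1 ->
  (\int[mu]_(x in `[e, 1%R]) (x `^ (a - 1))%:E = ((1 - e `^ a) / a)%:E)%E.
Proof.
move=> a0 /andP[e0 e1].
have dF (x : R) : 0 < x -> is_derive x 1 (fun y : R => a^-1 * y `^ a) (x `^ (a - 1)).
  move=> x0; have h := is_deriveZ a^-1 (is_derive1_powR a x0).
  apply: (@is_derive_eq _ _ _ _ _ _ _ _ h); rewrite /GRing.scale/=; field; exact: lt0r_neq0.
rewrite (@continuous_FTC2 _ _ (fun y : R => a^-1 * y `^ a)) //.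
- by rewrite powR1 -EFinB; congr EFin; ring.
- apply: derivable_within_continuous => x; rewrite in_itv/= => /andP[ex _].
  by apply: (@ex_derive _ _ _ _ _ _ _ (is_derive1_powR _ _)); exact: lt_le_trans ex.
- have cF (x : R) : 0 < x -> {for x, continuous (fun y : R => a^-1 * y `^ a)}.
    move=> x0; apply: differentiable_continuous; apply/derivable1_diffP.
    exact: (@ex_derive _ _ _ _ _ _ _ (dF _ x0)).
  split.
  + move=> x; rewrite in_itv/= => /andP[ex _].
    by apply: (@ex_derive _ _ _ _ _ _ _ (dF _ _)); exact: lt_trans ex.
  + by apply: cvg_at_right_filter; exact: cF.
  + by apply: cvg_at_left_filter; exact: cF.
- move=> x; rewrite in_itv/= => /andP[ex _].
  rewrite derive1E; apply: (@derive_val _ _ _ _ _ _ _ (dF _ _)).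
  exact: lt_trans ex.
Qed.

(** The integrand is unbounded at 0 when [a < 1], so the fundamental theorem of calculus is applied
    on [[2^-(n+1), 1]] and monotone convergence gives the limit. *)
Lemma integral_powR01 a : 0 < a ->
  (\int[mu]_(x in `]0%R, 1%R[) (x `^ (a - 1))%:E = (a^-1)%:E)%E.
Proof.
move=> a0.
rewrite integral_itv_bndo_bndc; last first.
  by apply/measurable_EFinP; apply: measurable_funTS; exact: measurable_powR.
pose e (n : nat) : R := 2^-1 ^+ n.+1.
have e0 n : 0 < e n by rewrite exprn_gt0.
have e1 n : e n < 1 by rewrite exprn_ilt1// invf_lt1// ltr1n.
have ce : e n @[n --> \oo] --> 0.
  have := @cvg_expr R (2^-1); rewrite ger0_norm// invf_lt1// ltr1n => /(_ isT).
  by rewrite -cvg_shiftS.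
have -> : `]0, 1]%classic = \bigcup_n `[e n, 1]%classic :> set R.
  apply/seteqP; split => [x /=|x [n _] /=]; rewrite in_itv/= => /andP[x0 x1].
    have [n _ hn] := (cvgr_lt _ ce) _ x0.
    by exists n => //=; rewrite in_itv/= x1 andbT ltW// (hn n)//=.
  by rewrite in_itv/= x1 (lt_le_trans (e0 n)).
have h := @ge0_nondecreasing_set_cvg_integral _ _ R
  (fun n => `[e n, 1]%classic : set (measurableTypeR R))
  (fun x : measurableTypeR R => (x `^ (a - 1))%:E) lebesgue_measure.
have {}h : (\int[mu]_(x in `[e i, 1%R]) (x `^ (a - 1))%:E)%E @[i --> \oo] -->
    (\int[mu]_(x in \bigcup_i `[e i, 1%R]%classic) (x `^ (a - 1))%:E)%E.
  apply: h => //.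
  - move=> m n mn; apply/subsetPset => x /=; rewrite !in_itv/= => /andP[hx ->].
    rewrite andbT (le_trans _ hx)//.
    by rewrite /e ler_wiXn2l// ?invr_ge0// invf_le1// ler1n.
  - by move=> n; apply/measurable_EFinP; apply: measurable_funTS; exact: measurable_powR.
  - by move=> n x _; rewrite lee_fin powR_ge0.
apply: (cvg_unique _ (@h)) => //.
rewrite (_ : (fun _ => _) = fun n => ((1 - e n `^ a) / a)%:E); last first.
  by apply/funext => n; rewrite -integral_powR_itv ?e0 ?e1.
apply: cvg_EFin; first exact: nearW.
suff : (1 - e n `^ a) / a @[n --> \oo] --> (1 - 0) / a by rewrite subr0 mul1r.
apply: cvgMl; apply: cvgB; first exact: cvg_cst.
have h2 : `|2^-1 `^ a| < 1 :> R.
  rewrite ger0_norm ?powR_ge0//; suff : 2^-1 `^ a < 1 `^ a :> R by rewrite powR1.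
  by rewrite gt0_ltr_powR// ?nnegrE// invf_lt1// ltr1n.
have := @cvg_expr R _ h2; rewrite -cvg_shiftS; apply: cvg_trans.
apply: near_eq_cvg; near=> n.
rewrite /= -(powR_mulrn n.+1 (powR_ge0 2^-1 a)) powRAC (powR_mulrn n.+1)//.
Unshelve. all: by end_near. Qed.

Lemma horner_bound01 p (x : R) : 0 <= x <= 1 -> `|p.[x]| <= \sum_(i < size p) `|p`_i|.
Proof.
move=> /andP[x0 x1]; rewrite horner_coef (le_trans (ler_norm_sum _ _ _))//.
apply: ler_sum => i _; rewrite normrM ler_piMr//.
by rewrite ger0_norm ?exprn_ge0// exprn_ile1.
Qed.

(** The exponent of [1 - x] is a natural number, as it is in the Jacobi weights [|M - N|]; this
    allows induction on it. *)
Definition beta_weight a b (x : R) : R := x `^ (a - 1) * (1 - x) ^+ b.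

Lemma measurable_beta_weight a b : measurable_fun setT (beta_weight a b).
Proof.
apply: measurable_funM; first exact: measurable_powR.
by apply: measurable_funX; exact: measurable_funB.
Qed.

Lemma measurable_horner p : measurable_fun setT (horner p).
Proof.
rewrite (_ : horner p = fun x => \sum_(i < size p) p`_i * x ^+ i); last first.
  by apply/funext => x; rewrite horner_coef.
by apply: measurable_sum => i; apply: measurable_funM => //; exact: measurable_funX.
Qed.

Lemma integrable_beta_weight a b p : 0 < a ->
  mu.-integrable `]0, 1[ (EFin \o (fun x => p.[x] * beta_weight a b x)).
Proof.
move=> a0; pose C := \sum_(i < size p) `|p`_i|.
have C0 : 0 <= C by apply: sumr_ge0.
apply: (@le_integrable _ _ _ _ _ _ _ (fun x : measurableTypeR R => C%:E * (x `^ (a - 1))%:E)%E) => //.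
- apply/measurable_EFinP; apply: measurable_funTS; apply: measurable_funM.
    exact: measurable_horner.
  exact: measurable_beta_weight.
- move=> x /=; rewrite in_itv/= => /andP[x0 x1].
  rewrite lee_fin !normrM ler_pM//.
    by rewrite (ger0_norm C0) horner_bound01// !ltW.
  rewrite ler_piMr// ger0_norm; last by rewrite exprn_ge0// subr_ge0 ltW.
  by rewrite exprn_ile1// ?subr_ge0 ?(ltW x1)// lerBlDr lerDl ltW.
apply: integrableZl => //; apply/integrableP; split.
  by apply/measurable_EFinP; apply: measurable_funTS; exact: measurable_powR.
under eq_integral do rewrite gee0_abs ?lee_fin ?powR_ge0//.
by rewrite integral_powR01// ltry.
Qed.

Definition beta_moment a b p : R :=
  \int[mu]_(x in `]0, 1[) (p.[x] * beta_weight a b x).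

Lemma beta_moment_linear a b c p q : 0 < a ->
  beta_moment a b (c *: p + q) = c * beta_moment a b p + beta_moment a b q.
Proof.
move=> a0; rewrite /beta_moment -RintegralZl//; last exact: integrable_beta_weight.
rewrite -RintegralD//; last 2 first.
- rewrite (_ : _ \o _ = EFin \o (fun x => (c *: p).[x] * beta_weight a b x)).
    exact: integrable_beta_weight.
  by apply/funext => x /=; rewrite hornerZ mulrA.
- exact: integrable_beta_weight.
by apply: eq_Rintegral => x _; rewrite hornerD hornerZ; ring.
Qed.

Lemma beta_momentD a b p q : 0 < a ->
  beta_moment a b (p + q) = beta_moment a b p + beta_moment a b q.
Proof. by move=> a0; rewrite -[p]scale1r beta_moment_linear// mul1r scale1r. Qed.

Lemma beta_moment0 a b : 0 < a -> beta_moment a b 0 = 0.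
Proof.
by move=> a0; have := @beta_momentD a b 0 0 a0; rewrite addr0; lra.
Qed.

Lemma beta_momentZ a b c p : 0 < a -> beta_moment a b (c *: p) = c * beta_moment a b p.
Proof. by move=> a0; rewrite -[c *: p]addr0 beta_moment_linear// beta_moment0// addr0. Qed.

Lemma beta_moment_1subX a b p :
  beta_moment a b ((1 - 'X) * p) = beta_moment a b.+1 p.
Proof.
apply: eq_Rintegral => x _.
rewrite /beta_weight hornerM hornerD hornerN hornerX -polyC1 hornerC exprS.
by rewrite [X in X * _]mulrC -mulrA; congr (_ * _); rewrite mulrCA.
Qed.

Lemma beta_moment_X a b p :
  beta_moment a b ('X * p) = beta_moment (a + 1) b p.
Proof.
apply: eq_Rintegral => x; rewrite inE/= in_itv/= => /andP[x0 _].
rewrite /beta_weight hornerM hornerX (_ : a + 1 - 1 = a - 1 + 1); last by ring.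
rewrite [in RHS]powRD ?(gt_eqF x0) ?implybT// powRr1 ?ltW//.
by rewrite mulrACA [in RHS]mulrCA [x * _]mulrC.
Qed.

Lemma beta_moment_Xn a b k p :
  beta_moment a b ('X^k * p) = beta_moment (a + k%:R) b p.
Proof.
elim: k a => [|k IH] a; first by rewrite expr0 mul1r addr0.
by rewrite exprS -mulrA beta_moment_X IH -addrA nat1r.
Qed.

(** The Beta function identity [a B(a, b+2) = (b+1) B(a+1, b+1)]. Induction on [b], splitting off
    one factor [1 - x], reduces it to the integral of a single power. *)
Lemma beta_moment_recl a b : 0 < a ->
  a * beta_moment a b.+1 1 = b.+1%:R * beta_moment (a + 1) b 1.
Proof.
move=> a0; elim: b a a0 => [|b IH] a a0.
  have m0 (c : R) : 0 < c -> beta_moment c 0 1 = c^-1.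
    move=> c0; rewrite /beta_moment /Rintegral.
    under eq_integral do rewrite /beta_weight -polyC1 hornerC expr0 mul1r mulr1.
    by rewrite integral_powR01.
  rewrite -beta_moment_1subX mulr1 beta_momentD// -scaleN1r beta_momentZ//.
  rewrite -['X]mulr1 beta_moment_X !m0 ?addr_gt0//; field.
  by rewrite !lt0r_neq0 ?addr_gt0.
have S (c : R) n : 0 < c ->
    beta_moment c n.+1 1 = beta_moment c n 1 - beta_moment (c + 1) n 1.
  move=> c0; rewrite -beta_moment_1subX mulr1 beta_momentD// -scaleN1r beta_momentZ//.
  by rewrite -['X]mulr1 beta_moment_X mulN1r.
have a1 : 0 < a + 1 by rewrite addr_gt0.
have h1 := IH _ a0; have h2 := IH _ a1.
rewrite [in LHS]S// mulrBr h1 [in RHS]S// -[b.+2]addn1 natrD.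
have h3 := S _ b a1; have h4 := S _ b a0.
move: h1 h2 h3 h4.
set u := beta_moment a b.+1 1; set v := beta_moment (a + 1) b.+1 1.
set w := beta_moment (a + 1) b 1; set t := beta_moment (a + 1 + 1) b 1.
set z := beta_moment a b 1 => h1 h2 h3 h4.
by move: h2 h3; nra.
Qed.

(* The total derivative of [s x^a (1-x)^(b+1)] integrates to zero on (0,1). *)
Lemma beta_moment_derivative a b s : 0 < a ->
  beta_moment a b (a *: ((1 - 'X) * s) - b.+1%:R *: ('X * s) + 'X * (1 - 'X) * s^`()) = 0.
Proof.
move=> a0.
pose L s := a *: ((1 - 'X) * s) - b.+1%:R *: ('X * s) + 'X * (1 - 'X) * s^`().
rewrite -/(L s).
have LD c p q : L (c *: p + q) = c *: L p + L q.
  by rewrite /L derivD derivZ !mulrDr -!scalerAr !scalerDr !scalerA -!mul_polyC !rmorphM/=; ring.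
(* By linearity powers of ['X] suffice; for them the claim is [beta_moment_recl] at [a + k]. *)
have LX k : beta_moment a b (L 'X^k) = 0.
  rewrite /L (_ : _ + _ = (a + k%:R) *: ('X^k * (1 - 'X)) - b.+1%:R *: ('X^k * 'X)).
    rewrite beta_momentD// -scaleNr !beta_momentZ// !beta_moment_Xn -['X]mulr1.
    rewrite beta_moment_X mulr1 -[1 - 'X]mulr1 beta_moment_1subX.
    rewrite beta_moment_recl; first by ring.
    by rewrite ltr_wpDr.
  rewrite derivXn; case: k => [|k]; first by rewrite mulr0n !mulr0 !addr0 !mulr1 !mul1r.
  rewrite -!mul_polyC /= -[_ *+ _]mulr_natr exprS polyCD polyCMn. ring.
rewrite -[s]coefK poly_def.
elim/big_rec: _ => [|i p _ IH]; last first.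
  by rewrite LD beta_moment_linear// LX mulr0 add0r.
by rewrite /L deriv0 !mulr0 !scaler0 subr0 addr0 beta_moment0.
Qed.

Definition beta_orth a b n p :=
  forall q, (size q <= n)%N -> beta_moment a b (p * q) = 0.

Lemma size_le_coef n (q : {poly R}) : (size q <= n.+1)%N -> q`_n = 0 -> (size q <= n)%N.
Proof.
move=> sq qn; apply/leq_sizeP => i; rewrite leq_eqVlt => /predU1P[<-//|ni].
by rewrite nth_default// (leq_trans sq).
Qed.

(** The new polynomial is [- x^(1-a-n) (1-x)^(-b)] times the derivative of [x^(a+n) (1-x)^(b+1) q].
    Integration by parts against [r] moves the derivative onto [r] and leaves [q] paired with a
    polynomial of size at most [n]. *)
Lemma beta_orth_up a b n q : 0 < a -> beta_orth a b.+1 n q ->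
  beta_orth a b n.+1
    ((a + n%:R) *: (('X - 1) * q) + b.+1%:R *: ('X * q) + 'X * ('X - 1) * q^`()).
Proof.
move=> a0 oq r sr.
have := beta_moment_derivative b (q * r) a0.
(* [n r - x r'] has no term of degree [n], which brings it within the range of the orthogonality of
   [q]. *)
pose t := n%:R *: r - 'X * r^`().
have st : (size t <= n)%N.
  apply: size_le_coef.
    rewrite (leq_trans (size_polyD _ _))// geq_max size_polyN.
    rewrite (leq_trans (size_scale_leq _ _))//=.
    have [->|r0] := eqVneq r 0; first by rewrite deriv0 mulr0 size_poly0.
    by rewrite mulrC (leq_trans (size_polyMleq _ _))// size_polyX addn2/= (leq_trans (leq_ltn_trans (size_poly _ _) _) sr)// prednK// lt0n size_poly_eq0.
  rewrite coefB coefZ coefXM; case: n {oq sr t} => [|n]; first by rewrite mul0r subrr.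
  by rewrite coef_deriv mulr_natl subrr.
have := oq _ st; rewrite -beta_moment_1subX => h1 h2.
have -> : ((a + n%:R) *: (('X - 1) * q) + b.+1%:R *: ('X * q) + 'X * ('X - 1) * q^`()) * r =
  (-1) *: (a *: ((1 - 'X) * (q * r)) - b.+1%:R *: ('X * (q * r))
       + 'X * (1 - 'X) * (q * r)^`()) + (-1) *: ((1 - 'X) * (q * t)).
  by rewrite /t derivM -!mul_polyC polyCD; ring.
by rewrite beta_momentD// !beta_momentZ// h1 h2 !mulr0 addr0.
Qed.

(** With [s = a + n + b], the new polynomial is [x^(1-s)] times the derivative of [x^s q]. The extra
    factor [1 - x] of the new weight makes integration by parts possible at 1. *)
Lemma beta_orth_stay a b n q : 0 < a -> (0 < n)%N -> beta_orth a b n q ->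
  beta_orth a b.+1 n ((a + n%:R + b%:R) *: q + 'X * q^`()).
Proof.
move=> a0 n0 oq r sr.
rewrite -beta_moment_1subX.
have := beta_moment_derivative b (q * r) a0.
(* What remains beside the total derivative of [q * r]; its terms of degree [n] cancel, so [q] is
   orthogonal to it. *)
pose t := (n + b)%:R *: r - n.-1%:R *: ('X * r) + 'X * ('X - 1) * r^`().
have st : (size t <= n)%N.
  have sX (u : {poly R}) m : (size u <= m)%N -> (size ('X * u)%R <= m.+1)%N.
    have [->|u0] := eqVneq u 0; first by rewrite mulr0 size_poly0.
    by rewrite mulrC size_mulX.
  have sd : (size r^`() <= n.-1)%N.
    by rewrite (leq_trans (size_poly _ _))//; case: (size r) sr => //= m; case: n {n0 oq t}.
  apply: size_le_coef.
    rewrite (leq_trans (size_polyD _ _))// geq_max; apply/andP; split.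
      rewrite (leq_trans (size_polyD _ _))// geq_max size_polyN.
      rewrite (leq_trans (size_scale_leq _ _)) ?(leqW sr)//=.
      by rewrite (leq_trans (size_scale_leq _ _))// sX.
    rewrite -mulrA sX// mulrBl mul1r (leq_trans (size_polyD _ _))// geq_max size_polyN.
    by rewrite -[in X in _ && X](prednK n0) (leqW sd) andbT -(prednK n0) sX.
  rewrite coefD coefB !coefZ coefXM -mulrA coefXM (gtn_eqF n0).
  rewrite mulrBl mul1r coefB coefXM !coef_deriv.
  have -> : r`_n = 0 by apply: nth_default.
  case: n n0 {oq t sd} sr => [//|[|n]] _ sr /=.
    by rewrite (_ : r`_1 = 0) ?mul0rn; [ring|apply: nth_default].
  by rewrite (_ : r`_n.+2 = 0) ?mul0rn; [rewrite -mulr_natl; ring|apply: nth_default].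
have := oq _ st => h1 h2.
have -> : (1 - 'X) * (((a + n%:R + b%:R) *: q + 'X * q^`()) * r) =
  (a *: ((1 - 'X) * (q * r)) - b.+1%:R *: ('X * (q * r))
       + 'X * (1 - 'X) * (q * r)^`()) + q * t.
  rewrite /t derivM -!mul_polyC !polyCD (_ : b.+1%:R = b%:R + 1); last by rewrite natr1.
  rewrite (_ : n.-1%:R = n%:R - 1); last by rewrite -subn1 natrB.
  by rewrite natrD !polyCD polyCN; ring.
by rewrite beta_momentD// h1 h2 addr0.
Qed.

(** Subtracting the multiple of [q] with the same leading term leaves a polynomial [h] of lower
    degree that is orthogonal to itself, hence zero since the weight is positive. *)
Lemma beta_orth_unique a b n p q : 0 < a ->
  beta_orth a b n p -> beta_orth a b n q -> size p = n.+1 -> size q = n.+1 ->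
  exists2 c, c != 0 & p = c *: q.
Proof.
move=> a0 op oq sp sq.
have lp : lead_coef p != 0 by rewrite lead_coef_eq0 -size_poly_eq0 sp.
have lq : lead_coef q != 0 by rewrite lead_coef_eq0 -size_poly_eq0 sq.
exists (lead_coef p / lead_coef q); first by rewrite mulf_neq0// invr_eq0.
apply/eqP; rewrite -subr_eq0; set h := p - _.
have sh : (size h <= n)%N.
  apply: size_le_coef.
    rewrite (leq_trans (size_polyD _ _))// geq_max size_polyN sp leqnn/=.
    by rewrite (leq_trans (size_scale_leq _ _))// sq.
  rewrite coefB coefZ.
  have -> : q`_n = lead_coef q by rewrite lead_coefE sq.
  by rewrite -mulrA mulVf// mulr1 lead_coefE sp subrr.
have : beta_moment a b (h * h) = 0.
  rewrite {1}/h mulrBl -scalerAl beta_momentD// -scaleNr beta_momentZ//.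
  by rewrite op// oq// mulr0 addr0.
move=> hh; apply: contraT => h0.
have : (\int[mu]_(x in `]0%R, 1%R[) `|((h * h).[x] * beta_weight a b x)%:E| = 0)%E.
  under eq_integral => x.
    rewrite inE/= in_itv/= => /andP[x0 x1].
    rewrite /= ger0_norm; last first.
      rewrite /beta_weight mulr_ge0//.
        by rewrite hornerM -expr2 sqr_ge0.
      by rewrite mulr_ge0 ?powR_ge0// exprn_ge0// subr_ge0 ltW.
    over.
  move: hh; rewrite /beta_moment /Rintegral => hh.
  rewrite -[LHS]fineK ?hh//.
  by apply: integrable_fin_num => //; exact: integrable_beta_weight.
have mI : measurable (`]0, 1[%classic : set R) by [].
move=> /(ae_eq_integral_abs mu mI) [|N [mN N0 hN]].
  apply/measurable_EFinP; apply: measurable_funTS; apply: measurable_funM.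
    exact: measurable_horner.
  exact: measurable_beta_weight.
(* The points [1 / (i + 2)] are more numerous than the roots [h] can have. *)
have [x0 x01 hx0] : exists2 x, 0 < x < 1 & h.[x] != 0.
  apply/not_exists2P => hn.
  pose rs : seq R := mkseq (fun i => i.+2%:R^-1) (size h).
  have : (size rs < size h)%N.
    apply: max_poly_roots => //.
      apply/allP => _ /mapP[i _ ->]; have [hi|/negP] := hn i.+2%:R^-1.
        by case: hi; rewrite invr_gt0 ltr0n invf_lt1// ltr1n.
      by rewrite negbK.
    by apply: mkseq_uniq => i j /invr_inj /eqP; rewrite eqr_nat => /eqP[].
  by rewrite size_mkseq ltnn.
(* By continuity [h] is nonzero on a ball around [x0], which has positive measure and would lie in
   the null set [N]. *)
have : \forall x \near x0, (x \in `]0%R, 1%R[) /\ (h.[x] != 0).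
  apply: filterI; first by apply: near_in_itvoo; rewrite in_itv/=.
  exact: (cvgr_neq0 _ (@continuous_horner _ h x0)).
move=> /nbhs_ballP[e /= e0 he].
have : (mu (ball x0 e) <= mu N)%E.
  apply: le_measure; rewrite ?inE//; first exact: measurable_ball.
  move=> x /he [x01' hx]; apply: hN => /= /(_ x01').
  move: x01'; rewrite in_itv/= => /andP[xgt0 xlt1] [] /eqP; apply/negP.
  rewrite hornerM !mulf_neq0// ?gt_eqF ?powR_gt0// exprn_gt0// subr_gt0//.
move=> hle; have : (mu (ball x0 e) <= 0)%E.
  by apply: (le_trans hle); rewrite le_eqVlt; apply/orP; left; apply/eqP; exact: N0.
move=> h2; have : ((e *+ 2)%:E <= 0 :> \bar R)%E.
  by rewrite -(lebesgue_measure_ball x0 (ltW e0)).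
by rewrite lee_fin leNgt mulrn_wgt0.
Qed.
End beta_moments.

Section weighted_derivative.
Context {R : realType}.
Implicit Types (c z : nat -> R).

Definition node_poly n z : {poly R} := \prod_(i < n) ('X - (z i)%:P).

(* [node_poly n z * \sum_(i < n) c i / ('X - z i)] *)
Definition weighted_deriv n c z : {poly R} :=
  \sum_(i < n) c i *: \prod_(l < n | l != i) ('X - (z l)%:P).

Lemma node_poly_recl n z : node_poly n.+1 z = ('X - (z 0)%:P) * node_poly n (z \o S).
Proof. by rewrite /node_poly big_ord_recl. Qed.

Lemma node_poly_recr n z : node_poly n.+1 z = node_poly n z * ('X - (z n)%:P).
Proof. by rewrite /node_poly big_ord_recr. Qed.

Lemma weighted_deriv_recl n c z :
  weighted_deriv n.+1 c z =
  c 0%N *: node_poly n (z \o S) + ('X - (z 0)%:P) * weighted_deriv n (c \o S) (z \o S).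
Proof.
rewrite /weighted_deriv big_ord_recl; congr (_ *: _ + _).
  by rewrite big_mkcond big_ord_recl/= mul1r.
rewrite mulr_sumr; apply: eq_bigr => i _.
rewrite -scalerAr; congr (_ *: _).
rewrite big_mkcond big_ord_recl/=; congr (_ * _).
by rewrite [RHS]big_mkcond; apply: eq_bigr => l _; rewrite (inj_eq lift_inj).
Qed.

Lemma weighted_deriv_recr n c z :
  weighted_deriv n.+1 c z =
  c n *: node_poly n z + ('X - (z n)%:P) * weighted_deriv n c z.
Proof.
rewrite /weighted_deriv big_ord_recr/= [LHS]addrC; congr (_ *: _ + _).
  rewrite big_mkcond big_ord_recr/= eqxx mulr1; apply: eq_bigr => i _.
  by rewrite -(inj_eq val_inj)/= ltn_eqF.
rewrite mulr_sumr; apply: eq_bigr => i _.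
rewrite -scalerAr; congr (_ *: _).
rewrite big_mkcond big_ord_recr/= -(inj_eq val_inj)/= gtn_eqF// mulrC; congr (_ * _).
by rewrite [RHS]big_mkcond; apply: eq_bigr => l _.
Qed.

Lemma deriv_node_poly n z : (node_poly n z)^`() = weighted_deriv n (fun=> 1) z.
Proof.
elim: n => [|n IH]; first by rewrite /node_poly /weighted_deriv !big_ord0 derivC.
by rewrite node_poly_recr derivM derivXsubC mulr1 IH weighted_deriv_recr scale1r addrC mulrC.
Qed.

Lemma size_node_poly n z : size (node_poly n z) = n.+1.
Proof. by rewrite /node_poly -(big_mkord xpredT (fun i => 'X - (z i)%:P)) size_prod_XsubC size_iota subn0. Qed.

Lemma size_weighted_deriv n c z : (size (weighted_deriv n c z) <= n)%N.
Proof.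
elim: n => [|n IH]; first by rewrite /weighted_deriv big_ord0 size_poly0.
rewrite weighted_deriv_recr (leq_trans (size_polyD _ _))// geq_max.
rewrite (leq_trans (size_scale_leq _ _)) ?size_node_poly//=.
by rewrite (leq_trans (size_polyMleq _ _))// size_XsubC.
Qed.

Lemma horner_node_poly n z x : (node_poly n z).[x] = \prod_(i < n) (x - z i).
Proof. by rewrite horner_prod; apply: eq_bigr => i _; rewrite !hornerE. Qed.

Lemma horner_weighted_deriv n c z x : (forall i : 'I_n, x != z i) ->
  (weighted_deriv n c z).[x] = (node_poly n z).[x] * \sum_(i < n) c i / (x - z i).
Proof.
move=> xz; rewrite horner_sum mulr_sumr; apply: eq_bigr => i _.
rewrite hornerZ horner_prod horner_node_poly [in RHS](bigD1 i)//=.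
rewrite (eq_bigr (fun l : 'I_n => x - z l)) => [|l _]; last by rewrite !hornerE.
by move: (xz i) (\prod_(_ < n | _) _); rewrite -subr_eq0 => d A; field.
Qed.

Lemma horner_weighted_deriv_node n c z (m : 'I_n) :
  (weighted_deriv n c z).[z m] = c m * \prod_(l < n | l != m) (z m - z l).
Proof.
rewrite horner_sum (bigD1 m)//= [X in _ + X]big1 ?addr0 => [|i im].
  rewrite hornerZ horner_prod; congr (_ * _).
  by apply: eq_bigr => l _; rewrite !hornerE.
by rewrite hornerZ horner_prod (bigD1 m) 1?eq_sym//= hornerXsubC subrr mul0r mulr0.
Qed.

(** At a node only one summand survives. Between consecutive nodes the product of differences
    changes sign while the charges stay positive, and the intermediate value theorem applies. *)
Lemma weighted_deriv_root n c z (m : nat) : (m.+1 < n)%N ->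
  (forall i k, (i < k)%N -> (k < n)%N -> z i < z k) ->
  (forall i, (i < n)%N -> 0 < c i) ->
  exists2 x, z m < x < z m.+1 & root (weighted_deriv n c z) x.
Proof.
move=> mn zlt c0; set p := weighted_deriv n c z.
have mn' := ltn_trans (ltnSn m) mn.
pose a : 'I_n := Ordinal mn'; pose b : 'I_n := Ordinal mn.
have ab : a != b by rewrite -(inj_eq val_inj)/= ltn_eqF.
(* The two mutual differences multiply to minus a square; every other node lies on the same side of
   both points and contributes a positive product. *)
have pab : p.[z m] * p.[z m.+1] < 0.
  rewrite (horner_weighted_deriv_node _ _ a) (horner_weighted_deriv_node _ _ b).
  rewrite mulrACA pmulr_rlt0; last by rewrite mulr_gt0 ?c0.
  rewrite (bigD1 b) 1?eq_sym//= [X in _ * X](bigD1 a)//=.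
  rewrite mulrACA pmulr_llt0.
    by rewrite -(opprB (z m)) mulrN oppr_lt0 -expr2 exprn_even_gt0//= subr_eq0 lt_eqF// zlt.
  rewrite [X in _ * X](eq_bigl (fun l : 'I_n => (l != a) && (l != b))); last first.
    by move=> l; rewrite andbC.
  rewrite -big_split/=; apply: prodr_gt0 => l /andP[la lb].
  have [lm|ml] := ltnP l m.
    by rewrite mulr_gt0// subr_gt0 zlt// (ltn_trans lm).
  have {}ml : (m.+1 < l)%N.
    rewrite ltn_neqAle; apply/andP; split.
      by apply: contra lb => /eqP e; apply/eqP/val_inj.
    rewrite ltn_neqAle ml andbT.
    by apply: contra la => /eqP e; apply/eqP/val_inj.
  by rewrite nmulr_rgt0 subr_lt0 zlt// (ltn_trans (ltnSn m)).
have zm : z m < z m.+1 by exact: zlt.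
have pm0 : p.[z m] != 0 by apply: contraTneq pab => ->; rewrite mul0r ltxx.
have pm1 : p.[z m.+1] != 0 by apply: contraTneq pab => ->; rewrite mulr0 ltxx.
have [x] : exists2 x, z m <= x <= z m.+1 & root p x.
  have [p0|p0] := ltP p.[z m] 0.
    apply: poly_ivt; first exact: ltW.
    by rewrite (ltW p0)/= ltW// -(nmulr_rlt0 _ p0).
  have {}p0 : 0 < p.[z m] by rewrite lt_neqAle eq_sym pm0.
  have [||x xz] := @poly_ivt _ (- p) (z m) (z m.+1); first exact: ltW.
    by rewrite !hornerN oppr_le0 (ltW p0)/= oppr_ge0 ltW// -(pmulr_rlt0 _ p0).
  by rewrite rootN => ?; exists x.
move=> /andP[xa xb] rx; exists x => //.
rewrite !lt_neqAle xa xb !andbT; apply/andP; split.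
  by apply: contraNneq pm0 => ->.
by apply: contraNneq pm1 => <-.
Qed.
End weighted_derivative.

Section critical_points.
Context {R : realType}.

(* The points at which the logarithmic potential of row [k.+1] given row [k] is
   singular: 0, the entries of row [k], and, by default, 1. *)
Definition node (z : seq R) (i : nat) : R := nth 1 (0 :: z) i.

(* In the density of row [k.+1] given row [k], the distance to the [i]-th node
   has exponent [theta * node_charge alpha M k i - 1]. *)
Definition node_charge (alpha : R) (M k i : nat) : R :=
  if i == 0%N then alpha + k%:R else if i == k.+1 then M%:R - k%:R else 1.

Lemma node_charge_gt0 alpha M k i : 0 < alpha -> (i < (minn k.+1 M).+1)%N ->
  0 < node_charge alpha M k i.
Proof.
move=> a0; rewrite /node_charge; case: eqVneq => [_ _|i0]; first by rewrite ltr_wpDr.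
case: eqVneq => // -> ; rewrite ltnS leq_min leqnn/= => kM.
by rewrite subr_gt0 ltr_nat.
Qed.

Lemma orthogonal_poly_moment (alpha : R) M N b n (p : {poly R}) :
  `|M%:R - N%:R| = b%:R :> R ->
  orthogonal_poly (jacobi_weight alpha M N) n p -> beta_orth alpha b n p.
Proof.
move=> hb [_ op] q sq; rewrite -[RHS](op _ sq); apply: eq_Rintegral => x.
rewrite inE/= in_itv/= => /andP[x0 x1].
rewrite hornerM /jacobi_weight hb powR_mulrn// subr_ge0; exact: ltW.
Qed.

Lemma enumerates_roots_prod (p : {poly R}) n (s : n.-tuple R) (z : nat -> R) :
  size p = n.+1 -> enumerates_roots01 p s -> (forall i : 'I_n, z i = tnth s i) ->
  exists2 c, c != 0 & p = c *: node_poly n z.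
Proof.
move=> sp [sinc sroot] zs; exists (lead_coef p).
  by rewrite lead_coef_eq0 -size_poly_eq0 sp.
rewrite {1}(@all_roots_prod_XsubC _ p s) ?size_tuple//.
- congr (_ *: _); rewrite big_tuple; apply: eq_bigr => i _; by rewrite zs.
- by apply/all_tnthP => i; have [/(_ _)[]] := sroot (tnth s i); first by exists i.
- rewrite uniq_rootsE; apply/tuple_uniqP => i j sij; apply: contrapT => /eqP.
  rewrite -(inj_eq val_inj) neq_ltn => /orP[] /sinc; by rewrite sij ltxx.
Qed.

Variables (M : nat) (alpha : R) (J : nat -> {poly R}).
Variable j : forall N, (minn N M).-tuple R.
Hypotheses (M0 : (1 <= M)%N) (alpha0 : 0 < alpha).
Hypothesis hJ : forall N, (1 <= N)%N ->
  orthogonal_poly (jacobi_weight alpha M N) (minn N M) (J N).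
Hypothesis hj : forall N, (1 <= N)%N -> enumerates_roots01 (J N) (j N).

(* [Q k] is proportional to [J k], and [p k] will be proportional to [J k.+1]. *)
Let Q k := node_poly (minn k M) (nth 1 (j k)).

Let distE N : `|M%:R - N%:R| = ((M - N) + (N - M))%:R :> R.
Proof.
have [NM|MN] := leqP N M.
  by rewrite (eqP NM) addn0 natrB// ger0_norm// subr_ge0 ler_nat.
rewrite (eqP (ltnW MN)) add0n natrB ?(ltnW MN)// distrC ger0_norm//.
by rewrite subr_ge0 ler_nat ltnW.
Qed.

Let Q_orth k : beta_orth alpha ((M - k) + (k - M)) (minn k M) (Q k).
Proof.
(* Row 0 corresponds to the constant polynomial 1, for which the orthogonality condition is
   empty. *)
case: k => [|k].
  by move=> q; rewrite min0n leqn0 size_poly_eq0 => /eqP ->; rewrite mulr0 beta_moment0.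
have [||c c0 JE] := @enumerates_roots_prod (J k.+1) _ (j k.+1) (nth 1 (j k.+1)) _ (hj (ltn0Sn k)).
- by case: (hJ (ltn0Sn k)).
- by move=> i; rewrite (tnth_nth 1).
move=> q sq; have := orthogonal_poly_moment (distE k.+1) (hJ (ltn0Sn k)) sq.
rewrite JE -scalerAl beta_momentZ// => /eqP; rewrite mulf_eq0 (negbTE c0).
by move=> /eqP.
Qed.

Let p k := weighted_deriv (minn k.+1 M).+1 (node_charge alpha M k) (node (j k)).

(** Below [M] the point 1 is a node of charge [M - k]: the degree rises while the exponent of
    [1 - x] drops, which is [beta_orth_up]. From [M] on, the degree stays [M] and the exponent
    rises, which is [beta_orth_stay]; the charge [alpha + k] at 0 is then its constant
    [a + n + b]. *)
Let p_orth k : beta_orth alpha ((M - k.+1) + (k.+1 - M)) (minn k.+1 M) (p k).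
Proof.
have := @Q_orth k; rewrite /p /Q.
move: (size_tuple (j k)); move: (tval (j k)) => s ss.
have [kM|Mk] := ltnP k M.
  rewrite (minn_idPl kM).
  rewrite (eqP (ltnW kM)) addn0 (eqP kM) addn0 subnS.
  set b := (M - k).-1; have bE : (M - k = b.+1)%N by rewrite prednK// subn_gt0.
  rewrite bE => /(beta_orth_up alpha0) h.
  rewrite weighted_deriv_recr node_poly_recl weighted_deriv_recl.
  have -> : node s k.+1 = 1.
    by rewrite /node /= nth_default// ss geq_minl.
  have -> : node_charge alpha M k k.+1 = b.+1%:R.
    by rewrite /node_charge eqxx -bE natrB// ltnW.
  have -> : weighted_deriv k (node_charge alpha M k \o S) (node s \o S) =
      (node_poly k (nth 1 s))^`().
    rewrite deriv_node_poly; apply: eq_bigr => i _; congr (_ *: _).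
    by rewrite /node_charge /= eqSS ltn_eqF.
  move: h; congr (beta_orth _ _ _ _).
  rewrite /node /= subr0 -!mul_polyC polyC1 /node_charge/=; ring.
rewrite (minn_idPr (leqW Mk)).
rewrite (eqP Mk) add0n (eqP (leqW Mk)) add0n (subSn Mk).
move=> /(beta_orth_stay alpha0 M0) h.
rewrite weighted_deriv_recl.
have -> : weighted_deriv M (node_charge alpha M k \o S) (node s \o S) =
      (node_poly M (nth 1 s))^`().
  rewrite deriv_node_poly; apply: eq_bigr => i _; congr (_ *: _).
  by rewrite /node_charge /= eqSS ltn_eqF// (leq_trans (ltn_ord i)).
move: h; congr (beta_orth _ _ _ _).
rewrite /node /= subr0 -!mul_polyC /node_charge/=.
by rewrite -addrA -natrD subnKC.
Qed.

Let row_lt k a b : (a < b)%N -> (b < minn k M)%N -> nth 1 (j k) a < nth 1 (j k) b.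
Proof.
case: k => [|k] ab bn; first by move: bn; rewrite leq_min ltn0.
have [inc _] := hj (ltn0Sn k).
have := inc (Ordinal (ltn_trans ab bn)) (Ordinal bn) ab.
by rewrite !(tnth_nth 1).
Qed.

Let row01 k a : (a < minn k M)%N -> 0 < nth 1 (j k) a < 1.
Proof.
case: k => [|k] an; first by move: an; rewrite leq_min ltn0.
have [_ rt] := hj (ltn0Sn k).
have [/(_ _)[|_]] := rt (tnth (j k.+1) (Ordinal an)); first by exists (Ordinal an).
by rewrite (tnth_nth 1).
Qed.

Lemma node_row_lt k i l : (i < l)%N -> (l < (minn k.+1 M).+1)%N ->
  node (j k) i < node (j k) l.
Proof.
case: l => // l il ld; rewrite /node /=.
have [ln|nl] := ltnP l (minn k M).
  case: i il => [|i] il /=; first by case/andP: (row01 ln).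
  exact: row_lt.
rewrite [X in _ < X]nth_default ?size_tuple//.
case: i il => [|i] il //=; apply: (andP (row01 _)).2.
lia.
Qed.

(** Each of the [d] gaps between consecutive nodes contains a root of [p k], whose degree is at most
    [d], so these are all its roots. Uniqueness makes [p k] proportional to [J k.+1], and increasing
    order matches the [m]-th root with the [m]-th gap. *)
Lemma jacobi_roots_critical k (m : 'I_(minn k.+1 M)) :
  node (j k) m < tnth (j k.+1) m < node (j k) m.+1 /\
  \sum_(i < (minn k.+1 M).+1) node_charge alpha M k i / (tnth (j k.+1) m - node (j k) i) = 0.
Proof.
move: m; set d := minn k.+1 M => m.
have lt i l := @node_row_lt k i l.
have c0 i := @node_charge_gt0 alpha M k i alpha0.
have /choice[y hy] (i : 'I_d) : exists x, node (j k) i < x < node (j k) i.+1 /\ root (p k) x.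
  have [x ? ?] := @weighted_deriv_root _ d.+1 (node_charge alpha M k) _ i (ltn_ord i) lt c0.
  by exists x.
have y_lt (i l : 'I_d) : (i < l)%N -> y i < y l.
  move=> il; have [/andP[_ h1] _] := hy i; have [/andP[h2 _] _] := hy l.
  rewrite (lt_le_trans h1)// (le_trans _ (ltW h2))//.
  by move: il; rewrite leq_eqVlt => /predU1P[->//|il]; rewrite ltW// lt// ltnS ltnW.
have d0 : (0 < d)%N by rewrite /d leq_min.
have node01 i : (i < d.+1)%N -> 0 <= node (j k) i <= 1.
  move=> id; apply/andP; split.
    by case: i id => // i id; rewrite -[0]/(node (j k) 0) ltW// lt.
  case: i id => [_|i id]; first exact: ler01.
  rewrite /node/=; have [ik|ki] := ltnP i (minn k M); first by case/andP: (row01 ik) => _ /ltW.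
  by rewrite nth_default// size_tuple.
have y01 i : 0 < y i < 1.
  have [/andP[h1 h2] _] := hy i.
  have [_] := andP (node01 i.+1 (ltn_ord i)).
  have [+ _] := andP (node01 i (leqW (ltn_ord i))).
  by move=> h3 h4; rewrite (le_lt_trans h3)// (lt_le_trans h2).
pose t := [tuple y i | i < d].
have ut : uniq t.
  apply/tuple_uniqP => i l; rewrite !tnth_mktuple => yy; apply: contrapT => /eqP.
  by rewrite -(inj_eq val_inj) neq_ltn => /orP[] /y_lt; rewrite yy ltxx.
have p0 : p k != 0.
  apply/eqP => pk0; have := @horner_weighted_deriv_node _ d.+1 (node_charge alpha M k) (node (j k)) ord0.
  rewrite -/(p k) pk0 horner0 => /esym/eqP; apply/negP; rewrite mulf_neq0//.
    by rewrite gt_eqF// c0.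
  apply/prodf_neq0 => l l0; rewrite subr_eq0 lt_eqF// lt//.
  by rewrite lt0n; apply: contra l0 => /eqP e; apply/eqP/val_inj.
(* Having [d] distinct roots, the nonzero polynomial [p k] attains the maximal size. *)
have sp : size (p k) = d.+1.
  apply/eqP; rewrite eqn_leq size_weighted_deriv/=.
  rewrite -{1}(size_tuple t) max_poly_roots//.
  by apply/all_tnthP => i; rewrite tnth_mktuple; case: (hy i).
have [sJ _] := hJ (ltn0Sn k).
have [e e0 JE] := beta_orth_unique alpha0
  (orthogonal_poly_moment (distE k.+1) (hJ (ltn0Sn k))) (@p_orth k) sJ sp.
have [inc rt] := hj (ltn0Sn k).
(* Two increasing lists of length [d], one contained in the other, are equal. *)
have tj : t = j k.+1.
  apply/val_inj/lt_sorted_eq.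
  - apply/(sortedP 0) => i; rewrite size_tuple => id.
    by rewrite -(tnth_nth 0 t (Ordinal id)) -(tnth_nth 0 t (Ordinal (ltn_trans (ltnSn i) id))) !tnth_mktuple y_lt.
  - apply/(sortedP 0) => i; rewrite size_tuple => id.
    by have := inc (Ordinal (ltn_trans (ltnSn i) id)) (Ordinal id) (ltnSn i); rewrite !(tnth_nth 0).
  have [||//] := uniq_min_size ut (s2 := j k.+1); last by rewrite !size_tuple.
  move=> x /tnthP[i ->]; rewrite tnth_mktuple.
  have [_ [|l ->]] := rt (y i); last exact: mem_tnth.
  split; last exact: y01.
  by rewrite JE rootZ//; case: (hy i).
have jE : tnth (j k.+1) m = y m by rewrite -tj tnth_mktuple.
rewrite jE; have [h1 h2] := hy m; split=> //.
have yn (i : 'I_d.+1) : y m != node (j k) i.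
  have /andP[h3 h4] := h1; have [im|mi] := leqP i m.
    rewrite gt_eqF// (le_lt_trans _ h3)//.
    by move: im; rewrite leq_eqVlt => /predU1P[->//|im]; rewrite ltW// lt// leqW.
  rewrite lt_eqF// (lt_le_trans h4)//.
  by move: mi; rewrite leq_eqVlt => /predU1P[->//|mi]; rewrite ltW// lt.
move: h2; rewrite /root horner_weighted_deriv// mulf_eq0 horner_node_poly => /orP[|/eqP//].
rewrite prodf_seq_eq0 => /hasP[i _ /= ]; rewrite subr_eq0 => yi.
by have := yn i; rewrite yi.
Qed.
End critical_points.

(** * Laplace asymptotics of one row *)

Lemma cvg_near_eq (R : realType) (f g : nat -> R) (l : R) :
  (\forall n \near \oo, f n = g n) ->
  g n @[n --> \oo] --> l -> f n @[n --> \oo] --> l.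
Proof.
move=> fg; apply: cvg_trans; apply: near_eq_cvg.
by apply: filterS fg => n ->.
Qed.

Lemma cvg_expn (R : realType) (f : nat -> R) (l : R) k :
  f n @[n --> \oo] --> l -> f n ^+ k @[n --> \oo] --> l ^+ k.
Proof.
move=> fl; elim: k => [|k IH]; first by rewrite expr0; exact: cvg_cst.
by rewrite exprS; under eq_fun do rewrite exprS; exact: cvgM.
Qed.

Section ln_bounds.
Context {R : realType}.
Implicit Types x : R.

(** The error vanishes at 0 and has derivative [y^2 / (1 + y)], which lies between 0 and [3 y^2] on
    [[-1/2, 1/2]]; hence it and its difference with [y^3] are monotone. *)
Lemma ln1D_taylor2 x : `|x| <= 2^-1 -> `|ln (1 + x) - x + x ^+ 2 / 2| <= `|x| ^+ 3.
Proof.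
move=> x2.
pose h (y : R) := ln (1 + y) - y + y ^+ 2 / 2.
pose k (y : R) := h y - y ^+ 3.
have dh (y : R) : -1 < y -> is_derive y 1 h (y ^+ 2 / (1 + y)).
  move=> y1; have y0 : 0 < 1 + y by lra.
  have dl : is_derive (1 + y) 1 (@ln R) (1 + y)^-1 by exact: is_derive1_ln.
  have d1 : is_derive y 1 (fun z : R => 1 + z) 1.
    by rewrite -[X in is_derive _ _ _ X]add0r; apply: is_deriveD.
  have := is_derive1_comp dl d1; rewrite mulr1 => dc.
  apply: is_derive_eq.
  by rewrite /GRing.scale/=; field; rewrite gt_eqF.
have dk (y : R) : -1 < y -> is_derive y 1 k (y ^+ 2 / (1 + y) - 3 * y ^+ 2).
  move=> y1; have := dh _ y1 => dhy; apply: is_derive_eq.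
  by rewrite /GRing.scale/=; ring.
have mono (f : R -> R) (f' : R -> R) (a b : R) : a <= b ->
   (forall y, a <= y <= b -> is_derive y 1 f (f' y)) ->
   (forall y, a <= y <= b -> 0 <= f' y) -> f a <= f b.
  move=> ab df f0.
  have df' y : y \in `[a, b] -> is_derive y 1 f (f' y).
    by rewrite in_itv/= => /df.
  have cf : {within `[a, b], continuous f}.
    apply: derivable_within_continuous => y /df' dfy; exact: ex_derive.
  have df'' y : y \in `]a, b[ -> is_derive y 1 f (f' y).
    by move=> yab; apply: df'; exact: subset_itv_oo_cc yab.
  have [c cab E] := MVT_segment ab df'' cf.
  by rewrite -subr_ge0 E mulr_ge0 ?subr_ge0// f0// -in_itv.
have h0 : h 0 = 0 by rewrite /h addr0 ln1; ring.
have k0 : k 0 = 0 by rewrite /k h0; ring.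
have hx' (y : R) : -2^-1 <= y <= 2^-1 -> 0 <= y ^+ 2 / (1 + y).
  by move=> y2; rewrite divr_ge0 ?sqr_ge0//; lra.
have kx' (y : R) : -2^-1 <= y <= 2^-1 -> 0 <= 3 * y ^+ 2 - y ^+ 2 / (1 + y).
  move=> y2; have y1 : 0 < 1 + y by lra.
  rewrite subr_ge0 ler_pdivrMr//; have := sqr_ge0 y; nra.
have dNk (y : R) : -1 < y -> is_derive y 1 (\- k) (3 * y ^+ 2 - y ^+ 2 / (1 + y)).
  by move=> y1; have := dk _ y1 => dky; apply: is_derive_eq; rewrite opprB.
change (`|h x| <= `|x| ^+ 3).
move: x2; rewrite ler_norml => x2; have [xp|xn] := leP 0 x.
  have hp : h 0 <= h x.
    by apply: (mono h (fun y => y ^+ 2 / (1 + y))) => // y y0x; [apply: dh|apply: hx']; lra.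
  have kp : (\- k) 0 <= (\- k) x.
    by apply: (mono _ (fun y => 3 * y ^+ 2 - y ^+ 2 / (1 + y))) => // y y0x; [apply: dNk|apply: kx']; lra.
  by move: hp kp; rewrite /= h0 k0 /k => hp kp; rewrite !ger0_norm//; lra.
have hp : h x <= h 0.
  by apply: (mono h (fun y => y ^+ 2 / (1 + y))) => [|y y0x|y y0x]; [lra|apply: dh|apply: hx']; lra.
have kp : (\- k) x <= (\- k) 0.
  by apply: (mono _ (fun y => 3 * y ^+ 2 - y ^+ 2 / (1 + y))) => [|y y0x|y y0x]; [lra|apply: dNk|apply: kx']; lra.
move: hp kp; rewrite /= h0 k0 /k => hp kp.
by rewrite (ltr0_norm xn) ler0_norm// exprNn; lra.
Qed.

(** Used to carry a bound on [log_profile] from a fixed distance to all larger ones. *)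
Lemma ln_concave1 (l x : R) : 0 <= l <= 1 -> 0 < 1 + x -> l * ln (1 + x) <= ln (1 + l * x).
Proof.
move=> l01 x0.
have := @concave_ln R (Itv01 (andP l01).1 (andP l01).2) (1 + x) 1 x0 ltr01.
rewrite !convRE/= ln1 mulr0 addr0.
rewrite (_ : l * (1 + x) + unstable.onem l * 1 = 1 + l * x)//.
by rewrite /unstable.onem; ring.
Qed.

End ln_bounds.

Section log_weight.
Context {R : realType}.
Variables (m : nat) (c delta eta : 'I_m -> R).
Hypotheses (c0 : forall i, 0 < c i) (delta0 : forall i, delta i != 0).
Hypothesis crit : \sum_i c i / delta i = 0.
Variables (e t : nat -> R).
Hypotheses (e_cvg : e n @[n --> \oo] --> (0 : R)).
Hypothesis (e_gt0 : \forall n \near \oo, 0 < e n).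
Hypothesis (tE : \forall n \near \oo, t n = (e n ^+ 2)^-1).

(* With [t = e^-2], the logarithm of [\prod_i |delta i - e * eta i + e * v| `^
   (t * c i - 1)] relative to its value at [v = 0]; the terms of order [1/e] cancel
   by [crit]. *)
Definition scaled_gap n i := delta i - e n * eta i.
Definition log_profile n v := \sum_i (t n * c i - 1) * ln (1 + e n * v / scaled_gap n i).
(** Minus the second derivative of the limiting exponent, and its linear coefficient due to the
    displacements [eta] of the nodes; the limiting normal law has mean [slope / curv] and variance
    [1 / curv]. *)
Definition curv := \sum_i c i / delta i ^+ 2.
Definition slope := \sum_i c i * eta i / delta i ^+ 2.

Lemma scaled_gap_cvg i : scaled_gap n i @[n --> \oo] --> delta i.
Proof.
rewrite -[X in _ --> X]subr0 -(mul0r (eta i)).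
apply: cvgB; first exact: cvg_cst.
by apply: cvgMl.
Qed.

Lemma scaled_gap_neq0 : \forall n \near \oo, forall i, scaled_gap n i != 0.
Proof.
apply: filter_forall => i; exact: (cvgr_neq0 _ (@scaled_gap_cvg i)).
Qed.

Let x n i v := e n * v / scaled_gap n i.

Let x_cvg i v : x n i v @[n --> \oo] --> (0 : R).
Proof.
rewrite -[X in _ --> X](mul0r (delta i)^-1) -(mul0r v).
apply: cvgM; first exact: cvgMl.
by apply: cvgV => //; exact: scaled_gap_cvg.
Qed.

Let ln_cvg i v : ln (1 + x n i v) @[n --> \oo] --> (0 : R).
Proof.
rewrite -ln1; apply: continuous_cvg; first exact: continuous_ln.
rewrite -[X in _ --> X](addr0 1); apply: cvgD; [exact: cvg_cst|exact: x_cvg].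
Qed.

(** The cubic remainder is of order [t * e^3 = e]. *)
Let rem_cvg i v :
  t n * (ln (1 + x n i v) - x n i v + x n i v ^+ 2 / 2) @[n --> \oo] --> (0 : R).
Proof.
have zero : e n * (`|v| ^+ 3 / `|scaled_gap n i| ^+ 3) @[n --> \oo] --> (0 : R).
  rewrite -[X in _ --> X](mul0r (`|v| ^+ 3 / `|delta i| ^+ 3)).
  apply: cvgM => //; apply: cvgMr; apply: cvgV.
    by rewrite expf_neq0// normr_eq0.
  by apply: cvg_expn; apply: cvg_norm; exact: scaled_gap_cvg.
apply/cvgr0Pnorm_le => eps eps0; near=> n.
have e0 : 0 < e n by near: n.
have tn : t n = (e n ^+ 2)^-1 by near: n.
have d0 : scaled_gap n i != 0 by move: {+}i; near: n; exact: scaled_gap_neq0.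
have x2 : `|x n i v| <= 2^-1.
  by near: n; apply: ((cvgr0Pnorm_le _).1 (@x_cvg i v)).
rewrite normrM tn (@le_trans _ _ ((e n ^+ 2)^-1 * `|x n i v| ^+ 3))//.
  rewrite ger0_norm ?invr_ge0 ?sqr_ge0// ler_wpM2l ?invr_ge0 ?sqr_ge0//.
  exact: ln1D_taylor2.
have -> : (e n ^+ 2)^-1 * `|x n i v| ^+ 3 = `|e n * (`|v| ^+ 3 / `|scaled_gap n i| ^+ 3)|.
  rewrite /x !normrM !normfV !normrX !normr_id (gtr0_norm e0).
  by field; rewrite !gt_eqF// normr_gt0.
by near: n; apply: ((cvgr0Pnorm_le _).1 zero).
Unshelve. all: by end_near. Qed.

Lemma log_profile_cvg v : log_profile n v @[n --> \oo] --> - curv * v ^+ 2 / 2 + slope * v.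
Proof.
(* The summand of [log_profile] without its singular part [(v / e) * (c i / delta i)], written as a
   Taylor remainder, a negligible logarithm, and convergent linear and quadratic terms. *)
pose a n i := c i * (t n * (ln (1 + x n i v) - x n i v + x n i v ^+ 2 / 2))
  - ln (1 + x n i v) + (c i * eta i / (scaled_gap n i * delta i) * v - c i / scaled_gap n i ^+ 2 * v ^+ 2 / 2).
have aE : \forall n \near \oo, log_profile n v = \sum_i a n i.
  near=> n.
  have e0 : 0 < e n by near: n.
  have tn : t n = (e n ^+ 2)^-1 by near: n.
  have d0 i : scaled_gap n i != 0 by move: i; near: n; exact: scaled_gap_neq0.
  have dE i : delta i = scaled_gap n i + e n * eta i by rewrite /scaled_gap; ring.
  transitivity (\sum_i (a n i + v / e n * (c i / delta i))); last first.
    by rewrite big_split/= -mulr_sumr crit mulr0 addr0.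
  apply: eq_bigr => i _; rewrite /a /x tn.
  set l := ln _; have := delta0 i; rewrite dE => h.
  by field; rewrite d0 h gt_eqF.
have aC i : a n i @[n --> \oo] -->
   c i * 0 - 0 + (c i * eta i / (delta i * delta i) * v - c i / delta i ^+ 2 * v ^+ 2 / 2).
  apply: cvgD.
    by apply: cvgB; [apply: cvgMr; exact: rem_cvg|exact: ln_cvg].
  apply: cvgB.
    apply: cvgMl; apply: cvgMr; apply: cvgV; first by rewrite mulf_neq0.
    by apply: cvgMl; exact: scaled_gap_cvg.
  do 2 apply: cvgMl; apply: cvgMr; apply: cvgV; first by rewrite expf_neq0.
  by apply: cvg_expn; exact: scaled_gap_cvg.
rewrite (_ : _ + _ = \sum_i (c i * 0 - 0 + (c i * eta i / (delta i * delta i) * v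
    - c i / delta i ^+ 2 * v ^+ 2 / 2))); last first.
  rewrite /curv /slope mulNr mulr_suml mulr_suml mulNr mulr_suml -sumrN -big_split/=.
  apply: eq_bigr => i _; have := delta0 i => di; rewrite mulr0 subrr add0r addrC.
  by congr (_ + _); field.
apply: (cvg_near_eq aE).
by apply: cvg_big => [|i _]; [exact: add_continuous|exact: aC].
Unshelve. all: by end_near. Qed.

Lemma curv_gt0 : (0 < m)%N -> 0 < curv.
Proof.
move=> m0; rewrite /curv (bigD1 (Ordinal m0))//= ltr_wpDr//.
  by apply: sumr_ge0 => i _; rewrite divr_ge0 ?sqr_ge0// ltW.
by rewrite divr_gt0// exprn_even_gt0//=.
Qed.

(** On a bounded range [ln (1 + x) <= x] suffices. Beyond it, the profile is concave, vanishes at 0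
    and is at most -1 at both points [v0] and [-v0], so it lies below [- |v| / v0]. *)
Lemma log_profile_le : (0 < m)%N -> exists C, exists2 k : R, 0 < k &
  \forall n \near \oo, forall v, (forall i, 0 < 1 + e n * v / scaled_gap n i) ->
    log_profile n v <= C - k * `|v|.
Proof.
move=> m0; have S0 := curv_gt0 m0.
(* Chosen so that [curv * v0 = curv + 2 |slope| + 4], which makes the limiting quadratic at most -2
   at distance [v0]; the profile itself is then eventually at most -1 there. *)
pose v0 := 1 + (2 * `|slope| + 4) / curv.
have v1 : 1 <= v0.
  by rewrite lerDl divr_ge0 ?ltW// addr_ge0// mulr_ge0.
have v00 : 0 < v0 by apply: lt_le_trans v1.
have qv0 (s : R) : `|s| = v0 -> - curv * s ^+ 2 / 2 + slope * s <= -2.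
  move=> sv; have : slope * s <= `|slope| * v0 by rewrite -sv -normrM ler_norm.
  have -> : s ^+ 2 = v0 ^+ 2 by rewrite -sv real_normK ?num_real.
  have : curv * v0 = curv + (2 * `|slope| + 4).
    by rewrite /v0 mulrDr mulr1 mulrCA divff ?mulr1// gt_eqF.
  by move: v1 v00 S0 (normr_ge0 slope); nra.
(* The derivative of the profile at 0; it stays bounded because the terms of order [1 / e] cancel by
   [crit]. *)
pose beta n := \sum_i (t n * c i - 1) * (e n / scaled_gap n i).
have betaE : \forall n \near \oo,
    beta n = \sum_i (c i * eta i / (scaled_gap n i * delta i) - e n / scaled_gap n i).
  near=> n.
  have e0 : 0 < e n by near: n.
  have tn : t n = (e n ^+ 2)^-1 by near: n.
  have d0 i : scaled_gap n i != 0 by move: i; near: n; exact: scaled_gap_neq0.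
  have dE i : delta i = scaled_gap n i + e n * eta i by rewrite /scaled_gap; ring.
  transitivity (\sum_i (c i * eta i / (scaled_gap n i * delta i) - e n / scaled_gap n i
     + (e n)^-1 * (c i / delta i))); last first.
    by rewrite big_split/= -mulr_sumr crit mulr0 addr0.
  apply: eq_bigr => i _; rewrite tn.
  have := delta0 i; rewrite dE => h.
  by field; rewrite d0 h gt_eqF.
have beta_cvg : beta n @[n --> \oo] --> \sum_i (c i * eta i / (delta i * delta i) - 0 / delta i).
  apply: (cvg_near_eq betaE).
  apply: cvg_big => [|i _]; first exact: add_continuous.
  apply: cvgB.
    apply: cvgMr; apply: cvgV; first by rewrite mulf_neq0.
    by apply: cvgMl; exact: scaled_gap_cvg.
  by apply: cvgM => //; apply: cvgV => //; exact: scaled_gap_cvg.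
set B := \sum_i _ in beta_cvg.
(* The extra 1 compensates [|v| / v0] on the range [|v| <= v0]. *)
exists (v0 * (`|B| + 1) + 1); exists v0^-1; first by rewrite invr_gt0.
have chi_v0 (s : R) : `|s| = v0 -> \forall n \near \oo, log_profile n s <= -1.
  move=> sv; apply: (cvgr_le _ (@log_profile_cvg s)).
  by apply: le_lt_trans (qv0 _ sv) _; lra.
have chi_p := chi_v0 _ (gtr0_norm v00).
have chi_n := chi_v0 (- v0) (etrans (normrN _) (gtr0_norm v00)).
near=> n => v vpos.
have e0 : 0 < e n by near: n.
have tn : t n = (e n ^+ 2)^-1 by near: n.
(* For large [n] every exponent is nonnegative, so bounds on the logarithms survive multiplication
   by it. *)
have tc i : 0 <= t n * c i - 1.
  move: i; near: n; apply: filter_forall => i; near=> n.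
  have e0 : 0 < e n by near: n.
  have -> : t n = (e n ^+ 2)^-1 by near: n.
  have eb : `|e n| <= Num.sqrt (c i).
    by near: n; apply: ((cvgr0Pnorm_le _).1 (@e_cvg)); rewrite sqrtr_gt0.
  rewrite subr_ge0 mulrC ler_pdivlMr ?exprn_gt0// mul1r.
  rewrite -(sqr_sqrtr (ltW (c0 i))) -(gtr0_norm e0).
  by rewrite lerXn2r// nnegrE// sqrtr_ge0.
have chi_at (s : R) : `|s| = v0 -> log_profile n s <= -1.
  move=> sv; have [->|->] : s = v0 \/ s = - v0.
    by move: sv; case: (ger0P s) => _ <-; [left|right; rewrite opprK].
  - by near: n.
  - by near: n.
have bn : `|beta n| <= `|B| + 1.
  near: n; apply: (cvgr_le `|B|); first exact: cvg_norm.
  by rewrite ltrDl.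
have [hv|hv] := leP `|v| v0.
  apply: (@le_trans _ _ (v * beta n)).
    rewrite /log_profile /beta mulr_sumr; apply: ler_sum => i _.
    rewrite mulrCA ler_wpM2l// mulrA (mulrC v); apply: le_ln1Dx.
    by have := vpos i; lra.
  apply: (@le_trans _ _ (v0 * (`|B| + 1))).
    by rewrite (le_trans (ler_norm _))// normrM ler_pM.
  rewrite -addrA lerDl subr_ge0 ler_pdivrMl ?mulr1//.
have v0v : 0 < `|v| by exact: lt_trans hv.
pose l := v0 / `|v|.
have l0 : 0 < l by rewrite divr_gt0.
have l01 : 0 <= l <= 1.
  by rewrite (ltW l0)/= /l ler_pdivrMr// mul1r ltW.
have lv : `|l * v| = v0.
  by rewrite normrM /l gtr0_norm ?divr_gt0// divfK// gt_eqF.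
have : l * log_profile n v <= log_profile n (l * v).
  rewrite /log_profile mulr_sumr; apply: ler_sum => i _; rewrite mulrCA ler_wpM2l//.
  have := ln_concave1 l01 (vpos i).
  by rewrite (_ : l * (e n * v / scaled_gap n i) = e n * (l * v) / scaled_gap n i)//; ring.
have := chi_at _ lv => h1 h2.
have h3 : l * log_profile n v <= -1 by exact: le_trans h2 h1.
have h4 : log_profile n v <= - (v0^-1 * `|v|).
  have -> : - (v0^-1 * `|v|) = (-1) / l.
    by rewrite /l; field; rewrite !gt_eqF.
  by rewrite ler_pdivlMr ?divr_gt0// mulrC.
apply: (le_trans h4); rewrite lerDr addr_ge0// mulr_ge0 ?ltW// addr_ge0//.
Unshelve. all: by end_near. Qed.

End log_weight.

Section laplace_row.
Context {R : realType}.
Local Open Scope ereal_scope.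
Notation leb := (@lebesgue_measure R).

Lemma expR_quad_normal (S B x : R) : (0 < S)%R ->
  (expR (- S * x ^+ 2 / 2 + B * x) =
   expR (B ^+ 2 / (2 * S)) / normal_peak (Num.sqrt S)^-1 *
   normal_pdf (B / S) (Num.sqrt S)^-1 x)%R.
Proof.
move=> S0; have q0 : (0 < Num.sqrt S)%R by rewrite sqrtr_gt0.
have p0 : (normal_peak (Num.sqrt S)^-1 != 0)%R.
  by rewrite gt_eqF// normal_peak_gt0// gt_eqF// invr_gt0.
have E (p f c : R) : p != 0%R -> (c / p * (p * f) = c * f)%R by move=> h; field.
rewrite normal_pdfE ?gt_eqF ?invr_gt0//= E// /normal_fun -expRD.
apply: (congr1 expR); rewrite exprVn sqr_sqrtr ?ltW//.
by field; rewrite gt_eqF.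
Qed.

(** The two-sided exponential is dominated by a multiple of the sum of an exponential density and
    its reflection. *)
Lemma integral_expR_norm (k : R) : (0 < k)%R ->
  \int[leb]_x (expR (- (k * `|x|)))%:E < +oo.
Proof.
move=> k0.
have mpdf := measurable_exponential_pdf k.
have pd0 y : (0 <= exponential_pdf k y)%R by exact: exponential_pdf_ge0 (ltW k0) y.
have mN : measurable_fun setT (fun x : R => exponential_pdf k (- x)%R).
  exact: measurableT_comp.
apply: (@le_lt_trans _ _ (\int[leb]_x (k^-1%:E *
    ((exponential_pdf k x)%:E + (exponential_pdf k (- x)%R)%:E)))).
  apply: ge0_le_integral => //.
  - apply/measurable_EFinP; apply: measurableT_comp => //.
    apply: measurableT_comp => //.
    by apply: measurable_funM => //; exact: measurableT_comp.
  - apply: emeasurable_funM => //; apply: emeasurable_funD; exact/measurable_EFinP.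
  - move=> x _; rewrite -EFinD -EFinM lee_fin mulrDr.
    have [x0|x0] := leP 0%R x.
      have -> : exponential_pdf k x = (k * expR (- k * x))%R by exact: exponential_pdfE.
      rewrite mulrA mulVf ?gt_eqF// mul1r.
      rewrite ger0_norm// -mulNr lerDl.
      by rewrite mulr_ge0 ?invr_ge0 ?(ltW k0).
    have nx0 : (0 <= - x)%R by rewrite oppr_ge0 ltW.
    have -> : exponential_pdf k (- x)%R = (k * expR (- k * - x))%R by exact: exponential_pdfE.
    rewrite [X in (_ <= _ + X)%R]mulrA mulVf ?gt_eqF// mul1r.
    rewrite ltr0_norm// -mulNr lerDr.
    by rewrite mulr_ge0 ?invr_ge0 ?(ltW k0).
have pg0 x : 0 <= (exponential_pdf k x)%:E by rewrite lee_fin exponential_pdf_ge0 ?ltW.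
rewrite ge0_integralZl//; last 3 first.
- apply: emeasurable_funD; exact/measurable_EFinP.
- by move=> x _; rewrite adde_ge0.
- by rewrite lee_fin invr_ge0 ltW.
rewrite ge0_integralD//; [|exact/measurable_EFinP|exact/measurable_EFinP].
have -> : \int[leb]_x (exponential_pdf k (- x)%R)%:E = 1.
  rewrite -(integral_exponential_pdf k0).
  rewrite [RHS](integral_affine (a := -1) 0)%R//; [|exact/measurable_EFinP].
  rewrite normrN1 mul1e; apply: eq_integral => x _.
  by rewrite add0r mulN1r.
by rewrite integral_exponential_pdf// -EFinD -EFinM ltry.
Qed.

Variables (k : nat) (w : nat -> k.-tuple R -> R) (K : nat -> R) (A C kappa : R).
Variables (S B : 'I_k -> R).
Hypotheses (mw : forall n, measurable_fun setT (w n)) (w0 : forall n v, (0 <= w n v)%R).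
Hypotheses (K0 : \forall n \near \oo, (0 < K n)%R) (A0 : (0 < A)%R) (kappa0 : (0 < kappa)%R).
Hypothesis (S0 : forall j, (0 < S j)%R).
Hypothesis w_cvg : forall v, (w n v / K n)%R @[n --> \oo] -->
  (A * \prod_j expR (- S j * tnth v j ^+ 2 / 2 + B j * tnth v j))%R.
Hypothesis w_le : \forall n \near \oo, forall v,
  (w n v <= K n * (C * \prod_j expR (- (kappa * `|tnth v j|))))%R.

(** The scale [K n] cancels in the quotient. Domination by a product of exponentials gives
    convergence of the masses, so the quotient tends to the Gaussian function divided by its own
    mass. *)
Lemma laplace_row v :
  (w n v / fine (\int[lebesgue_tuple k]_u (w n u)%:E))%R @[n --> \oo] -->
  (\prod_j normal_pdf (B j / S j) (Num.sqrt (S j))^-1 (tnth v j))%R.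
Proof.
pose G v := (A * \prod_j expR (- S j * tnth v j ^+ 2 / 2 + B j * tnth v j))%R.
pose a j := (expR (B j ^+ 2 / (2 * S j)) / normal_peak (Num.sqrt (S j))^-1)%R.
pose A' := (A * \prod_j a j)%R.
have a0 j : (0 < a j)%R.
  by rewrite divr_gt0 ?expR_gt0// normal_peak_gt0// gt_eqF// invr_gt0 sqrtr_gt0.
have A'0 : (0 < A')%R by rewrite mulr_gt0// prodr_gt0.
pose pdf v := (\prod_j normal_pdf (B j / S j) (Num.sqrt (S j))^-1 (tnth v j))%R.
have GE u : G u = (A' * pdf u)%R.
  rewrite /G /A' /pdf -mulrA -big_split/=; congr (_ * _)%R.
  by apply: eq_bigr => j _; rewrite expR_quad_normal.
have mpdf : measurable_fun setT pdf.
  apply: measurable_prod => j _; apply: measurableT_comp; last exact: measurable_tnth.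
  exact: measurable_normal_pdf.
have pdf_ge0 u : (0 <= pdf u)%R by apply: prodr_ge0 => j _; exact: normal_pdf_ge0.
have Ipdf : \int[lebesgue_tuple k]_u (pdf u)%:E = 1.
  rewrite (integral_prod_tuple (h := fun j => normal_pdf (B j / S j) (Num.sqrt (S j))^-1)).
  - by rewrite big1// => j _; exact: integral_normal_pdf.
  - by move=> j; exact: measurable_normal_pdf.
  - by move=> j x; exact: normal_pdf_ge0.
have IG : \int[lebesgue_tuple k]_u (G u)%:E = A'%:E.
  under eq_integral do rewrite GE EFinM.
  rewrite ge0_integralZl//; first by rewrite Ipdf mule1.
  - exact/measurable_EFinP.
  - by move=> u _; rewrite lee_fin.
  - by rewrite lee_fin ltW.
pose D (u : k.-tuple R) := (C * \prod_j expR (- (kappa * `|tnth u j|)))%R.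
have mexp : measurable_fun setT (fun x : R => expR (- (kappa * `|x|))).
  apply: measurableT_comp => //; apply: measurableT_comp => //.
  by apply: measurable_funM => //; exact: measurableT_comp.
have iD : (lebesgue_tuple k).-integrable setT (EFin \o D).
  have ip : (lebesgue_tuple k).-integrable setT
      (fun u => (\prod_j expR (- (kappa * `|tnth u j|)))%R%:E).
    apply/integrableP; split.
      apply/measurable_EFinP; apply: measurable_prod => j _.
      exact: (measurableT_comp mexp (measurable_tnth j)).
    rewrite (eq_integral (fun u : k.-tuple R => (\prod_j expR (- (kappa * `|tnth u j|)))%R%:E)); last first.
      by move=> u _; rewrite /= ger0_norm// prodr_ge0// => j _; exact: expR_ge0.
    rewrite (integral_prod_tuple (h := fun j x => expR (- (kappa * `|x|))))//.
    have I0 : 0 <= \int[leb]_x (expR (- (kappa * `|x|)))%:E.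
      by apply: integral_ge0 => x _; rewrite lee_fin expR_ge0.
    have If : \int[leb]_x (expR (- (kappa * `|x|)))%:E \is a fin_num.
      by rewrite ge0_fin_numE// integral_expR_norm.
    by rewrite -(fineK If) -(big_morph EFin (@EFinM R) erefl) ltry.
  by have := integrableZl measurableT C ip.
have [N _ KN] := K0; have [N' _ wN] := w_le.
(* The bounds hold only eventually while dominated convergence wants them for every index, hence the
   shift by [n0]. *)
pose n0 := maxn N N'.
have IgC : \int[lebesgue_tuple k]_u ((w (n + n0)%N u / K (n + n0)%N)%R)%:E @[n --> \oo] --> A'%:E.
  rewrite -IG; apply: (dominated_cvg _ _ _ (g := EFin \o D)) => //.
  - by move=> n; apply/measurable_EFinP; apply: measurable_funM.
  - move=> u _; apply/cvg_EFin; first exact: nearW.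
    have := @w_cvg u; rewrite -(cvg_shiftn n0); exact.
  - move=> n u _; rewrite lee_fin.
    have Kn : (0 < K (n + n0)%N)%R by apply: KN; rewrite /= (leq_trans (leq_maxl N N'))// leq_addl.
    rewrite ger0_norm; last by rewrite divr_ge0// ltW.
    rewrite ler_pdivrMr// mulrC; apply: wN.
    by rewrite /= (leq_trans (leq_maxr N N'))// leq_addl.
rewrite -(cvg_shiftn n0).
have -> : (\prod_j normal_pdf (B j / S j) (Num.sqrt (S j))^-1 (tnth v j) = G v / A')%R.
  by rewrite GE mulrAC divff ?mul1r// gt_eqF.
pose I n := fine (\int[lebesgue_tuple k]_u ((w (n + n0)%N u / K (n + n0)%N)%R)%:E).
have IC : I n @[n --> \oo] --> A' by exact: fine_cvg.
have GC : ((w (n + n0)%N v / K (n + n0)%N)%R / I n)%R @[n --> \oo] --> (G v / A')%R.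
  apply: cvgM; last by apply: cvgV => //; rewrite gt_eqF.
  by have := @w_cvg v; rewrite -(cvg_shiftn n0); exact.
apply: cvg_near_eq GC; apply: nearW => n.
have Kn : (0 < K (n + n0)%N)%R by apply: KN; rewrite /= (leq_trans (leq_maxl N N'))// leq_addl.
(* Valid even for an infinite integral, since [fine] then gives 0 on both sides. *)
have -> : I n = ((K (n + n0)%N)^-1 * fine (\int[lebesgue_tuple k]_u (w (n + n0)%N u)%:E))%R.
  rewrite /I; under eq_integral do rewrite mulrC EFinM.
  rewrite ge0_integralZl//.
  - case: (\int[lebesgue_tuple k]_x _) => [r| |]//=.
      by rewrite gt0_muley ?lte_fin ?invr_gt0//= mulr0.
    by rewrite gt0_muleNy ?lte_fin ?invr_gt0//= mulr0.
  - exact/measurable_EFinP.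
  - by move=> u _; rewrite lee_fin.
  - by rewrite lee_fin invr_ge0 ltW.
by rewrite invfM invrK mulrA divfK// gt_eqF.
Qed.

End laplace_row.

Lemma cvg_prodr {R : realType} (I : Type) (r : seq I) (P : pred I)
    (f : I -> nat -> R) (l : I -> R) :
  (forall i, P i -> f i n @[n --> \oo] --> l i) ->
  \prod_(i <- r | P i) f i n @[n --> \oo] --> \prod_(i <- r | P i) l i.
Proof.
move=> h; elim: r => [|i r IH].
  by rewrite big_nil; under eq_fun do rewrite big_nil; exact: cvg_cst.
rewrite big_cons; under eq_fun do rewrite big_cons.
by case: ifPn => // Pi; apply: cvgM => //; exact: h.
Qed.

Section row_weight.
Context {R : realType}.
Variables (d : nat) (c : nat -> R).
Implicit Types (z : nat -> R) (y : d.-tuple R) (t : R).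

Definition slot z (m : nat) (y : R) : bool := z m < y < z m.+1.

(* Up to factors depending on [z] only, the transition density from a row [z]
   to the next row [y]; the coordinates of [y] interact only through the first
   factor, of degree one whatever [t] is. *)
Definition row_weight t z y : R :=
  vandermonde_pow 1 y *
  \prod_(m < d) (if slot z m (tnth y m)
    then \prod_(i < d.+1) `|tnth y m - z i| `^ (t * c i - 1) else 0).

Lemma row_weight_ge0 t z y : 0 <= row_weight t z y.
Proof.
apply: mulr_ge0; first by apply: prodr_ge0 => i _; apply: prodr_ge0 => l _; exact: powR_ge0.
by apply: prodr_ge0 => m _; case: ifP => // _; apply: prodr_ge0 => i _; exact: powR_ge0.
Qed.

Lemma measurable_vandermonde_pow s : measurable_fun setT (@vandermonde_pow R d s).
Proof.
apply: measurable_prod => i _.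
rewrite (_ : (fun _ => _) = fun y => \prod_(l < d)
    (if (i < l)%N then (tnth y l - tnth y i) `^ s else 1)); last first.
  by apply/funext => y; rewrite big_mkcond.
apply: measurable_prod => l _; have [il|_] := boolP (i < l)%N => //.
apply: (measurableT_comp (measurable_powR s)).
by apply: measurable_funB; exact: measurable_tnth.
Qed.

Lemma measurable_row_weight dT (T : measurableType dT) t (z : T -> nat -> R)
    (y : T -> d.-tuple R) :
  (forall i, measurable_fun setT (z^~ i)) -> measurable_fun setT y ->
  measurable_fun setT (fun x => row_weight t (z x) (y x)).
Proof.
move=> mz my.
have my' m : measurable_fun setT (fun x => tnth (y x) m).
  exact: measurableT_comp (measurable_tnth m) my.
apply: measurable_funM; first exact: measurableT_comp (measurable_vandermonde_pow 1) my.
apply: measurable_prod => m _.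
apply: measurable_fun_ifT => //.
  by apply: measurable_and; exact: measurable_fun_ltr.
apply: measurable_prod => i _.
apply: (measurableT_comp (measurable_powR _)).
by apply: measurableT_comp => //; apply: measurable_funB => //; exact: mz.
Qed.

Lemma powR_norm_le (L a p : R) : 1 <= L -> `|a| <= L -> 0 <= p -> `|a| `^ p <= L `^ p.
Proof.
move=> L1 aL p0; rewrite ge0_ler_powR// ?nnegrE//.
exact: le_trans ler01 L1.
Qed.

Lemma vandermonde_pow1_le (L : R) y : 1 <= L ->
  (forall i l, `|tnth y i - tnth y l| <= L) ->
  vandermonde_pow 1 y <= \prod_(i < d) \prod_(l < d | (i < l)%N) L.
Proof.
move=> L1 yL; rewrite /vandermonde_pow.
apply: ler_prod => i _; rewrite prodr_ge0 => [|l _]; last exact: powR_ge0.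
apply: ler_prod => l _; rewrite powR_ge0/=.
have [h|h] := leP 0 (tnth y l - tnth y i).
  by rewrite powRr1// (le_trans (ler_norm _)).
(* On a negative base the power is 1 by convention, because [ln] is 0 there; the bound holds since
   [1 <= L]. *)
rewrite /powR lt_eqF// ln0 ?mulr0 ?expR0//; exact: ltW.
Qed.

(** When [t * c i >= 1] all exponents are nonnegative, so the weight is bounded on its support,
    which lies in a bounded box. *)
Lemma row_weight_integrable t z : (forall i, (i < d.+1)%N -> 1 <= t * c i) ->
  (\int[lebesgue_tuple d]_y (row_weight t z y)%:E < +oo)%E.
Proof.
move=> tc.
pose L := 1 + \sum_(i < d.+1) `|z i|.
have L1 : 1 <= L by rewrite lerDl sumr_ge0.
have zL i : (i < d.+1)%N -> `|z i| <= L.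
  move=> id; rewrite /L (bigD1 (Ordinal id))//= addrCA lerDl addr_ge0//.
  by apply: sumr_ge0.
pose L2 := 2 * L.
have L21 : 1 <= L2 by rewrite /L2; lra.
have slotL m x : (m < d)%N -> slot z m x -> `|x| <= L.
  move=> md /andP[h1 h2]; rewrite ler_norml.
  have := zL _ (ltnW (_ : m.+1 < d.+1)%N); rewrite ltnS => /(_ md).
  have := zL m.+1 _; rewrite ltnS => /(_ md).
  rewrite !ler_norml => /andP[h3 h4] /andP[h5 h6].
  by apply/andP; split; lra.
pose C := (\prod_(i < d) \prod_(l < d | (i < l)%N) L2) *
  \prod_(m < d) \prod_(i < d.+1) L2 `^ (t * c i - 1).
pose I m : R -> R := fun x => if slot z m x then 1 else 0.
have C0 : 0 <= C.
  apply: mulr_ge0; last first.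
    by apply: prodr_ge0 => m _; apply: prodr_ge0 => i _; exact: powR_ge0.
  by apply: prodr_ge0 => m _; apply: prodr_ge0 => i _; rewrite (le_trans ler01).
have mI m : measurable_fun setT (I m).
  apply: measurable_fun_ifT => //.
  by apply: measurable_and; exact: measurable_fun_ltr.
have I0 m x : 0 <= I m x by rewrite /I; case: ifP.
apply: (@le_lt_trans _ _ (\int[lebesgue_tuple d]_y (C%:E * (\prod_(m < d) I m (tnth y m))%R%:E))%E).
  apply: ge0_le_integral => //.
  - by move=> y _; rewrite lee_fin row_weight_ge0.
  - apply/measurable_EFinP; apply: (@measurable_row_weight _ _ _ (fun=> z) id) => //.
  - apply/measurable_EFinP; apply: measurable_funM => //.
    apply: measurable_prod => m _.
    exact: measurableT_comp (mI m) (measurable_tnth m).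
  - move=> y _; rewrite -EFinM lee_fin /row_weight /C.
    have [/forallP sl|] := boolP [forall m : 'I_d, slot z m (tnth y m)]; last first.
      rewrite negb_forall => /existsP[m /negbTE hm].
      rewrite [X in _ * X](bigD1 m)//= hm mul0r mulr0 mulr_ge0//.
      by apply: prodr_ge0.
    rewrite [X in _ <= _ * X]big1 ?mulr1 => [|m _]; last by rewrite /I sl.
    have yL m : `|tnth y m| <= L by apply: (slotL m) => //; exact: sl.
    apply: ler_pM.
    + by apply: prodr_ge0 => i _; apply: prodr_ge0 => l _; exact: powR_ge0.
    + by apply: prodr_ge0 => m _; case: ifP => // _; apply: prodr_ge0 => i _; exact: powR_ge0.
    + apply: vandermonde_pow1_le => // i l; rewrite (le_trans (ler_normB _ _))//.
      by have := yL i; have := yL l; rewrite /L2; lra.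
    + apply: ler_prod => m _; rewrite sl prodr_ge0 => [|i _]; last exact: powR_ge0.
      apply: ler_prod => i _; rewrite powR_ge0/= powR_norm_le//; last first.
        by rewrite subr_ge0 tc.
      rewrite (le_trans (ler_normB _ _))//.
      by have := yL m; have := zL i (ltn_ord i); rewrite /L2; lra.
rewrite ge0_integralZl//; last 2 first.
- apply/measurable_EFinP; apply: measurable_prod => m _.
  exact: measurableT_comp (mI m) (measurable_tnth m).
- by move=> y _; rewrite lee_fin prodr_ge0.
rewrite (integral_prod_tuple (h := fun m : 'I_d => I m))//.
have If (m : 'I_d) : (\int[lebesgue_measure]_x (I m x)%:E \is a fin_num)%E.
  rewrite ge0_fin_numE; last by apply: integral_ge0 => x _; rewrite lee_fin.
  rewrite (_ : (fun _ => _) = (fun x => (\1_(`]z m, z m.+1[) x)%:E)); last first.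
    by apply/funext => x; rewrite /I /slot indicE mem_setE in_itv/=; case: (_ && _).
  apply: (@le_lt_trans _ _ (lebesgue_measure [set` `]z m, z m.+1[])).
    by rewrite integral_indic// setIT.
  rewrite lebesgue_measure_itv/=.
  by case: ifP; rewrite ?ltry// -EFinD ltry.
rewrite (eq_bigr (fun m : 'I_d => (fine (\int[lebesgue_measure]_x (I m x)%:E))%:E)) => [|m _].
  by rewrite -(big_morph EFin (@EFinM R) erefl) -EFinM ltry.
by rewrite fineK.
Qed.
End row_weight.

Section row_limit.
Context {R : realType}.
Variables (d : nat) (c zs eta : nat -> R) (ys : d.-tuple R) (e t : nat -> R).
Hypothesis c0 : forall i, (i < d.+1)%N -> 0 < c i.
Hypothesis zs_lt : forall i l, (i < l)%N -> (l < d.+1)%N -> zs i < zs l.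
Hypothesis ys_slot : forall m : 'I_d, slot zs m (tnth ys m).
Hypothesis critical : forall m : 'I_d,
  \sum_(i < d.+1) c i / (tnth ys m - zs i) = 0.
Hypothesis e_cvg : e n @[n --> \oo] --> (0 : R).
Hypothesis e_gt0 : \forall n \near \oo, 0 < e n.
Hypothesis tE : \forall n \near \oo, t n = (e n ^+ 2)^-1.

Let delta (m : 'I_d) (i : 'I_d.+1) := tnth ys m - zs i.
Let z n (i : nat) := zs i + e n * eta i.

Definition row_curv (m : 'I_d) : R := \sum_(i < d.+1) c i / (tnth ys m - zs i) ^+ 2.
Definition row_slope (m : 'I_d) : R :=
  \sum_(i < d.+1) c i * eta i / (tnth ys m - zs i) ^+ 2.

Let delta_neq0 m i : delta m i != 0.
Proof.
have /andP[h1 h2] := ys_slot m; rewrite subr_eq0.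
have [im|mi] := leqP i m.
  rewrite gt_eqF// (le_lt_trans _ h1)//.
  by move: im; rewrite leq_eqVlt => /predU1P[->//|im]; rewrite ltW// zs_lt// leqW.
rewrite lt_eqF// (lt_le_trans h2)//.
by move: mi; rewrite leq_eqVlt => /predU1P[->//|mi]; rewrite ltW// zs_lt.
Qed.

Let delta_sign m i : (delta m i > 0) = (i <= m)%N.
Proof.
have /andP[h1 h2] := ys_slot m; rewrite subr_gt0.
have [im|mi] := leqP i m.
  rewrite (le_lt_trans _ h1)//.
  by move: im; rewrite leq_eqVlt => /predU1P[->//|im]; rewrite ltW// zs_lt// leqW.
apply/negbTE; rewrite -leNgt ltW// (lt_le_trans h2)//.
by move: mi; rewrite leq_eqVlt => /predU1P[->//|mi]; rewrite ltW// zs_lt.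
Qed.

Let DD m := scaled_gap (delta m) (fun i : 'I_d.+1 => eta i) e.
Let X m := log_profile (fun i : 'I_d.+1 => c i) (delta m) (fun i : 'I_d.+1 => eta i) e t.

Let A := vandermonde_pow 1 ys.
(** The product of powers of distances at [v = 0]; it carries all the growth in [t]. *)
Let K n := \prod_(m < d) \prod_(i < d.+1) `|DD m n i| `^ (t n * c i - 1).
Let y n (v : d.-tuple R) := affine_tuple ys (e n) v.
Let w n v := row_weight c (t n) (z n) (y n v).

Let gapE n v m (i : 'I_d.+1) : tnth (y n v) m - z n i = DD m n i + e n * tnth v m.
Proof. by rewrite tnth_mktuple /z /DD /scaled_gap /delta; ring. Qed.

Let DD_cvg m i : DD m n i @[n --> \oo] --> delta m i.
Proof. exact: scaled_gap_cvg. Qed.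

Let DD_neq0 : \forall n \near \oo, forall m i, DD m n i != 0.
Proof. by apply: filter_forall => m; apply: scaled_gap_neq0 => //; exact: delta_neq0. Qed.

Let DD_sign : \forall n \near \oo, forall m i, (0 < DD m n i) = (i <= m)%N.
Proof.
apply: filter_forall => m; apply: filter_forall => i.
have [im|mi] := leqP i m.
  have : 0 < delta m i by rewrite delta_sign.
  by move=> h; apply: filterS (cvgr_gt _ (@DD_cvg m i) _ h) => n ->.
have : delta m i < 0.
  by rewrite lt_neqAle delta_neq0 leNgt delta_sign -ltnNge.
move=> h; apply: filterS (cvgr_lt _ (@DD_cvg m i) _ h) => n hn.
by apply/negbTE; rewrite -leNgt ltW.
Qed.

Let z_cvg i : z n i @[n --> \oo] --> zs i.
Proof.
rewrite -[X in _ --> X]addr0 -(mul0r (eta i)).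
by apply: cvgD; [exact: cvg_cst|exact: cvgMl].
Qed.

Let y_cvg v m : tnth (y n v) m @[n --> \oo] --> tnth ys m.
Proof.
have h : tnth ys m + e n * tnth v m @[n --> \oo] --> tnth ys m.
  rewrite -[X in _ --> X]addr0 -(mul0r (tnth v m)).
  by apply: cvgD; [exact: cvg_cst|exact: cvgMl].
by apply: cvg_near_eq (@h); apply: nearW => n; rewrite tnth_mktuple.
Qed.

Let z_lt : \forall n \near \oo, forall i l : 'I_d.+1, (i < l)%N -> z n i < z n l.
Proof.
apply: filter_forall => i; apply: filter_forall => l.
have [il|li] := ltnP i l; last by apply: nearW.
have h : 0 < zs l - zs i by rewrite subr_gt0 zs_lt.
have hh : z n l - z n i @[n --> \oo] --> zs l - zs i by apply: cvgB; exact: z_cvg.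
by apply: filterS (cvgr_gt _ (@hh) _ h) => n /= hn _; rewrite -subr_gt0.
Qed.

Let factorE n v m : (forall i, DD m n i != 0) ->
  (forall i, 0 < 1 + e n * tnth v m / DD m n i) ->
  \prod_(i < d.+1) `|tnth (y n v) m - z n i| `^ (t n * c i - 1) =
  (\prod_(i < d.+1) `|DD m n i| `^ (t n * c i - 1)) * expR (X m n (tnth v m)).
Proof.
move=> D0 pos; rewrite /X /log_profile expR_sum -big_split/=; apply: eq_bigr => i _.
rewrite gapE.
have -> : DD m n i + e n * tnth v m = DD m n i * (1 + e n * tnth v m / DD m n i).
  by field; exact: D0.
rewrite normrM powRM// (gtr0_norm (pos i)); congr (_ * _).
by rewrite /powR gt_eqF.
Qed.

(** Inside its slot, the distance of a coordinate to each node keeps the sign it has at [v = 0], so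
    their ratio is positive. *)
Let slot_pos : \forall n \near \oo, forall v (m : 'I_d), slot (z n) m (tnth (y n v) m) ->
  forall i, 0 < 1 + e n * tnth v m / DD m n i.
Proof.
near=> n.
have D0 : forall m i, DD m n i != 0 by near: n.
have Ds : forall m i, (0 < DD m n i) = (i <= m)%N by near: n.
have zl : forall a b : 'I_d.+1, (a < b)%N -> z n a < z n b by near: n.
move=> v m /andP[h1 h2] i.
have -> : 1 + e n * tnth v m / DD m n i = (tnth (y n v) m - z n i) / DD m n i.
  by rewrite gapE; field; exact: D0.
have [im|mi] := leqP i m.
  rewrite divr_gt0 ?Ds// subr_gt0 (le_lt_trans _ h1)//.
  move: im; rewrite leq_eqVlt => /predU1P[->//|im]; rewrite ltW//.
  by apply: (zl i (widen_ord (leqnSn d) m)).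
rewrite -[X in 0 < X]mulrNN -invrN; apply: divr_gt0.
  rewrite opprB subr_gt0 (lt_le_trans h2)//.
  move: mi; rewrite leq_eqVlt => /predU1P[->//|mi]; rewrite ltW//.
  by apply: (zl (lift ord0 m) i).
by rewrite oppr_gt0 lt_neqAle D0/= leNgt Ds -ltnNge.
Unshelve. all: by end_near. Qed.

Let K0 : \forall n \near \oo, 0 < K n.
Proof.
apply: filterS DD_neq0 => n D0.
by apply: prodr_gt0 => m _; apply: prodr_gt0 => i _; rewrite powR_gt0// normr_gt0.
Qed.

Let A0 : 0 < A.
Proof.
apply: prodr_gt0 => i _; apply: prodr_gt0 => l il; apply: powR_gt0; rewrite subr_gt0.
have /andP[_ h1] := ys_slot i; have /andP[h2 _] := ys_slot l.
rewrite (lt_le_trans h1)// (le_trans _ (ltW h2))//.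
move: il; rewrite leq_eqVlt => /predU1P[->//|il]; rewrite ltW// zs_lt//.
by rewrite ltnS ltnW.
Qed.

Let wE n v : (forall m i, DD m n i != 0) ->
  (forall m i, 0 < 1 + e n * tnth v m / DD m n i) ->
  (forall m : 'I_d, slot (z n) m (tnth (y n v) m)) ->
  w n v = K n * (vandermonde_pow 1 (y n v) * \prod_(m < d) expR (X m n (tnth v m))).
Proof.
move=> D0 pos sl; rewrite /w /row_weight mulrCA; congr (_ * _).
rewrite /K -big_split/=; apply: eq_bigr => m _; rewrite sl factorE//.
Qed.

Let w_cvg v : w n v / K n @[n --> \oo] -->
  A * \prod_(m < d) expR (- row_curv m * tnth v m ^+ 2 / 2 + row_slope m * tnth v m).
Proof.
have H : vandermonde_pow 1 (y n v) * \prod_(m < d) expR (X m n (tnth v m)) @[n --> \oo] -->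
    A * \prod_(m < d) expR (- row_curv m * tnth v m ^+ 2 / 2 + row_slope m * tnth v m).
  apply: cvgM.
    apply: cvg_prodr => i _; apply: cvg_prodr => l il.
    have h : 0 < tnth ys l - tnth ys i.
      rewrite subr_gt0.
      have /andP[_ h1] := ys_slot i; have /andP[h2 _] := ys_slot l.
      rewrite (lt_le_trans h1)// (le_trans _ (ltW h2))//.
      move: il; rewrite leq_eqVlt => /predU1P[->//|il]; rewrite ltW// zs_lt//.
      by rewrite ltnS ltnW.
    rewrite powRr1 ?(ltW h)//.
    have hc : tnth (y n v) l - tnth (y n v) i @[n --> \oo] --> tnth ys l - tnth ys i.
      by apply: cvgB; exact: y_cvg.
    apply: cvg_near_eq (@hc).
    apply: filterS (cvgr_gt _ (@hc) _ h) => n hn.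
    by rewrite powRr1// ltW.
  apply: cvg_prodr => m _; apply: continuous_cvg; first exact: continuous_expR.
  exact: (@log_profile_cvg R d.+1 (fun i => c i) (delta m) (fun i => eta i) (delta_neq0 m)
    (critical m) e t e_cvg e_gt0 tE (tnth v m)).
apply: cvg_near_eq (@H); near=> n.
have D0 : forall m i, DD m n i != 0 by near: n.
have sp : forall v (m : 'I_d), slot (z n) m (tnth (y n v) m) ->
    forall i, 0 < 1 + e n * tnth v m / DD m n i by near: n.
have Kn : 0 < K n by near: n.
have sl : forall m : 'I_d, slot (z n) m (tnth (y n v) m).
  near: n; apply: filter_forall => m.
  have /andP[h1 h2] := ys_slot m.
  rewrite -subr_gt0 in h1; rewrite -subr_gt0 in h2.
  near=> n; rewrite /slot -subr_gt0 -[X in _ && X]subr_gt0; apply/andP; split; near: n.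
    have hh : tnth (y n v) m - z n m @[n --> \oo] --> tnth ys m - zs m.
      by apply: cvgB; [exact: y_cvg|exact: z_cvg].
    exact: cvgr_gt _ (@hh) _ h1.
  have hh : z n m.+1 - tnth (y n v) m @[n --> \oo] --> zs m.+1 - tnth ys m.
    by apply: cvgB; [exact: z_cvg|exact: y_cvg].
  exact: cvgr_gt _ (@hh) _ h2.
rewrite wE//; last by move=> m; exact: sp.
by rewrite mulrAC divff ?mul1r// gt_eqF.
Unshelve. all: by end_near. Qed.

(** Outside the slots the weight is 0. Inside, [log_profile_le] bounds each coordinate, and the
    Vandermonde factor is bounded because the slots lie between nodes that stay bounded. *)
Let w_le : exists C, exists2 kappa, 0 < kappa &
  \forall n \near \oo, forall v,
    w n v <= K n * (C * \prod_(m < d) expR (- (kappa * `|tnth v m|))).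
Proof.
have /choice[Cs /choice[ks hks]] (m : 'I_d) : exists C, exists k, 0 < k /\
    \forall n \near \oo, forall x, (forall i, 0 < 1 + e n * x / DD m n i) ->
    X m n x <= C - k * `|x|.
  have c0' (i : 'I_d.+1) : 0 < c i by exact: c0.
  have [C [k k0 hk]] := @log_profile_le R d.+1 (fun i => c i) (delta m)
    (fun i : 'I_d.+1 => eta i) c0' (delta_neq0 m) (critical m) e t e_cvg e_gt0 tE (ltn0Sn d).
  by exists C, k.
(* One decay rate for all coordinates; starting the minimum from 1 keeps it positive even without
   coordinates. *)
pose kappa := \big[Num.min/1]_(m < d) ks m.
have kappa0 : 0 < kappa.
  rewrite /kappa; elim/big_ind: _ => // [a b a0 b0|m _]; first by rewrite lt_min a0.
  by case: (hks m).
have kappa_le m : kappa <= ks m by exact: bigmin_le_cond.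
(* Half of [L] eventually bounds every node, hence every coordinate in its slot, and [L] bounds
   their differences. *)
pose L := 2 * (1 + \sum_(i < d.+1) (`|zs i| + 1)).
have L1 : 1 <= L.
  have : 0 <= \sum_(i < d.+1) (`|zs i| + 1) by apply: sumr_ge0 => i _; rewrite addr_ge0.
  by rewrite /L; lra.
pose C := (\prod_(i < d) \prod_(l < d | (i < l)%N) L) * \prod_(m < d) expR (Cs m).
exists C, kappa => //.
have zL' : \forall n \near \oo, forall i : 'I_d.+1, `|z n i| <= `|zs i| + 1.
  apply: filter_forall => i.
  have h : `|zs i| < `|zs i| + 1 by rewrite ltrDl.
  have hh : `|z n i| @[n --> \oo] --> `|zs i| by apply: cvg_norm; exact: z_cvg.
  by apply: filterS (cvgr_lt _ (@hh) _ h) => n /ltW.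
near=> n => v.
have D0 : forall m i, DD m n i != 0 by near: n.
have sp : forall v (m : 'I_d), slot (z n) m (tnth (y n v) m) ->
    forall i, 0 < 1 + e n * tnth v m / DD m n i by near: n.
have Kn : 0 < K n by near: n.
have hX : forall m x, (forall i, 0 < 1 + e n * x / DD m n i) -> X m n x <= Cs m - ks m * `|x|.
  by near: n; apply: filter_forall => m; case: (hks m).
have zL : forall i : 'I_d.+1, `|z n i| <= `|zs i| + 1 by near: n.
have [/forallP sl|] := boolP [forall m : 'I_d, slot (z n) m (tnth (y n v) m)]; last first.
  rewrite negb_forall => /existsP[m /negbTE hm].
  rewrite /w /row_weight (bigD1 m)//= hm mul0r mulr0.
  apply: mulr_ge0; first exact: ltW.
  apply: mulr_ge0; last by apply: prodr_ge0 => i _; exact: expR_ge0.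
  apply: mulr_ge0; last by apply: prodr_ge0 => i _; exact: expR_ge0.
  by apply: prodr_ge0 => i _; apply: prodr_ge0 => l _; rewrite (le_trans ler01).
rewrite wE//; last by move=> m; exact: sp.
rewrite ler_pM2l// /C -mulrA; apply: ler_pM.
- by apply: prodr_ge0 => i _; apply: prodr_ge0 => l _; exact: powR_ge0.
- by apply: prodr_ge0 => i _; exact: expR_ge0.
- apply: vandermonde_pow1_le => // i l.
  have zi (a : 'I_d.+1) : `|z n a| <= L / 2.
    rewrite (le_trans (zL a))// /L mulrAC divff// mul1r (bigD1 a)//= addrCA lerDl addr_ge0//.
    by apply: sumr_ge0 => b _; rewrite addr_ge0.
  have yi a : `|tnth (y n v) a| <= L / 2.
    have /andP[h1 h2] := sl a.
    have := zi (widen_ord (leqnSn d) a); have := zi (lift ord0 a).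
    rewrite !ler_norml /= /bump /= add1n => /andP[h3 h4] /andP[h5 h6].
    by apply/andP; split; lra.
  by rewrite (le_trans (ler_normB _ _))//; have := yi i; have := yi l; lra.
rewrite -big_split/=; apply: ler_prod => m _; rewrite expR_ge0/= -expRD ler_expR.
rewrite (le_trans (hX _ _ (sp _ _ (sl m))))// lerD2l lerN2.
by rewrite ler_wpM2r.
Unshelve. all: by end_near. Qed.

Lemma row_weight_cvg (v : d.-tuple R) :
  row_weight c (t n) (z n) (affine_tuple ys (e n) v) /
    fine (\int[lebesgue_tuple d]_u
      (row_weight c (t n) (z n) (affine_tuple ys (e n) u))%:E)%E @[n --> \oo] -->
  \prod_(m < d) normal_pdf (row_slope m / row_curv m) (Num.sqrt (row_curv m))^-1 (tnth v m).
Proof.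
have [C [kappa k0 hw]] := w_le.
apply: (@laplace_row _ _ w K A C kappa) => //.
- move=> n; apply: (@measurable_row_weight _ _ _ _ _ _ (fun=> z n) (y n)) => //.
  exact: measurable_affine_tuple.
- by move=> n u; exact: row_weight_ge0.
- move=> m; apply: (@curv_gt0 _ d.+1 (fun i => c i) (delta m)) => //.
  by move=> i; exact: c0.
Qed.
End row_limit.

(** * The corners process as a forward chain *)

Section corners_factor.
Context {R : realType}.
Variables (M : nat) (alpha theta : R).
Hypothesis M0 : (1 <= M)%N.
Local Notation dim k := (minn k M).
Local Notation row k := ((dim k).-tuple R).

(** Since the nodes increase, one interval per entry already forces the order and the bounds of [v].
    Given [u], the support is thus a product of intervals, as in [row_weight]. *)
Lemma domain_slot k (u : row k) (v : row k.+1) : config01 u ->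
  (config01 v /\ interlace u v) <->
  (forall m : 'I_(dim k.+1), slot (node u) m (tnth v m)).
Proof.
move=> [u01 uinc].
have nodeS (i : nat) (ik : (i < dim k)%N) : node u i.+1 = tnth u (Ordinal ik).
  by rewrite /node/= (tnth_nth 1).
have nodeT (l : 'I_(dim k)) : node u l.+1 = tnth u l by rewrite /node/= (tnth_nth 1).
have nodeD (i : nat) : (dim k <= i)%N -> node u i.+1 = 1.
  by move=> ki; rewrite /node/= nth_default// size_tuple.
split.
  move=> [[v01 vinc] inter] m; apply/andP; split.
    case: m => -[|m] mk; first by case/andP: (v01 (Ordinal mk)).
    rewrite /=; have mk' : (m < dim k)%N by lia.
    by rewrite nodeS; exact: (inter (Ordinal mk) (Ordinal mk')).2.
  have [mk|km] := ltnP m (dim k); last by rewrite nodeD//; case/andP: (v01 m).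
  by rewrite (nodeS _ mk); exact: (inter m (Ordinal mk)).1.
move=> sl.
have node01 i : 0 <= node u i <= 1.
  case: i => [|i]; first by rewrite /node/= lexx ler01.
  have [ik|ki] := ltnP i (dim k); last by rewrite nodeD// ler01 lexx.
  by rewrite (nodeS _ ik) !ltW//; case/andP: (u01 (Ordinal ik)).
have node_le i l : (i <= l)%N -> node u i <= node u l.
  case: i => [|i]; first by case/andP: (node01 l).
  case: l => // l il; have [lk|kl] := ltnP l (dim k); last first.
    by rewrite (nodeD _ kl); case/andP: (node01 i.+1).
  have ik := leq_ltn_trans (il : (i <= l)%N) lk; rewrite (nodeS _ ik) (nodeS _ lk).
  move: il; rewrite leq_eqVlt => /predU1P[il|il].
    by rewrite le_eqVlt; apply/orP; left; apply/eqP; congr tnth; apply/val_inj; case: il.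
  by rewrite ltW// uinc.
split; [split|].
- move=> i; have /andP[h1 h2] := sl i.
  have /andP[h3 _] := node01 i; have /andP[_ h4] := node01 i.+1.
  by rewrite (le_lt_trans h3)// (lt_le_trans h2).
- move=> i l il; have /andP[_ h1] := sl i; have /andP[h2 _] := sl l.
  by rewrite (lt_le_trans h1)// (le_trans (node_le _ _ il))// ltW.
- move=> i l; have /andP[h1 h2] := sl i; split => il.
    by move: h2; rewrite il nodeT.
  by move: h1; rewrite il nodeT.
Qed.

Definition gamma_factor k : R :=
  if (k < M)%N then Gamma (k.+1%:R * theta) / Gamma theta ^+ k.+1
  else Gamma (k.+1%:R * theta) / (Gamma theta ^+ M * Gamma (k.+1%:R * theta - M%:R * theta)).

Definition side_factor k (u : row k) : R :=
  \1_[set z | config01 z] u * (vandermonde_pow 1 u *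
  \prod_(i < dim k) ((if (k < M)%N then 1 else (1 - tnth u i) `^ (theta * (k.+1%:R - M%:R) - 1)) *
    tnth u i `^ (- (k.+1%:R * theta)))).

(** The support condition is built in as an indicator. The given transition densities start from row
    2; the transition to the empty row 0 is the constant 1. *)
Definition backward_kernel k (v : row k.+1) (u : row k) : R :=
  if k == 0%N then 1
  else \1_[set z : row k.+1 * row k | config01 z.2 /\ interlace z.2 z.1] (v, u) *
    backward_density theta v (u : (minn k.+1.-1 M).-tuple R).

Definition forward_weight k (u : row k) (v : row k.+1) : R :=
  row_weight (node_charge alpha M k) theta (node u) v.

Lemma prod_nodes k (u : row k) (y : R) : config01 u -> 0 < y < 1 ->
  \prod_(i < (dim k.+1).+1) `|y - node u i| `^ (theta * node_charge alpha M k i - 1) =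
  y `^ (theta * (alpha + k%:R) - 1) *
  (\prod_(i < dim k) `|y - tnth u i| `^ (theta - 1)) *
  (if (k < M)%N then (1 - y) `^ (theta * (M%:R - k%:R) - 1) else 1).
Proof.
move=> _ /andP[y0 y1].
rewrite big_ord_recl {1}/node /= subr0 gtr0_norm// {1}/node_charge/= -mulrA; congr (_ * _).
have E (i : 'I_(dim k)) : `|y - node u i.+1| `^ (theta * node_charge alpha M k i.+1 - 1) =
    `|y - tnth u i| `^ (theta - 1).
  rewrite /node/= -tnth_nth /node_charge/= eqSS ltn_eqF ?mulr1//.
  by rewrite (leq_trans (ltn_ord i)) ?geq_minl.
have [kM|] := boolP (k < M)%N; last rewrite -leqNgt => Mk.
  have Ek : dim k.+1 = (dim k).+1 by rewrite (minn_idPl kM) (minn_idPl (ltnW kM)).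
  rewrite Ek big_ord_recr/=; congr (_ * _).
    by apply: eq_bigr => i _; rewrite -E.
  rewrite /node/= nth_default ?size_tuple//.
  rewrite (_ : bump 0 (dim k) = k.+1); last by rewrite /bump add1n (minn_idPl (ltnW kM)).
  by rewrite /node_charge/= eqxx distrC gtr0_norm// subr_gt0.
have Ek : dim k.+1 = dim k by rewrite (minn_idPr Mk) (minn_idPr (leqW Mk)).
rewrite Ek mulr1; apply: eq_bigr => i _; by rewrite -E.
Qed.

Lemma vandermonde_powD n (s t : R) (v : n.-tuple R) : config01 v ->
  vandermonde_pow s v * vandermonde_pow t v = vandermonde_pow (s + t) v.
Proof.
move=> [_ inc]; rewrite /vandermonde_pow -big_split/=; apply: eq_bigr => i _.
rewrite -big_split/=; apply: eq_bigr => l il.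
have a0 : 0 < tnth v l - tnth v i by rewrite subr_gt0 inc.
by rewrite -powRD// (gt_eqF a0) implybT.
Qed.

(** Exponents are collected factor by factor: [2 theta] and [1 - 2 theta] on the Vandermonde of [v]
    add up to 1, the powers of [v] to [theta * (alpha + k) - 1], and those of [1 - v] to
    [theta * (M - k) - 1] below [M] and to 0 from [M] on. *)
Lemma corners_factor (c : R) k (u : row k) (v : row k.+1) :
  (\1_[set z | config01 z] v * (c * jacobi_ensemble alpha theta v)) *
    backward_kernel v u =
  (c * (if k == 0%N then 1 else gamma_factor k)) * forward_weight u v * side_factor u.
Proof.
have [u01|u01] := pselect (config01 u); last first.
  rewrite /side_factor (_ : \1_ _ u = 0) ?mul0r ?mulr0; last first.
    by rewrite indicE memNset.
  rewrite /backward_kernel; case: eqP => k0; last first.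
    by rewrite (_ : \1_ _ (v, u) = 0) ?mul0r ?mulr0// indicE memNset//= => -[].
  exfalso; apply: u01; split => i; exfalso; case: i; by rewrite k0 min0n.
rewrite /side_factor (_ : \1_ _ u = 1) ?mul1r; last by rewrite indicE mem_set.
have [vu|vu] := pselect (config01 v /\ interlace u v); last first.
  rewrite /forward_weight /row_weight.
  have [m hm] : exists m : 'I_(dim k.+1), slot (node u) m (tnth v m) = false.
    apply: contrapT => hn; apply: vu; apply/domain_slot => // m.
    by apply: contrapT => /negP/negbTE hm; apply: hn; exists m.
  rewrite (bigD1 m)//= hm mul0r !mulr0 mul0r.
  have [v01|v01] := pselect (config01 v); last first.
    by rewrite (_ : \1_ _ v = 0) ?mul0r// indicE memNset.
  rewrite /backward_kernel; case: eqP => k0.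
    by exfalso; apply: vu; split => // i l; exfalso; case: l; rewrite k0 min0n.
  rewrite [X in _ * (X * _)](_ : _ = 0) ?mul0r ?mulr0// indicE memNset//= => -[_ ?].
  by apply: vu; split.
have [v01 inter] := vu.
have sl : forall m : 'I_(dim k.+1), slot (node u) m (tnth v m).
  by have [h _] := domain_slot v u01; exact: h.
rewrite (_ : \1_ _ v = 1) ?mul1r; last by rewrite indicE mem_set.
pose Y s := \prod_(m < dim k.+1) tnth v m `^ s.
pose Z s := \prod_(m < dim k.+1) (1 - tnth v m) `^ s.
pose X := \prod_(m < dim k.+1) \prod_(i < dim k) `|tnth v m - tnth u i| `^ (theta - 1).
have YD s t : Y s * Y t = Y (s + t).
  rewrite /Y -big_split/=; apply: eq_bigr => m _.
  have a0 : 0 < tnth v m by case/andP: (v01.1 m).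
  by rewrite -powRD// (gt_eqF a0) implybT.
have ZD s t : Z s * Z t = Z (s + t).
  rewrite /Z -big_split/=; apply: eq_bigr => m _.
  have a0 : 0 < 1 - tnth v m by rewrite subr_gt0; case/andP: (v01.1 m).
  by rewrite -powRD// (gt_eqF a0) implybT.
have FE : forward_weight u v = vandermonde_pow 1 v * (Y (theta * (alpha + k%:R) - 1) * X *
    (if (k < M)%N then Z (theta * (M%:R - k%:R) - 1) else 1)).
  rewrite /forward_weight /row_weight; congr (_ * _).
  rewrite (eq_bigr (fun m => tnth v m `^ (theta * (alpha + k%:R) - 1) *
    (\prod_(i < dim k) `|tnth v m - tnth u i| `^ (theta - 1)) *
    (if (k < M)%N then (1 - tnth v m) `^ (theta * (M%:R - k%:R) - 1) else 1))) => [|m _].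
    rewrite !big_split/=; congr (_ * _).
    by case: ifP => // _; rewrite big1.
  by rewrite sl prod_nodes//; exact: v01.1.
have JE : jacobi_ensemble alpha theta v = vandermonde_pow (2 * theta) v *
    (Y (theta * alpha - 1) * Z (theta * `|M%:R - k.+1%:R| + theta - 1)).
  by rewrite /jacobi_ensemble big_split.
(* Row 0 is empty and row 1 has one entry, so only powers of [v] and [1 - v] remain. *)
rewrite FE JE /backward_kernel; have [k0|k0] := eqVneq k 0%N.
  have kM : (k < M)%N by rewrite k0.
  have vdm1 n (s : R) (z : n.-tuple R) : (n <= 1)%N -> vandermonde_pow s z = 1.
    move=> n1; rewrite /vandermonde_pow big1// => i _; rewrite big1// => l il.
    by have := ltn_ord l; have := leq_ltn_trans (leq0n i) il; lia.
  rewrite !vdm1 ?kM; [|lia|lia|lia].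
  rewrite /X big1 => [|m _]; last by rewrite big1// => i _; exfalso; case: i; rewrite k0 min0n.
  rewrite [X in _ = _ * (1 * X)]big1; last by move=> i _; exfalso; case: i; rewrite k0 min0n.
  rewrite !mulr1 !mul1r; congr (_ * (Y _ * Z _)); first by rewrite k0 addr0.
  rewrite k0 subr0 ger0_norm ?subr_ge0 ?ler1n//; ring.
rewrite (_ : \1_ _ (v, u) = 1) ?mul1r; last by rewrite indicE mem_set.
have XE : \prod_i \prod_j `|tnth v j - tnth u i| `^ (theta - 1) = X by rewrite exchange_big.
have <- : vandermonde_pow (2 * theta) v * vandermonde_pow (1 - 2 * theta) v = vandermonde_pow 1 v.
  by rewrite vandermonde_powD//; congr (vandermonde_pow _ v); ring.
have <- : Y (theta * alpha - 1) * Y ((k.+1%:R - 1) * theta) = Y (theta * (alpha + k%:R) - 1).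
  by rewrite YD -natr1; congr Y; ring.
rewrite /backward_density /gamma_factor; have [kM|] := boolP (k < M)%N; last rewrite -leqNgt => Mk.
  have <- : Z (theta * `|M%:R - k.+1%:R| + theta - 1) = Z (theta * (M%:R - k%:R) - 1).
    congr Z; rewrite ger0_norm ?subr_ge0 ?ler_nat//; by rewrite -natr1; ring.
  under [in RHS]eq_bigr do rewrite mul1r.
  rewrite XE /Y; ring.
rewrite !big_split/= XE -/(Y _) -/(Z _).
have ZZ : Z (theta * `|M%:R - k.+1%:R| + theta - 1) * Z (theta * (M%:R - k.+1%:R - 1) + 1) = 1.
  rewrite ZD ler0_norm ?subr_le0 ?ler_nat ?leqW// /Z big1// => m _.
  by rewrite [X in _ `^ X](_ : _ = 0) ?powRr0//; ring.
rewrite -[X in _ = X](mulr1) -[X in _ = _ * X]ZZ.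
ring.
Qed.
End corners_factor.

(** * Measurability and sign of the density factors *)

Section measurable_factors.
Context {R : realType}.

Lemma measurable_forall_ord dT (T : measurableType dT) n (Q : 'I_n -> T -> Prop) :
  (forall i, measurable [set x | Q i x]) -> measurable [set x | forall i, Q i x].
Proof.
move=> mQ; rewrite (_ : [set x | _] = \bigcap_(i in [set: 'I_n]) [set x | Q i x]).
  by apply: fin_bigcap_measurable => //.
by apply/seteqP; split => x /= h i; [move=> _; exact: h|exact: h].
Qed.

Lemma measurable_lt_fun dT (T : measurableType dT) (f g : T -> R) :
  measurable_fun setT f -> measurable_fun setT g -> measurable [set x | f x < g x].
Proof.
move=> mf mg; have h := measurable_fun_ltr mf mg.
by have := h measurableT [set true] I; rewrite setTI.
Qed.

Lemma measurable_implies dT (T : measurableType dT) (Q : Prop) (B : set T) :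
  (Q -> measurable B) -> measurable [set x | Q -> B x].
Proof.
move=> mB; have [q|nq] := pselect Q.
  by rewrite (_ : [set x | _] = B); [exact: mB|apply/seteqP; split => x /=; tauto].
by rewrite (_ : [set x | _] = setT)//; apply/seteqP; split => x /=; tauto.
Qed.

Lemma measurable_and_set dT (T : measurableType dT) (B C : set T) :
  measurable B -> measurable C -> measurable [set x | B x /\ C x].
Proof. exact: measurableI. Qed.

Lemma measurable_config01 n : measurable [set z : n.-tuple R | config01 z].
Proof.
apply: measurable_and_set; apply: measurable_forall_ord => i.
  rewrite (_ : [set x | _] = [set x : n.-tuple R | 0 < tnth x i /\ tnth x i < 1]); last first.
    by apply/seteqP; split => x /= => [/andP|[? ?]]; [|apply/andP].
  by apply: measurable_and_set; apply: measurable_lt_fun => //; exact: measurable_tnth.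
apply: measurable_forall_ord => l; apply: measurable_implies => _.
by apply: measurable_lt_fun; exact: measurable_tnth.
Qed.

Lemma measurable_interlace k l : measurable
  [set z : l.-tuple R * k.-tuple R | config01 z.2 /\ interlace z.2 z.1].
Proof.
have m1 i : measurable_fun setT (fun z : l.-tuple R * k.-tuple R => tnth z.1 i).
  exact: measurableT_comp (measurable_tnth i) (@measurable_fst _ _ _ _).
have m2 i : measurable_fun setT (fun z : l.-tuple R * k.-tuple R => tnth z.2 i).
  exact: measurableT_comp (measurable_tnth i) (@measurable_snd _ _ _ _).
apply: measurable_and_set.
  have ms : measurable_fun setT (@snd (l.-tuple R) (k.-tuple R)) by exact: measurable_snd.
  have h := ms measurableT _ (@measurable_config01 k); rewrite setTI in h; exact: h.
apply: measurable_forall_ord => i; apply: measurable_forall_ord => j.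
apply: measurable_and_set; apply: measurable_implies => _; exact: measurable_lt_fun.
Qed.

Lemma measurable_jacobi_ensemble (alpha theta : R) M N :
  measurable_fun setT (@jacobi_ensemble R alpha theta M N).
Proof.
apply: measurable_funM; first exact: measurable_vandermonde_pow.
apply: measurable_prod => i _; apply: measurable_funM.
  exact: measurableT_comp (measurable_powR _) (measurable_tnth i).
apply: (measurableT_comp (measurable_powR _)).
by apply: measurable_funB => //; exact: measurable_tnth.
Qed.

Lemma measurable_backward_density (theta : R) M N : measurable_fun setT
  (fun z : (minn N M).-tuple R * (minn N.-1 M).-tuple R => backward_density theta z.1 z.2).
Proof.
pose T := ((minn N M).-tuple R * (minn N.-1 M).-tuple R)%type.
have m1 i : measurable_fun setT (fun z : T => tnth z.1 i).
  exact: measurableT_comp (measurable_tnth i) (@measurable_fst _ _ _ _).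
have m2 i : measurable_fun setT (fun z : T => tnth z.2 i).
  exact: measurableT_comp (measurable_tnth i) (@measurable_snd _ _ _ _).
have mp (f : T -> R) s : measurable_fun setT f -> measurable_fun setT (fun z => f z `^ s).
  exact: (measurableT_comp (measurable_powR s)).
have mv1 s : measurable_fun setT (fun z : T => vandermonde_pow s z.1).
  exact: measurableT_comp (measurable_vandermonde_pow s) (@measurable_fst _ _ _ _).
have mv2 s : measurable_fun setT (fun z : T => vandermonde_pow s z.2).
  exact: measurableT_comp (measurable_vandermonde_pow s) (@measurable_snd _ _ _ _).
have mx : measurable_fun setT
    (fun z : T => \prod_i \prod_j `|tnth z.1 j - tnth z.2 i| `^ (theta - 1)).
  apply: measurable_prod => i _; apply: measurable_prod => l _; apply: mp.
  by apply: measurableT_comp => //; exact: measurable_funB.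
rewrite /backward_density; case: (boolP (N <= M)%N) => _.
  apply: measurable_funM; last first.
    by apply: measurable_prod => i _; exact: mp.
  apply: measurable_funM => //; apply: measurable_funM => //; apply: measurable_funM => //.
  apply: measurable_funM => //.
  by apply: measurable_prod => i _; exact: mp.
apply: measurable_funM; last first.
  apply: measurable_prod => i _; apply: measurable_funM; last exact: mp.
  by apply: mp; exact: measurable_funB.
apply: measurable_funM => //; apply: measurable_funM.
  by apply: measurable_funM => //; exact: measurable_funM.
apply: measurable_prod => i _; apply: measurable_funM; first exact: mp.
by apply: mp; exact: measurable_funB.
Qed.

Lemma Gamma_ge0 (s : R) : 0 <= Gamma s.
Proof. by apply: Rintegral_ge0 => t _; rewrite mulr_ge0 ?powR_ge0 ?expR_ge0. Qed.

Lemma vandermonde_pow_ge0 n (s : R) (z : n.-tuple R) : 0 <= vandermonde_pow s z.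
Proof. by apply: prodr_ge0 => i _; apply: prodr_ge0 => l _; exact: powR_ge0. Qed.

Lemma jacobi_ensemble_ge0 (alpha theta : R) M N (z : (minn N M).-tuple R) :
  0 <= jacobi_ensemble alpha theta z.
Proof.
apply: mulr_ge0; first exact: vandermonde_pow_ge0.
by apply: prodr_ge0 => i _; rewrite mulr_ge0 ?powR_ge0.
Qed.

Lemma backward_density_ge0 (theta : R) M N (y : (minn N M).-tuple R) z :
  0 <= backward_density theta y z.
Proof.
have G := Gamma_ge0.
rewrite /backward_density; case: ifP => _.
  by repeat (apply: mulr_ge0); rewrite ?vandermonde_pow_ge0 ?G ?invr_ge0 ?exprn_ge0//;
    apply: prodr_ge0 => i _; rewrite ?powR_ge0//; apply: prodr_ge0 => l _; rewrite ?powR_ge0.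
apply: mulr_ge0; last by apply: prodr_ge0 => i _; rewrite mulr_ge0 ?powR_ge0.
apply: mulr_ge0; last by apply: prodr_ge0 => i _; apply: prodr_ge0 => l _; exact: powR_ge0.
apply: mulr_ge0; last by apply: prodr_ge0 => i _; rewrite mulr_ge0 ?powR_ge0.
by rewrite mulr_ge0 ?mulr_ge0 ?vandermonde_pow_ge0 ?invr_ge0 ?mulr_ge0 ?exprn_ge0.
Qed.

Lemma measurable_node k i : measurable_fun setT (fun u : k.-tuple R => node u i).
Proof.
case: i => [|i]; first exact: measurable_cst.
have [ik|ki] := ltnP i k.
  rewrite (_ : (fun _ => _) = fun u : k.-tuple R => tnth u (Ordinal ik)).
    exact: measurable_tnth.
  by apply/funext => u; rewrite (tnth_nth 1).
rewrite (_ : (fun _ => _) = cst 1); first exact: measurable_cst.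
by apply/funext => u; rewrite /node/= nth_default// size_tuple.
Qed.
End measurable_factors.

Section corners_law.
Context {R : realType}.
Variables (M : nat) (alpha theta : R).
Hypothesis M0 : (1 <= M)%N.
Hypothesis charge1 : forall k i, (i < (minn k.+1 M).+1)%N ->
  1 <= theta * node_charge alpha M k i.
Local Notation dim := (fun k => minn k M).
Context d (T : measurableType d) (P : probability T R)
  (x : forall N, {RV P >-> (minn N M).-tuple R}).
Hypothesis hx : jacobi_corners alpha theta x.

Let S k := upper_rows_sigma (fun L => x L : T -> _) k.

Let mx k : measurable_fun setT (x k : T -> (minn k M).-tuple R).
Proof. exact: measurable_funPT. Qed.

Let S_T k : S k setT.
Proof.
have [h0 hC _] : sigma_algebra setT (S k) by exact: smallest_sigma_algebra.
by rewrite -[setT]setD0; exact: hC.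
Qed.

Let S_gen k L (A : set ((minn L M).-tuple R)) : (k <= L)%N -> measurable A ->
  S k (x L @^-1` A).
Proof.
move=> kL mA; apply: sub_gen_smallest; exists L => //.
by exists A => //; rewrite setTI.
Qed.

Let S_sub k B : S k.+1 B -> S k B.
Proof.
apply: sub_smallest2r; first exact: smallest_sigma_algebra.
by move=> C [L /= kL CL]; exists L => //=; exact: ltnW.
Qed.

Let S_I k B (A : set ((minn k M).-tuple R)) : S k.+1 B -> measurable A ->
  S k (B `&` x k @^-1` A).
Proof.
move=> SB mA.
exact: (@measurableI _ (g_sigma_algebraType (\bigcup_(L in [set L | (k <= L)%N])
  preimage_set_system setT (x L : T -> _) measurable)) B _ (S_sub SB) (S_gen _ mA)).
Qed.

Let mS k B : S k B -> measurable B.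
Proof.
apply: smallest_sub; first exact: sigma_algebra_measurable.
move=> C [L /= kL [A mA <-]]; exact: mx.
Qed.

(** Applies the abstract reversal to the rows: [corners_factor] supplies the factorization,
    [charge1] the integrability of the weights, and row 0, being empty, is constant. *)
Lemma corners_forward_law N (g : array dim N -> \bar R) :
  measurable_fun setT g -> (forall e, 0 <= g e)%E ->
  (\int[P]_t g (array_map (dim := dim) x N t) =
   \int[array_measure dim N]_e
     (g e * (array_density (forward_density dim (@forward_weight R M alpha theta)) e)%:E))%E.
Proof.
move=> mg g0.
have [_ marg back] := hx.
have /choice[c hc] k : exists c : R, 0 < c /\ forall B, measurable B ->
    P (x k.+1 @^-1` B) = (\int[lebesgue_tuple (minn k.+1 M)]_(z in B `&` [set z | config01 z])
             (c * jacobi_ensemble alpha theta z)%:E)%E.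
  by have [c c0 h] := marg k.+1 isT; exists c.
have int_indic n (B D : set (n.-tuple R)) (f : n.-tuple R -> R) :
    (\int[lebesgue_tuple n]_(z in B `&` D) (f z)%:E =
     \int[lebesgue_tuple n]_(z in B) (\1_D z * f z)%:E)%E.
  rewrite integral_mkcond [RHS]integral_mkcond; apply: eq_integral => z _.
  rewrite !patchE in_setI indicE.
  by case: (z \in B); case: (z \in D); rewrite ?mul1r ?mul0r.
have gf0 k : 0 <= gamma_factor M theta k.
  have G := @Gamma_ge0 R.
  by rewrite /gamma_factor; case: ifP => _; rewrite ?divr_ge0 ?mulr_ge0 ?exprn_ge0.
have mside k : measurable_fun setT (@side_factor R M theta k).
  apply: measurable_funM; first by apply: measurable_indic; exact: measurable_config01.
  apply: measurable_funM; first exact: measurable_vandermonde_pow.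
  apply: measurable_prod => i _; apply: measurable_funM; last first.
    exact: measurableT_comp (measurable_powR _) (measurable_tnth i).
  case: (boolP (k < M)%N) => // _; apply: (measurableT_comp (measurable_powR _)).
  by apply: measurable_funB => //; exact: measurable_tnth.
have dim0 : minn 0 M = 0%N by rewrite min0n.
pose v0 : (minn 0 M).-tuple R := [tuple 0 | i < minn 0 M].
have x0E t : x 0 t = v0 by exact: tuple_dim0_eq.
have leb0 (A : set ((minn 0 M).-tuple R)) : measurable A ->
    (\int[lebesgue_tuple (minn 0 M)]_(u in A) 1 = (\1_A v0)%:E)%E.
  move=> mA; rewrite integral_mkcond (integral_tuple_dim0 v0)//.
    by rewrite patchE indicE; case: (v0 \in A).
  by apply/(measurable_restrictT _ _).1.
apply: (@forward_law_integral R dim d T P x S (@backward_kernel R M theta)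
  (fun k v => \1_[set z | config01 z] v * (c k * jacobi_ensemble alpha theta v))
  (@forward_weight R M alpha theta) (@side_factor R M theta)
  (fun k => c k * (if k == 0%N then 1 else gamma_factor M theta k))) => //.
- move=> k v u; rewrite /backward_kernel; case: ifP => // _.
  by rewrite mulr_ge0 ?backward_density_ge0.
- move=> k; rewrite /backward_kernel; case: (boolP (k == 0%N)) => // _; apply: measurable_funM.
    rewrite (_ : (fun z => _) = \1_[set z : (minn k.+1 M).-tuple R * (minn k M).-tuple R |
      config01 z.2 /\ interlace z.2 z.1]); last by apply/funext => -[].
    by apply: measurable_indic; exact: measurable_interlace.
  exact: (@measurable_backward_density R theta M k.+1).
- move=> k B A SB mA.
  case: k A SB mA => [|k] A SB mA.
    transitivity (\int[P]_(t in B) (\1_A v0)%:E)%E; last first.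
      by apply: eq_integral => t _; rewrite -leb0.
    rewrite integral_cst ?indicE; last exact: mS SB.
    have [Av|Av] := boolP (v0 \in A).
      rewrite (_ : x 0 @^-1` A = setT) ?setIT ?mul1e//.
      by apply/seteqP; split => // t _ /=; rewrite (x0E t); exact: set_mem.
    rewrite (_ : x 0 @^-1` A = set0) ?setI0 ?measure0 ?mul0e//.
    by apply/seteqP; split => // t /=; rewrite (x0E t) => /mem_set; rewrite (negbTE Av).
  rewrite (back k.+2 isT B A SB mA); apply: eq_integral => t _.
  rewrite int_indic; apply: eq_integral => u _.
  by rewrite /backward_kernel.
- move=> k v; apply: mulr_ge0 => //; apply: mulr_ge0; last exact: jacobi_ensemble_ge0.
  by case: (hc k) => /ltW.
- move=> k; apply: measurable_funM; first by apply: measurable_indic; exact: measurable_config01.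
  by apply: measurable_funM => //; exact: measurable_jacobi_ensemble.
- by move=> k A mA; rewrite (hc k).2// int_indic.
- move=> A mA; rewrite leb0// indicE; have [Av|Av] := boolP (v0 \in A).
    rewrite (_ : x 0 @^-1` A = setT) ?probability_setT//.
    by apply/seteqP; split => // t _ /=; rewrite (x0E t); exact: set_mem.
  rewrite (_ : x 0 @^-1` A = set0) ?measure0//.
  by apply/seteqP; split => // t /=; rewrite (x0E t) => /mem_set; rewrite (negbTE Av).
- by move=> k u v; exact: row_weight_ge0.
- move=> k; apply: measurable_row_weight => //.
  by move=> i; exact: measurableT_comp (measurable_node i) (@measurable_fst _ _ _ _).
- move=> k u; apply: mulr_ge0 => //; apply: mulr_ge0; first exact: vandermonde_pow_ge0.
  by apply: prodr_ge0 => i _; rewrite mulr_ge0 ?powR_ge0//; case: ifP => // _; rewrite powR_ge0.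
- by move=> k; rewrite mulr_ge0//; [apply: ltW; case: (hc k)|case: ifP].
- by move=> k u v; exact: corners_factor.
- by move=> k u; apply: row_weight_integrable => i ik; exact: charge1.
Qed.
End corners_law.

(** * Rescaling and passage to the limit *)

Section array_affine.
Context {R : realType}.
Variable dim : nat -> nat.
Local Notation row k := ((dim k).-tuple R).
Local Open Scope ereal_scope.

Fixpoint array_affine (b : forall k, row k) (a : R) (N : nat) : array dim N -> array dim N :=
  match N return array dim N -> array dim N with
  | 0 => affine_tuple (b 0%N) a
  | N'.+1 => fun e => (array_affine b a e.1, affine_tuple (b N'.+1) a e.2)
  end.

Lemma measurable_array_affine b a N : measurable_fun setT (@array_affine b a N).
Proof.
elim: N => [|N IH]; first exact: measurable_affine_tuple.
apply: measurable_fun_pair; first exact: measurableT_comp IH (@measurable_fst _ _ _ _).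
exact: measurableT_comp (measurable_affine_tuple _ _) (@measurable_snd _ _ _ _).
Qed.

Lemma array_affine_map (T : Type) (x : forall k, T -> row k) b a N t :
  array_map (fun k t => affine_tuple (b k) a (x k t)) N t = array_affine b a (array_map x N t).
Proof. by elim: N => //= N ->. Qed.

Lemma last_row_affine b a N (e : array dim N) :
  last_row (array_affine b a e) = affine_tuple (b N) a (last_row e).
Proof. by case: N e. Qed.

Hypothesis dim0 : dim 0 = 0%N.

Lemma integral_array_affine b a N (f : array dim N -> \bar R) : (0 < a)%R ->
  measurable_fun setT f -> (forall e, 0 <= f e) ->
  \int[array_measure dim N]_e f e =
  (a ^+ offset dim N)%:E * \int[array_measure dim N]_e f (array_affine b a e).
Proof.
move=> a0; elim: N f => [|N IH] f mf f0.
  rewrite expr0 mul1e.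
  have := @integral_affine_tuple R (dim 0) (b 0%N) a f a0 mf f0.
  by rewrite (_ : a ^+ dim 0 = 1)%R ?mul1e// dim0.
have mA := @measurable_array_affine b a N.
have mA' := @measurable_array_affine b a N.+1.
transitivity (\int[array_measure dim N \x lebesgue_tuple (dim N.+1)]_e f e); first by [].
rewrite (fubini_tonelli1 _ mf)// /fubini_F.
have mF : measurable_fun setT (fun e => \int[lebesgue_tuple (dim N.+1)]_v f (e, v)).
  exact: measurable_integral_snd.
rewrite [LHS]IH//; last by move=> e; exact: integral_ge0.
rewrite /= exprD EFinM -muleA; congr (_ * _).
transitivity ((a ^+ dim N.+1)%:E *
  \int[array_measure dim N \x lebesgue_tuple (dim N.+1)]_e f (array_affine b a (e : array dim N.+1))); last by [].
have mfA : measurable_fun setT (f \o @array_affine b a N.+1).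
  exact: measurableT_comp mf mA'.
rewrite (fubini_tonelli1 _ mfA); last by move=> e; exact: f0.
rewrite -ge0_integralZl//; last 3 first.
- exact: (@measurable_integral_snd R _ _ _ _ (lebesgue_tuple (dim N.+1)) _ mfA (fun e => f0 _)).
- by move=> e _; apply: integral_ge0 => v _; exact: f0.
- by rewrite lee_fin exprn_ge0// ltW.
apply: eq_integral => e _.
have mfe : measurable_fun setT (fun v => f (array_affine b a e, v)).
  by apply: measurableT_comp mf _; exact: measurable_fun_pair.
exact: (@integral_affine_tuple R (dim N.+1) (b N.+1) a _ a0 mfe).
Qed.

(** The Jacobian comes from the substitution in the normalizing integral. *)
Lemma forward_density_affine (w : forall k, row k -> row k.+1 -> R) b a k u v :
  (0 < a)%R -> (forall v, 0 <= w k (affine_tuple (b k) a u) v)%R ->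
  measurable_fun setT (w k (affine_tuple (b k) a u)) ->
  (forward_density dim w k (affine_tuple (b k) a u) (affine_tuple (b k.+1) a v) * a ^+ dim k.+1 =
   forward_density dim (fun k u v => w k (affine_tuple (b k) a u) (affine_tuple (b k.+1) a v))
     k u v)%R.
Proof.
move=> a0 w0 mw; rewrite /forward_density.
have an0 : (a ^+ dim k.+1 != 0)%R by rewrite gt_eqF// exprn_gt0.
have /= -> := @integral_affine_tuple R (dim k.+1) (b k.+1) a
  (fun v => (w k (affine_tuple (b k) a u) v)%:E) a0; last 2 first.
- exact/measurable_EFinP.
- by move=> z; rewrite lee_fin.
set Z := \int[_]_x _.
have -> : (fine ((a ^+ dim k.+1)%:E * Z) = a ^+ dim k.+1 * fine Z)%R.
  case: Z => [r| |]//=.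
    by rewrite gt0_muley ?lte_fin ?exprn_gt0//= mulr0.
  by rewrite gt0_muleNy ?lte_fin ?exprn_gt0//= mulr0.
by rewrite invfM mulrAC mulrA mulfK.
Qed.

Lemma array_density_affine (w : forall k, row k -> row k.+1 -> R) b a N (e : array dim N) :
  (0 < a)%R -> (forall k u v, 0 <= w k u v)%R ->
  (forall k u, measurable_fun setT (w k u)) ->
  (array_density (forward_density dim w) (array_affine b a e) * a ^+ offset dim N =
   array_density (forward_density dim
     (fun k u v => w k (affine_tuple (b k) a u) (affine_tuple (b k.+1) a v))) e)%R.
Proof.
move=> a0 w0 mw; elim: N e => [|N IH] e; first by rewrite /= mulr1.
rewrite /= last_row_affine exprD mulrACA -forward_density_affine//.
by rewrite -IH.
Qed.

Lemma affine_tupleK k (b : k.-tuple R) (a : R) : a != 0%R ->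
  cancel (affine_tuple b a) (affine_tuple [tuple (- a^-1 * tnth b i)%R | i < k] a^-1).
Proof.
move=> a0 v; apply: eq_from_tnth => i; rewrite !tnth_mktuple.
by rewrite mulrDr mulrA mulVf// mul1r mulNr addKr.
Qed.

Lemma array_affineK b a N : a != 0%R ->
  cancel (@array_affine b a^-1 N)
    (@array_affine (fun k => [tuple (- a * tnth (b k) i)%R | i < dim k]) a N).
Proof.
move=> a0; have a'0 : (a^-1 != 0)%R by rewrite invr_eq0.
elim: N => [|N IH] e.
  by have := affine_tupleK (b 0%N) a'0 e; rewrite /= invrK.
case: e => e v /=; rewrite IH; congr pair.
by have := affine_tupleK (b N.+1) a'0 v; rewrite /= invrK.
Qed.

End array_affine.

Section expectation_bounded.
Context {R : realType}.

(* Markov's inequality for [min(1, |X|/(m+1))] replaces a tightness argument. *)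
Lemma cvg_in_probability_scaled (d : R -> measure_display)
    (T : forall theta, measurableType (d theta))
    (P : forall theta, probability (T theta) R)
    (Y : forall theta, T theta -> R) (c : R) d' (T' : measurableType d')
    (P' : probability T' R) (xi : T' -> R) :
  (forall theta, measurable_fun setT (Y theta)) -> measurable_fun setT xi ->
  (forall f : R -> R, continuous f -> (forall v, `|f v| <= 1) ->
    (\int[P theta]_w (f (Num.sqrt theta * (Y theta w - c)))%:E)%E @[theta --> +oo] -->
    (\int[P']_w (f (xi w))%:E)%E) ->
  cvg_in_probability P Y c.
Proof.
move=> mY mxi hcv eps eps0.
pose f (m : nat) (v : R) : R := Num.min 1 (`|v| / m.+1%:R).
have cf m : continuous (f m).
  move=> v; apply: (@continuous_min _ _ (cst 1) (fun v : R => `|v| / m.+1%:R) v).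
    exact: cvg_cst.
  by apply: cvgMl; exact: norm_continuous.
have f0 m v : 0 <= f m v by rewrite le_min ler01 divr_ge0.
have f1 m v : f m v <= 1 by rewrite ge_min lexx.
have fb m v : `|f m v| <= 1 by rewrite ger0_norm.
have mf m : measurable_fun setT (f m) by apply: continuous_measurable_fun.
have lim0 : (\int[P']_w (f m (xi w))%:E)%E @[m --> \oo] --> 0%E.
  rewrite (_ : 0%E = (\int[P']_w (cst 0 w))%E); last by rewrite integral0.
  apply: (dominated_cvg _ _ _ (g := cst 1%E)) => //.
  - by move=> m; apply/measurable_EFinP; exact: measurableT_comp (mf m) mxi.
  - move=> w _; apply/cvg_EFin; first exact: nearW.
    apply: (@squeeze_cvgr _ _ _ _ (fun=> 0) (fun m => `|xi w| * m.+1%:R^-1)).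
    + by apply: nearW => m /=; rewrite f0 /f ge_min lexx orbT.
    + exact: cvg_cst.
    + rewrite -[X in _ --> X](mulr0 `|xi w|); apply: cvgMr.
      exact: cvg_harmonic.
  - exact: finite_measure_integrable_cst.
  - by move=> m w _; rewrite /= lee_fin fb.
have mA t : measurable [set w | eps < `|Y t w - c|].
  rewrite (_ : [set w | _] = (fun w => `|Y t w - c|) @^-1` `]eps, +oo[); last first.
    by apply/seteqP; split => w /=; rewrite in_itv/= andbT.
  rewrite -[X in measurable X]setTI.
  have m1 : measurable_fun setT (fun w => `|Y t w - c|).
    by apply: measurableT_comp => //; apply: measurable_funB.
  exact: m1.
apply/fine_cvgP; split; first by apply: nearW => t; exact: fin_num_measure.
apply/cvgrPdist_lt => delta delta0.
have /fine_cvgP[_ lim0r] := lim0.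
have [m _ hm] := cvgr_lt _ (@lim0r) _ delta0.
have {}hm := hm m (leqnn m).
have Lfin : (\int[P']_w (f m (xi w))%:E \is a fin_num)%E.
  apply: integrable_fin_num => //.
  apply: (@le_integrable _ _ _ _ _ _ _ (cst 1%E)) => //.
  - by apply/measurable_EFinP; exact: measurableT_comp (mf m) mxi.
  - by move=> w _; rewrite /= lee_fin normr1 fb.
  - exact: finite_measure_integrable_cst.
have := hcv (f m) (cf m) (fb m); rewrite -(fineK Lfin) => /fine_cvgP[fin cv].
have near1 : \forall t \near +oo,
    fine (\int[P t]_w (f m (Num.sqrt t * (Y t w - c)))%:E)%E < delta.
  exact: cvgr_lt _ (@cv) _ hm.
near=> t.
have t0 : 0 < t by near: t; exact: nbhs_pinfty_gt.
(* From here on, a deviation larger than [eps] forces the test function [f m] to equal 1. *)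
have tm : m.+1%:R <= Num.sqrt t * eps.
  have : (m.+1%:R / eps) ^+ 2 <= t by near: t; apply: nbhs_pinfty_ge; exact: num_real.
  rewrite -ler_pdivrMr// => h; rewrite -[leLHS]ger0_norm ?divr_ge0 ?(ltW eps0)// -sqrtr_sqr.
  by rewrite ler_wsqrtr.
rewrite sub0r normrN ger0_norm ?fine_ge0//.
have h1 : fine (\int[P t]_w (f m (Num.sqrt t * (Y t w - c)))%:E)%E < delta by near: t.
apply: le_lt_trans h1.
apply: fine_le.
- exact: fin_num_measure.
- by near: t.
rewrite -[X in P t X]setIT -integral_indic//.
apply: ge0_le_integral => //.
- by apply/measurable_EFinP; apply: measurable_indic.
- apply/measurable_EFinP; apply: measurableT_comp; first exact: mf.
  by apply: measurable_funM => //; apply: measurable_funB.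
- move=> w _; rewrite lee_fin indicE; have [/set_mem/= hw|_] := boolP (w \in _); last exact: f0.
  rewrite /f le_min lexx/= ler_pdivlMr// mul1r (le_trans tm)// normrM.
  by rewrite ger0_norm// ler_wpM2l// ltW.
Unshelve. all: by end_near. Qed.
End expectation_bounded.

(** * Fluctuations around the Jacobi roots *)

Section jacobi_limit.
Context {R : realType}.
Variables (M : nat) (alpha : R) (J : nat -> {poly R}).
Variable j : forall N, (minn N M).-tuple R.
Hypotheses (M0 : (1 <= M)%N) (alpha0 : 0 < alpha).
Hypothesis hJ : forall N, (1 <= N)%N ->
  orthogonal_poly (jacobi_weight alpha M N) (minn N M) (J N).
Hypothesis hj : forall N, (1 <= N)%N -> enumerates_roots01 (J N) (j N).
Local Notation dim := (fun k => minn k M).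
Local Notation row k := ((minn k M).-tuple R).
Notation unif := (uniform_prob (@ltr01 R)).

Definition jacobi_curv k (m : 'I_(minn k.+1 M)) : R :=
  row_curv (node_charge alpha M k) (node (j k)) (j k.+1) m.

(** Sensitivity of the [m]-th critical point to the displacement of entry [i] of the row below, by
    implicit differentiation of the critical equation; the shift [i.+1] skips the node 0. *)
Definition jacobi_coef k (m : 'I_(minn k.+1 M)) (i : 'I_(minn k M)) : R :=
  node_charge alpha M k i.+1 / (tnth (j k.+1) m - node (j k) i.+1) ^+ 2 / jacobi_curv m.

Definition jacobi_sigma k (m : 'I_(minn k.+1 M)) : R := (Num.sqrt (jacobi_curv m))^-1.

Let slot_j k (m : 'I_(minn k.+1 M)) : slot (node (j k)) m (tnth (j k.+1) m).
Proof. by have [] := jacobi_roots_critical M0 alpha0 hJ hj m. Qed.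

Let charge0 k i : (i < (minn k.+1 M).+1)%N -> 0 < node_charge alpha M k i.
Proof. exact: node_charge_gt0. Qed.

Let node_lt k i l : (i < l)%N -> (l < (minn k.+1 M).+1)%N -> node (j k) i < node (j k) l.
Proof. exact: (node_row_lt M0 alpha0 hj). Qed.

Let jacobi_curv_gt0 k (m : 'I_(minn k.+1 M)) : 0 < jacobi_curv m.
Proof.
apply: (@curv_gt0 _ (minn k.+1 M).+1 (fun i => node_charge alpha M k i)
  (fun i => tnth (j k.+1) m - node (j k) i)) => // [i|i]; first exact: charge0.
have /andP[h1 h2] := slot_j m; rewrite subr_eq0.
have [im|mi] := leqP i m.
  rewrite gt_eqF// (le_lt_trans _ h1)//.
  by move: im; rewrite leq_eqVlt => /predU1P[->//|im]; rewrite ltW// node_lt// leqW.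
rewrite lt_eqF// (lt_le_trans h2)//.
by move: mi; rewrite leq_eqVlt => /predU1P[->//|mi]; rewrite ltW// node_lt.
Qed.

Let sigma0 k (m : 'I_(minn k.+1 M)) : 0 < jacobi_sigma m.
Proof. by rewrite invr_gt0 sqrtr_gt0. Qed.

(** The displacements [nth 0 (0 :: u)] vanish at the fixed node 0 and, by default, at the node 1, so
    only entries of [u] contribute to the slope. *)
Lemma row_mean_jacobi k (u : row k) (m : 'I_(minn k.+1 M)) :
  row_slope (node_charge alpha M k) (node (j k)) (nth 0 (0 :: u)) (j k.+1) m / jacobi_curv m =
  row_mean (dim := dim) jacobi_coef u m.
Proof.
rewrite /row_slope big_ord_recl /= mulr0 mul0r add0r mulr_suml /row_mean.
have le : (minn k M <= minn k.+1 M)%N by lia.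
pose F i := node_charge alpha M k i.+1 * nth 0 u i / (tnth (j k.+1) m - node (j k) i.+1) ^+ 2 / jacobi_curv m.
transitivity (\sum_(i < minn k.+1 M) F i); first by apply: eq_bigr.
rewrite (eq_bigr (fun i : 'I_(minn k M) => F i)) => [|i _]; last first.
  by rewrite /F /jacobi_coef (tnth_nth 0 u); ring.
rewrite (big_ord_widen _ F le) [RHS]big_mkcond; apply: eq_bigr => i _.
by case: ltnP => // ki; rewrite /F nth_default ?size_tuple// mulr0 !mul0r.
Qed.

Definition scaled_weight (theta e : R) k (u : row k) (v : row k.+1) : R :=
  forward_weight alpha theta (affine_tuple (j k) e u) (affine_tuple (j k.+1) e v).

Lemma node_affine k e (u : row k) i :
  node (affine_tuple (j k) e u) i = node (j k) i + e * nth 0 (0 :: u) i.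
Proof.
case: i => [|i]; first by rewrite /node/= mulr0 addr0.
rewrite /node/=; have [ik|ki] := ltnP i (minn k M).
  pose o := Ordinal ik; rewrite -[i]/(nat_of_ord o).
  by rewrite -(tnth_nth 1 (affine_tuple (j k) e u) o) -(tnth_nth 1 (j k) o) -(tnth_nth 0 u o) tnth_mktuple.
by rewrite !nth_default ?size_tuple ?card_ord// mulr0 addr0.
Qed.

Lemma scaled_density_cvg (e t : nat -> R) k (u : row k) (v : row k.+1) :
  e n @[n --> \oo] --> (0 : R) -> (\forall n \near \oo, 0 < e n) ->
  (\forall n \near \oo, t n = (e n ^+ 2)^-1) ->
  forward_density dim (scaled_weight (t n) (e n)) k u v @[n --> \oo] -->
  gaussian_density (dim := dim) jacobi_coef jacobi_sigma u v.
Proof.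
move=> e_cvg e0 tE.
have crit (m : 'I_(minn k.+1 M)) := (jacobi_roots_critical M0 alpha0 hJ hj m).2.
have := row_weight_cvg (eta := nth 0 (0 :: u)) (@charge0 k) (@node_lt k) (@slot_j k) crit e_cvg e0 tE (v := v).
rewrite /gaussian_density.
under eq_bigr do rewrite row_mean_jacobi.
rewrite /forward_density /scaled_weight /forward_weight => h.
have nE n : node (affine_tuple (j k) (e n) u) = (fun i => node (j k) i + e n * nth 0 (0 :: u) i).
  by apply/funext => i; exact: node_affine.
by apply: cvg_near_eq (@h); apply: nearW => n; rewrite nE.
Qed.

Lemma array_density_cvg (e t : nat -> R) N (x : array dim N) :
  e n @[n --> \oo] --> (0 : R) -> (\forall n \near \oo, 0 < e n) ->
  (\forall n \near \oo, t n = (e n ^+ 2)^-1) ->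
  array_density (forward_density dim (scaled_weight (t n) (e n))) x @[n --> \oo] -->
  array_density (gaussian_density (dim := dim) jacobi_coef jacobi_sigma) x.
Proof.
move=> e_cvg e0 tE; elim: N x => [|N IH] x; first exact: cvg_cst.
by apply: cvgM; [exact: IH|exact: scaled_density_cvg].
Qed.

Lemma scaled_weight_ge0 theta e k u v : 0 <= @scaled_weight theta e k u v.
Proof. exact: row_weight_ge0. Qed.

Lemma measurable_forward_weight theta k :
  measurable_fun setT (fun z : row k * row k.+1 => forward_weight alpha theta z.1 z.2).
Proof.
apply: measurable_row_weight => //.
by move=> i; exact: measurableT_comp (measurable_node i) (@measurable_fst _ _ _ _).
Qed.

Lemma measurable_scaled_weight theta e k :
  measurable_fun setT (fun z : row k * row k.+1 => scaled_weight theta e z.1 z.2).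
Proof.
apply: (measurableT_comp (@measurable_forward_weight theta k)
  (g := fun z => (affine_tuple (j k) e z.1, affine_tuple (j k.+1) e z.2))).
apply: measurable_fun_pair.
  exact: measurableT_comp (measurable_affine_tuple _ _) (@measurable_fst _ _ _ _).
exact: measurableT_comp (measurable_affine_tuple _ _) (@measurable_snd _ _ _ _).
Qed.

Definition rescale (theta : R) k : row k -> row k :=
  affine_tuple [tuple - Num.sqrt theta * tnth (j k) i | i < minn k M] (Num.sqrt theta).

Lemma tnth_rescale theta k (v : row k) i :
  tnth (rescale theta v) i = Num.sqrt theta * (tnth v i - tnth (j k) i).
Proof. by rewrite !tnth_mktuple; ring. Qed.

(** The chain law holds for the unscaled array; substituting [j + v / sqrt theta] for it undoes
    [rescale] inside [g]. *)
Lemma rescaled_law theta d (T : measurableType d) (P : probability T R)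
    (r : forall N, {RV P >-> row N}) N (g : array dim N -> \bar R) :
  1 <= theta -> 1 <= theta * alpha -> jacobi_corners alpha theta r ->
  measurable_fun setT g -> (forall e, 0 <= g e)%E ->
  (\int[P]_w g (array_map (dim := dim) (fun k w => rescale theta (r k w)) N w) =
   \int[array_measure dim N]_e (g e * (array_density (forward_density dim
      (scaled_weight theta (Num.sqrt theta)^-1)) e)%:E))%E.
Proof.
move=> th1 tha1 hr mg g0.
have th0 : 0 < theta by exact: lt_le_trans th1.
(* The charges are [alpha + k], 1, or [M - k >= 1], so the two lower bounds on [theta] suffice. *)
have charge1 k i : (i < (minn k.+1 M).+1)%N -> 1 <= theta * node_charge alpha M k i.
  rewrite /node_charge; case: eqVneq => [_ _|_].
    by rewrite mulrDr (le_trans tha1)// lerDl mulr_ge0// ltW.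
  case: eqVneq => [->|_ _]; last by rewrite mulr1.
  rewrite ltnS leq_min leqnn/= => kM; rewrite (le_trans th1)// ler_peMr// ?(ltW th0)//.
  rewrite lerBrDr (_ : 1 + k%:R = k.+1%:R) ?ler_nat//.
  by rewrite addrC natr1.
pose s := Num.sqrt theta; have s0 : 0 < s by rewrite sqrtr_gt0.
pose bb k : row k := [tuple - s * tnth (j k) i | i < minn k M].
have mg' : measurable_fun setT (g \o @array_affine R dim bb s N).
  exact: measurableT_comp mg (@measurable_array_affine R dim bb s N).
transitivity (\int[P]_w (g \o @array_affine R dim bb s N) (array_map (dim := dim) r N w))%E.
  by apply: eq_integral => w _; rewrite /= -array_affine_map.
rewrite (corners_forward_law M0 charge1 hr mg'); last by move=> e; exact: g0.
have si0 : 0 < s^-1 by rewrite invr_gt0.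
pose w := @forward_weight R M alpha theta.
have w0 k u v : 0 <= w k u v by exact: row_weight_ge0.
have mw k u : measurable_fun setT (w k u).
  apply: (measurableT_comp (@measurable_forward_weight theta k) (g := fun v => (u, v))).
  exact: measurable_fun_pair.
have mD : measurable_fun setT (@array_density R dim (forward_density dim w) N).
  apply: measurable_array_density; apply: measurable_forward_density => // k.
  exact: measurable_forward_weight.
have D0 e : 0 <= @array_density R dim (forward_density dim w) N e.
  apply: array_density_ge0 => k u v; apply: divr_ge0 => //.
  by apply: fine_ge0; apply: integral_ge0 => z _; rewrite lee_fin.
pose G e := ((g \o @array_affine R dim bb s N) e *
  (@array_density R dim (forward_density dim w) N e)%:E)%E.
have mG : measurable_fun setT G by apply: emeasurable_funM => //; exact/measurable_EFinP.
have G0 e : (0 <= G e)%E by apply: mule_ge0; [exact: g0|rewrite lee_fin; exact: D0].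
pose c := s^-1 ^+ offset dim N; have c0 : 0 <= c by rewrite exprn_ge0// ltW.
pose GA e := G (@array_affine R dim j s^-1 N e).
have mGA : measurable_fun setT GA.
  by apply: measurableT_comp mG _; exact: measurable_array_affine.
(* The Jacobian [c] of the substitution is exactly the factor turning the product of transition
   densities into the one built from [scaled_weight]. *)
transitivity (c%:E * \int[array_measure dim N]_e GA e)%E.
  exact: (@integral_array_affine R dim (min0n M) j s^-1 N G si0 mG G0).
transitivity (\int[array_measure dim N]_e (c%:E * GA e))%E.
  by apply/esym; apply: ge0_integralZl => // e _; exact: G0.
apply: eq_integral => e _.
rewrite /GA /G /= muleCA -EFinM mulrC array_density_affine//.
by rewrite /bb array_affineK// gt_eqF.
Qed.

Section limit_theorem.
Context (d : R -> measure_display) (T : forall theta : R, measurableType (d theta))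
  (P : forall theta : R, probability (T theta) R)
  (r : forall (theta : R) (N : nat), {RV (P theta) >-> (minn N M).-tuple R}).
Hypothesis hr : forall theta : R, 0 < theta -> jacobi_corners alpha theta (r theta).

(** Limits at infinity are tested on arbitrary sequences [t n], to which [cvg_density] applies. The
    density formula requires [t n >= 1] and [t n * alpha >= 1], so it holds only eventually. *)
Lemma rescaled_cvg N (F : array dim N -> R) (C : R) : measurable_fun setT F ->
  (forall e, `|F e| <= C) ->
  (\int[P theta]_w (F (array_map (dim := dim)
     (fun k w => rescale theta (r theta k w)) N w))%:E)%E @[theta --> +oo] -->
  (\int[unif]_w (F (array_map (gaussian_row (dim := dim) jacobi_coef jacobi_sigma) N w))%:E)%E.
Proof.
move=> mF FC; apply/cvge_pinftyP => t too.
pose e n := (Num.sqrt (t n))^-1.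
have t_ge c : \forall n \near \oo, c <= t n by move/cvgryPge : too; exact.
have e0 : \forall n \near \oo, 0 < e n.
  by apply: filterS (t_ge 1) => n h; rewrite invr_gt0 sqrtr_gt0 (lt_le_trans ltr01).
have tE : \forall n \near \oo, t n = (e n ^+ 2)^-1.
  apply: filterS (t_ge 1) => n h; rewrite /e exprVn sqr_sqrtr ?invrK//.
  exact: le_trans ler01 h.
have e_cvg : e n @[n --> \oo] --> (0 : R).
  apply/cvgrPdist_lt => eps eps0.
  apply: filterS2 e0 (t_ge ((eps^-1 + 1) ^+ 2)) => n en h.
  rewrite sub0r normrN gtr0_norm// /e invf_plt ?posrE//; last first.
    by rewrite -invr_gt0.
  rewrite (@lt_le_trans _ _ (eps^-1 + 1)) ?ltrDl//.
  rewrite -[leLHS]ger0_norm -?sqrtr_sqr ?ler_wsqrtr//.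
  by rewrite addr_ge0// invr_ge0 ltW.
pose D_ n := @array_density R dim (forward_density dim (scaled_weight (t n) (e n))) N.
pose D := @array_density R dim (gaussian_density (dim := dim) jacobi_coef jacobi_sigma) N.
have mD_ n : measurable_fun setT (D_ n).
  apply: measurable_array_density; apply: measurable_forward_density => k.
    by move=> u v; exact: scaled_weight_ge0.
  exact: measurable_scaled_weight.
have mD : measurable_fun setT D.
  by apply: measurable_array_density => k; exact: (@measurable_gaussian_density R dim jacobi_coef jacobi_sigma sigma0).
have D_0 n x : 0 <= D_ n x.
  apply: array_density_ge0 => k u v; apply: divr_ge0; first exact: scaled_weight_ge0.
  by apply: fine_ge0; apply: integral_ge0 => z _; rewrite lee_fin scaled_weight_ge0.
have D0 x : 0 <= D x.
  apply: (@array_density_ge0 R dim _ N x) => k u v; exact: prod_normal_pdf_ge0.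
have law_ : \forall n \near \oo, forall g : array dim N -> \bar R,
    measurable_fun setT g -> (forall x, 0 <= g x)%E ->
    (\int[P (t n)]_w g (array_map (dim := dim) (fun k w => rescale (t n) (r (t n) k w)) N w) =
     \int[array_measure dim N]_x (g x * (D_ n x)%:E))%E.
  apply: filterS2 (t_ge 1) (t_ge alpha^-1) => n h1 h2 g mg g0.
  rewrite (rescaled_law h1 _ (hr _) mg g0)//.
    by rewrite -ler_pdivrMr// div1r.
  exact: lt_le_trans h1.
have law := (@gaussian_rows_law R dim (min0n M) jacobi_coef jacobi_sigma sigma0 N).2.
rewrite (density_transfer D0 law mF).
have := @cvg_density _ _ R (array_measure dim N) D_ D mD_ mD D_0 D0 _ _ _ F C mF FC.
move=> h; apply: cvg_trans (h _ _ _).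
- apply: near_eq_cvg; apply: filterS law_ => n ln.
  by rewrite (density_transfer (D_0 n) ln mF).
- apply: filterS law_ => n ln.
  transitivity (\int[array_measure dim N]_x (cst 1 x * (D_ n x)%:E))%E.
    by apply: eq_integral => x _; rewrite mul1e.
  rewrite -(ln (cst 1%E) (measurable_cst _) (fun=> @lee01 R)).
  by rewrite integral_cst// mul1e; exact: probability_setT.
- transitivity (\int[array_measure dim N]_x (cst 1 x * (D x)%:E))%E.
    by apply: eq_integral => x _; rewrite mul1e.
  rewrite -(law (cst 1%E) (measurable_cst _) (fun=> @lee01 R)).
  by rewrite integral_cst// mul1e; exact: probability_setT.
- by move=> x; exact: array_density_cvg.
Qed.

Definition jacobi_gaussian (Ni : {N : nat & 'I_(minn N M)}) : {RV unif >-> R} :=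
  [the {RV unif >-> R} of gaussian_entry (dim := dim) jacobi_coef jacobi_sigma Ni].

Lemma jacobi_fdd : cvg_fdd P
  (fun theta Ni w => Num.sqrt theta *
    (tnth (r theta (tag Ni) w) (tagged Ni) - tnth (j (tag Ni)) (tagged Ni)))
  unif (fun Ni => jacobi_gaussian Ni : _ -> R).
Proof.
move=> n s f cf [C fC].
(* Finitely many entries lie in the rows up to some [N], so the test function becomes a bounded
   function of a finite array. *)
pose N := \max_(k < n) tag (s k).
have sN k : (tag (s k) <= N)%N by exact: (leq_bigmax (F := fun k : 'I_n => tag (s k))).
pose F (e : array dim N) := f (\row_k array_coord e (tag (s k)) (tagged (s k))).
have mF : measurable_fun setT F.
  apply: measurable_continuous_row => // k; exact: measurable_array_coord.
have := @rescaled_cvg N F C mF (fun e => fC _).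
rewrite unlock.
have -> : (fun w => (f (\row_k jacobi_gaussian (s k) w))%:E) =
   (fun w => (F (array_map (gaussian_row (dim := dim) jacobi_coef jacobi_sigma) N w))%:E).
  apply/funext => w; congr (f _)%:E; apply/rowP => k; rewrite !mxE.
  by rewrite array_coord_map// -tnth_nth.
have -> : (fun theta => \int[P theta]_w (f (\row_k (Num.sqrt theta *
      (tnth (r theta (tag (s k)) w) (tagged (s k)) - tnth (j (tag (s k))) (tagged (s k))))))%:E)%E =
    (fun theta => \int[P theta]_w (F (array_map (dim := dim)
     (fun k w => rescale theta (r theta k w)) N w))%:E)%E.
  apply/funext => theta; apply: eq_integral => w _.
  congr (f _)%:E; apply/rowP => k; rewrite !mxE.
  by rewrite array_coord_map// -tnth_nth tnth_rescale.
by [].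
Qed.

(** The one-entry case of [jacobi_fdd] provides the test integrals, with row vectors of length 1 in
    place of scalars. *)
Lemma jacobi_cvg_probability N (i : 'I_(minn N M)) :
  cvg_in_probability P (fun theta w => tnth (r theta N w) i) (tnth (j N) i).
Proof.
apply: (@cvg_in_probability_scaled _ _ _ _ _ _ _ _ unif
  (jacobi_gaussian (existT _ N i))).
- move=> theta; exact: measurableT_comp (measurable_tnth i) _.
- exact: measurable_funPT.
- move=> f cf f1.
  pose g (v : 'rV[R]_1) := f (v ord0 ord0).
  have cg : continuous g.
    by move=> v; apply: continuous_comp; [exact: coord_continuous|exact: cf].
  have bg : exists C, forall v, `|g v| <= C by exists 1 => v; exact: f1.
  have := @jacobi_fdd 1 (fun=> existT _ N i) g cg bg; rewrite unlock.
  have gE (c : R) : g (\row_(k < 1) c) = f c by rewrite /g mxE.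
  under eq_fun do under eq_integral do rewrite gE.
  by under [X in _ --> X]eq_integral do rewrite gE.
Qed.
End limit_theorem.
End jacobi_limit.

Theorem theorem5p1 (R : realType) (M : nat) (alpha : R)
    (hM : (1 <= M)%N) (halpha : 0 < alpha)
    (d : R -> measure_display)
    (T : forall theta : R, measurableType (d theta))
    (P : forall theta : R, probability (T theta) R)
    (r : forall (theta : R) (N : nat), {RV (P theta) >-> (minn N M).-tuple R})
    (hr : forall theta : R, 0 < theta ->
       jacobi_corners alpha theta (r theta))
    (J : nat -> {poly R})
    (hJ : forall N : nat, (1 <= N)%N ->
       orthogonal_poly (jacobi_weight alpha M N) (minn N M) (J N))
    (j : forall N : nat, (minn N M).-tuple R)
    (hj : forall N : nat, (1 <= N)%N -> enumerates_roots01 (J N) (j N)) :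
  (forall (N : nat) (i : 'I_(minn N M)), (1 <= N)%N ->
     cvg_in_probability P (fun theta w => tnth (r theta N w) i) (tnth (j N) i))
  /\
  (exists (d' : measure_display) (T' : measurableType d')
     (P' : probability T' R)
     (xi : {N : nat & 'I_(minn N M)} -> {RV P' >-> R}),
     centered_gaussian xi /\
     cvg_fdd P
       (fun theta Ni w => Num.sqrt theta *
          (tnth (r theta (tag Ni) w) (tagged Ni)
           - tnth (j (tag Ni)) (tagged Ni)))
       P' (fun Ni => xi Ni : T' -> R)).
Proof.
split; first by move=> N i _; exact: (jacobi_cvg_probability hM halpha hJ hj hr).
exists _, (measurableTypeR R), (uniform_prob (@ltr01 R)), (jacobi_gaussian alpha j); split.
  exact: (gaussian_array_centered (min0n M)).
exact: (jacobi_fdd hM halpha hJ hj hr).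
Qed.
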